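(* Let $N\ge2$ be an integer, $\theta\in\mathbb R\setminus\mathbb Q$, $r_0(0),r_1(0)\in\mathbb N$, and $l_{j,k}(n)\in\mathbb N$ for $n\in\mathbb Z_{\ge0}$ and $j,k\in\{0,1\}$, and let $A$ and $\alpha\colon S^1\to\operatorname{Aut}(A)$ be the C*-algebra and action constructed from these data as described in the context. Assume that $r_0(0)\le r_1(0)$ and that for all $n\in\mathbb Z_{\ge0}$ we have $$l_{1,0}(n)\ge l_{0,0}(n),\quad l_{0,1}(n)\ge l_{0,0}(n),\quad l_{1,1}(n)\ge l_{0,1}(n),\quad\text{and}\quad l_{1,1}(n)\ge l_{1,0}(n).$$ Further assume that $$\lim_{n\to\infty}\frac{l_{0,1}(n)}{l_{0,0}(n)}=\infty\quad\text{and}\quad\lim_{n\to\infty}\frac{l_{1,1}(n)}{l_{1,0}(n)}=\infty.$$ Then $\alpha$ has the tracial Rokhlin property with comparison and has the modified tracial Rokhlin property. Moreover, given finite sets $F\subseteq A$, $F_0\subseteq A^\alpha$, and $S\subseteq C(S^1)$, as well as $\varepsilon>0$, $x\in A_+$ with $\|x\|=1$, and $y\in(A^\alpha)_+\setminus\{0\}$, it is possible to choose a projection $p\in A^\alpha$, a unital completely positive contractive map $\varphi\colon C(S^1)\to pAp$, and a partial isometry $s\in A^\alpha$ such that the conditions in the definition of the tracial Rokhlin property with comparison (for $F,S,\varepsilon,x,y$) and the conditions in the definition of the modified tracial Rokhlin property (for $F_1=F$, $F_2=F_0$, $S,\varepsilon,x$) are simultaneously satisfied.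
   Context: $\mathbb N=\{1,2,\ldots\}$; $S^1$ is the circle group. Construction of $(A,\alpha)$. For a homomorphism $\psi\colon C\to D$ of C*-algebras let $\psi^{(k)}_n\colon M_n(C)\to M_{kn}(D)$ be $\operatorname{id}_{M_n}\otimes\psi^{(k)}$, where $\psi^{(k)}(a)=1_{M_k}\otimes\psi(a)$. Let $\beta\colon S^1\to\operatorname{Aut}(C(S^1))$ be $\beta_\zeta(f)(z)=f(\zeta^{-1}z)$ and, for $\lambda\in\mathbb R$, $\widetilde\beta_\lambda=\beta_{\exp(2\pi i\lambda)}$. Let $\omega=\exp(2\pi i/N)$ and let $u\in M_N$ be the permutation matrix with entries $1$ in positions $(j,j+1)$, $1\le j\le N-1$, and $(N,1)$, and $0$ elsewhere. Let $R=\{f\in C(S^1,M_N)\colon f(\omega z)=uf(z)u^*\text{ for all }z\in S^1\}$, which is invariant under $\operatorname{id}_{M_N}\otimes\beta_\zeta$; let $\gamma\colon S^1\to\operatorname{Aut}(R)$ be the restriction of this action. Let $\iota\colon R\to C(S^1,M_N)=M_N(C(S^1))$ be the inclusion, and let $\xi\colon C(S^1)\to R$ be $\xi(f)(z)=\operatorname{diag}(f(z),f(\omega z),\ldots,f(\omega^{N-1}z))$. Define recursively $r_0(n+1)=l_{0,0}(n)r_0(n)+l_{0,1}(n)r_1(n)$ and $r_1(n+1)=Nl_{1,0}(n)r_0(n)+2Nl_{1,1}(n)r_1(n)$. For $n\ge0$ set $A_{n,0}=M_{r_0(n)}(R)$, $A_{n,1}=M_{r_1(n)}(C(S^1))$,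 $A_n=A_{n,0}\oplus A_{n,1}$, with action $\alpha^{(n)}_\zeta=(\operatorname{id}_{M_{r_0(n)}}\otimes\gamma_\zeta)\oplus(\operatorname{id}_{M_{r_1(n)}}\otimes\beta_\zeta)$. Set $\nu_{n,0,0}=(\operatorname{id}_R)^{(l_{0,0}(n))}_{r_0(n)}$, $\nu_{n,0,1}=\xi^{(l_{0,1}(n))}_{r_1(n)}$, $\nu_{n,1,0}=\iota^{(l_{1,0}(n))}_{r_0(n)}$, and let $\nu_{n,1,1}\colon A_{n,1}\to M_{2Nl_{1,1}(n)r_1(n)}(C(S^1))$ be the block diagonal sum of the $2N$ maps $(\widetilde\beta_\lambda)^{(l_{1,1}(n))}_{r_1(n)}$ for $\lambda=0,\tfrac1N,\ldots,\tfrac{N-1}N,\theta,\theta+\tfrac1N,\ldots,\theta+\tfrac{N-1}N$ (in this order). Define $\nu_n\colon A_n\to A_{n+1}$ by $\nu_n(a_0,a_1)=\bigl(\operatorname{diag}(\nu_{n,0,0}(a_0),\nu_{n,0,1}(a_1)),\operatorname{diag}(\nu_{n,1,0}(a_0),\nu_{n,1,1}(a_1))\bigr)$. These maps are equivariant. Let $A=\varinjlim_nA_n$ and $\alpha=\varinjlim\alpha^{(n)}$. Definitions. For a C*-algebra $C$ and $a,b\in C_+$, $a\precsim_Cb$ means Cuntz subequivalence in $C$. Let $\alpha$ be an action of a second countable compact group $G$ on an infinite dimensional simple separable unital C*-algebra $A$, with fixed point algebra $A^\alpha$; $\mathtt{Lt}_g(f)(h)=f(g^{-1}h)$ on $C(G)$.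 For a projection $p\in A^\alpha$, finite $F\subseteq A$, $S\subseteq C(G)$ and $\varepsilon>0$, a unital completely positive map $\varphi\colon C(G)\to pAp$ is $(F,S,\varepsilon)$-approximately equivariant central multiplicative if $\|\varphi(f_1f_2)-\varphi(f_1)\varphi(f_2)\|<\varepsilon$, $\|\varphi(f)a-a\varphi(f)\|<\varepsilon$, and $\sup_{g\in G}\|\varphi(\mathtt{Lt}_g(f))-\alpha_g(\varphi(f))\|<\varepsilon$ for all $f,f_1,f_2\in S$ and $a\in F$. Tracial Rokhlin property with comparison: for all finite $F\subseteq A$, $S\subseteq C(G)$, every $\varepsilon>0$, every $x\in A_+$ with $\|x\|=1$, and every $y\in(A^\alpha)_+\setminus\{0\}$, there are a projection $p\in A^\alpha$ and a unital completely positive $\varphi\colon C(G)\to pAp$ such that: (1) $\varphi$ is $(F,S,\varepsilon)$-approximately equivariant central multiplicative; (2) $1-p\precsim_Ax$; (3) $1-p\precsim_{A^\alpha}y$; (4) $1-p\precsim_{A^\alpha}p$; (5) $\|pxp\|>1-\varepsilon$. Modified tracial Rokhlin property: for all finite $F_1\subseteq A$, $F_2\subseteq A^\alpha$, $S\subseteq C(G)$, every $\varepsilon>0$, and every $x\in A_+$ with $\|x\|=1$, there are a projection $p\in A^\alpha$, a partial isometry $s\in A^\alpha$, and a unital completely positive contractive map $\varphi\colon C(G)\to pAp$ such that: (1) $\varphi$ is $(F_1,S,\varepsilon)$-approximately equivariant central multiplicative; (2) $1-p\precsim_Ax$; (3) $s^*s=1-p$ and $ss^*\le p$; (4) $\|sa-as\|<\varepsilon$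 for all $a\in F_2$; (5) $\|pxp\|>1-\varepsilon$. *)

(* Defs.v *)
From HB Require Import structures.
From mathcomp Require Import all_boot all_order all_algebra complex mxtens.
From mathcomp Require Import all_classical all_reals all_analysis.

Set Implicit Arguments.
Unset Strict Implicit.
Unset Printing Implicit Defensive.

Import Order.TTheory GRing.Theory Num.Theory numFieldNormedType.Exports.

Local Open Scope classical_set_scope.
Local Open Scope complex_scope.
Local Open Scope ring_scope.

(* Unital *-algebras over R[i], with the scalars given by a ring homomorphism
   into the centre.  The library's algType is not used because it excludes the
   zero ring, hence also matrix algebras 'M_n for an arbitrary n. *)
HB.mixin Record isStarAlgebra (R : realType) A of GRing.PzRing A := {
  scal : R[i] -> A;
  star : A -> A;
  scal1 : scal 1 = 1;
  scalD : {morph scal : c d / c + d};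
  scalM : {morph scal : c d / c * d};
  scalC : forall c a, scal c * a = a * scal c;
  starK : involutive star;
  starD : {morph star : a b / a + b};
  starM : forall a b, star (a * b) = star b * star a;
  star_scal : forall c, star (scal c) = scal c^*;
}.

#[short(type="starAlgType")]
HB.structure Definition StarAlgebra (R : realType) :=
  {A of GRing.PzRing A & isStarAlgebra R A}.

(* The norm is given here rather than inherited from a normedModType: the
   library has no structure joining those with PzRing, and over R[i] their norm
   would take its values in R[i]. *)
HB.mixin Record isCStar (R : realType) A of StarAlgebra R A := {
  cnorm : A -> R;
  cnorm_eq0 : forall a, cnorm a = 0 -> a = 0;
  cnormD : forall a b, cnorm (a + b) <= cnorm a + cnorm b;
  cnormZ : forall c a, cnorm (scal c * a) = complex.Re `|c| * cnorm a;
  cnormM : forall a b, cnorm (a * b) <= cnorm a * cnorm b;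
  cnorm_star : forall a, cnorm (star a * a) = cnorm a ^+ 2;
  cnorm_complete : forall u : nat -> A,
    (forall e : R, 0 < e -> exists k, forall m n,
      (k <= m)%N -> (k <= n)%N -> cnorm (u m - u n) < e) ->
    exists l : A, cnorm (u n - l) @[n --> \oo] --> (0 : R);
}.

(* Unital C*-algebras; the zero algebra is allowed. *)
#[short(type="cstarType")]
HB.structure Definition CStar (R : realType) :=
  {A of StarAlgebra R A & isCStar R A}.

Definition clinear (R : realType) (A B : starAlgType R) (f : A -> B) :=
  {morph f : a b / a + b} /\ forall c a, f (scal c * a) = scal c * f a.

(* *-homomorphisms, not required to be unital. *)
Definition star_hom (R : realType) (A B : starAlgType R) (f : A -> B) :=
  [/\ clinear f, {morph f : a b / a * b} & {morph f : a / star a}].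

Section StarAlgebraNotions.
Variables (R : realType) (A : starAlgType R).
Implicit Types (B : set A) (a p s : A).

(* The positive elements b^* b of the *-subalgebra B *)
Definition positive_in B : set A := [set a | exists2 b, B b & a = star b * b].
Definition positive : set A := positive_in setT.

Definition is_projection p := star p = p /\ p * p = p.
Definition partial_isometry s := is_projection (star s * s).
Definition corner p : set A := [set p * a * p | a in setT].

End StarAlgebraNotions.

Section ProductAlgebra.
Variables (R : realType) (A B : starAlgType R).
Implicit Types x y : A * B.

Definition prod_scal (c : R[i]) : A * B := (scal c, scal c).
Definition prod_star x : A * B := (star x.1, star x.2).

Fact prod_scal1 : prod_scal 1 = 1.
Proof. by rewrite /prod_scal !scal1. Qed.
Fact prod_scalD : {morph prod_scal : c d / c + d}.
Proof. by move=> c d; rewrite /prod_scal !scalD. Qed.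
Fact prod_scalM : {morph prod_scal : c d / c * d}.
Proof. by move=> c d; rewrite /prod_scal !scalM. Qed.
Fact prod_scalC c x : prod_scal c * x = x * prod_scal c.
Proof. by congr (_, _); rewrite /= scalC. Qed.
Fact prod_starK : involutive prod_star.
Proof. by case=> a b; rewrite /prod_star/= !starK. Qed.
Fact prod_starD : {morph prod_star : x y / x + y}.
Proof. by move=> x y; rewrite /prod_star/= !starD. Qed.
Fact prod_starM x y : prod_star (x * y) = prod_star y * prod_star x.
Proof. by rewrite /prod_star/= !starM. Qed.
Fact prod_star_scal c : prod_star (prod_scal c) = prod_scal c^*.
Proof. by rewrite /prod_star/= !star_scal. Qed.

HB.instance Definition _ := isStarAlgebra.Build R (A * B)%type
  prod_scal1 prod_scalD prod_scalM prod_scalC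
  prod_starK prod_starD prod_starM prod_star_scal.
End ProductAlgebra.

Section MatrixAlgebra.
Variables (R : realType) (A : starAlgType R) (n : nat).
Implicit Types X Y : 'M[A]_n.

Definition mat_scal (c : R[i]) : 'M[A]_n := (scal c)%:M.
Definition mat_star X : 'M[A]_n := \matrix_(i, j) star (X j i).

Let star0 : star (0 : A) = 0.
Proof. by apply: (addrI (star 0 : A)); rewrite -starD !addr0. Qed.

Let star_sum (F : 'I_n -> A) : star (\sum_k F k) = \sum_k star (F k).
Proof. exact: (big_morph (star : A -> A) starD star0). Qed.

Fact mat_scal1 : mat_scal 1 = 1.
Proof. by rewrite /mat_scal scal1. Qed.
Fact mat_scalD : {morph mat_scal : c d / c + d}.
Proof. by move=> c d; rewrite /mat_scal scalD raddfD. Qed.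
Fact mat_scalM : {morph mat_scal : c d / c * d}.
Proof. by move=> c d; rewrite /mat_scal scalM rmorphM. Qed.
Fact mat_scalC c X : mat_scal c * X = X * mat_scal c.
Proof.
rewrite /mat_scal -diag_const_mx; apply/matrixP => i j.
rewrite -mulmxE mul_diag_mx mul_mx_diag !mxE; exact: scalC.
Qed.
Fact mat_starK : involutive mat_star.
Proof. by move=> X; apply/matrixP=> i j; rewrite !mxE starK. Qed.
Fact mat_starD : {morph mat_star : X Y / X + Y}.
Proof. by move=> X Y; apply/matrixP=> i j; rewrite !mxE starD. Qed.
Fact mat_starM X Y : mat_star (X * Y) = mat_star Y * mat_star X.
Proof.
apply/matrixP=> i j; rewrite !mxE star_sum.
by apply: eq_bigr => k _; rewrite !mxE starM.
Qed.
Fact mat_star_scal c : mat_star (mat_scal c) = mat_scal c^*.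
Proof.
apply/matrixP=> i j; rewrite !mxE eq_sym.
by case: eqP => _; rewrite ?mulr1n ?mulr0n ?star0 ?star_scal.
Qed.

HB.instance Definition _ := isStarAlgebra.Build R 'M[A]_n
  mat_scal1 mat_scalD mat_scalM mat_scalC
  mat_starK mat_starD mat_starM mat_star_scal.
End MatrixAlgebra.

Section ComplexContinuity.
Variables (R : realType) (T : topologicalType).
Implicit Types f g : T -> R[i]^o.

Lemma continuous_csub f g :
  continuous f -> continuous g -> continuous (f - g).
Proof. by move=> cf cg z; apply: continuousB; [exact: cf | exact: cg]. Qed.

Lemma continuous_cmul f g :
  continuous f -> continuous g -> continuous (f * g).
Proof.
by move=> cf cg z; apply: (@cvgM R[i] _ _ _ f g); [exact: cf | exact: cg].
Qed.

Lemma continuous_ccst (c : R[i]) : continuous (cst c : T -> R[i]^o).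
Proof. by move=> z; exact: cvg_cst. Qed.

Lemma continuous_conjc f : continuous f -> continuous (fun z => (f z)^* : R[i]^o).
Proof.
move=> cf z; apply/cvgrPdist_lt => e e0.
have /cvgrPdist_lt/(_ e e0) := cf z.
apply: filterS => w; congr (_ < _).
rewrite -[in RHS]rmorphB; symmetry; exact: norm_conjC.
Qed.

End ComplexContinuity.

Section Circle.
Variable R : realType.

Definition circle : Type := {z : R[i] | `|z| == 1}.
Definition Circle (z : R[i]) (z1 : `|z| == 1) : circle := exist _ z z1.
HB.instance Definition _ := [isSub of circle for (@proj1_sig R[i] _)].
HB.instance Definition _ := [Choice of circle by <:].
HB.instance Definition _ := Topological.copy circle
  (initial_topology (val : circle -> R[i]^o)).

Fact circle1_subproof : `|1 : R[i]| == 1. Proof. by rewrite normr1. Qed.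
Fact circleM_subproof (z w : circle) : `|val z * val w| == 1.
Proof. by rewrite normrM (eqP (valP z)) (eqP (valP w)) mulr1. Qed.
Fact circleV_subproof (z : circle) : `|(val z)^-1| == 1.
Proof. by rewrite normfV (eqP (valP z)) invr1. Qed.

Definition circle1 : circle := Circle circle1_subproof.
Definition circleM (z w : circle) : circle := Circle (circleM_subproof z w).
Definition circleV (z : circle) : circle := Circle (circleV_subproof z).

Fact circle_neq0 (z : circle) : val z != 0.
Proof. by rewrite -normr_eq0 (eqP (valP z)) oner_eq0. Qed.
Fact circleA : associative circleM.
Proof. by move=> x y z; apply: val_inj; rewrite /= mulrA. Qed.
Fact circle1l : left_id circle1 circleM.
Proof. by move=> x; apply: val_inj; rewrite /= mul1r. Qed.
Fact circle1r : right_id circle1 circleM.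
Proof. by move=> x; apply: val_inj; rewrite /= mulr1. Qed.
Fact circleVl : left_inverse circle1 circleV circleM.
Proof. by move=> x; apply: val_inj; rewrite /= mulVf// circle_neq0. Qed.
Fact circleVr : right_inverse circle1 circleV circleM.
Proof. by move=> x; apply: val_inj; rewrite /= mulfV// circle_neq0. Qed.
HB.instance Definition _ := isGroup.Build circle
  circleA circle1l circle1r circleVl circleVr.

Lemma circleMC (z w : circle) : (z * w = w * z)%g.
Proof. by apply: val_inj; rewrite /= mulrC. Qed.

Fact cis_subproof (t : R) : `|cos (2 * pi * t) +i* sin (2 * pi * t)| == 1.
Proof. by rewrite normc_def/= cos2Dsin2 sqrtr1. Qed.

(* exp (2 pi i t) *)
Definition cis (t : R) : circle := Circle (cis_subproof t).

Lemma cisD (s t : R) : cis (s + t) = (cis s * cis t)%g.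
Proof.
apply: val_inj => /=; rewrite !mulrDr cosD sinD.
by congr (_ +i* _); rewrite addrC.
Qed.

Lemma cis1 : cis 1 = 1%g.
Proof. by apply: val_inj; rewrite /= mulr1 mulr_natl cos2pi sin2pi. Qed.

Lemma cis0 : cis 0 = 1%g.
Proof. by apply: val_inj; rewrite /= mulr0 cos0 sin0. Qed.

Lemma cisX (t : R) n : (cis t ^+ n)%g = cis (n%:R * t).
Proof.
elim: n => [|n IH]; first by rewrite mul0r cis0.
by rewrite expgS IH -cisD -nat1r mulrDl mul1r.
Qed.

Lemma circle_translate_continuous (w : circle) :
  continuous (fun z : circle => (w * z)%g).
Proof.
apply: continuous_comp_initial.
apply: (@continuous_cmul R circle (cst (val w)) (val : circle -> R[i]^o)).
  exact: continuous_ccst.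
exact: initial_continuous.
Qed.

End Circle.

Section ContinuousFunctions.
Variable R : realType.

Definition continuous_pred : {pred circle R -> R[i]^o} :=
  fun f => `[< continuous f >].

Fact continuous_subring : GRing.subring_closed continuous_pred.
Proof.
split=> [|f g /asboolP cf /asboolP cg|f g /asboolP cf /asboolP cg].
- by apply/asboolP; exact: continuous_ccst.
- exact: (introT (asboolP _) (continuous_csub cf cg)).
- exact: (introT (asboolP _) (continuous_cmul cf cg)).
Qed.
HB.instance Definition _ := GRing.isSubringClosed.Build _ continuous_pred
  continuous_subring.

(* C(S^1) *)
Definition cfun : Type := {f : circle R -> R[i]^o | f \in continuous_pred}.
HB.instance Definition _ := [isSub of cfun for (@proj1_sig _ _)].
HB.instance Definition _ := [Choice of cfun by <:].
HB.instance Definition _ := GRing.SubChoice_isSubPzRing.Build _ _ cfun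
  continuous_subring.

Definition ceval (z : circle R) (f : cfun) : R[i] := val f z.

Lemma cfunP (f g : cfun) : (forall z, ceval z f = ceval z g) -> f = g.
Proof. by move=> fg; apply: val_inj; apply/funext. Qed.

Fact ceval_is_zmod_morphism z : zmod_morphism (ceval z).
Proof. by []. Qed.
HB.instance Definition _ z := GRing.isZmodMorphism.Build _ _ (ceval z)
  (ceval_is_zmod_morphism z).
Fact ceval_is_monoid_morphism z : monoid_morphism (ceval z).
Proof. by []. Qed.
HB.instance Definition _ z := GRing.isMonoidMorphism.Build _ _ (ceval z)
  (ceval_is_monoid_morphism z).

Definition mkcfun (f : circle R -> R[i]^o) (cf : continuous f) : cfun :=
  exist _ f (introT (asboolP _) cf).

Definition cfun_scal (c : R[i]) : cfun := mkcfun (@continuous_ccst R (circle R) c).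
Definition cfun_star (f : cfun) : cfun :=
  mkcfun (continuous_conjc (elimT (asboolP _) (valP f))).

Fact cfun_scal1 : cfun_scal 1 = 1. Proof. by apply: cfunP => z. Qed.
Fact cfun_scalD : {morph cfun_scal : c d / c + d}.
Proof. by move=> c d; apply: cfunP => z. Qed.
Fact cfun_scalM : {morph cfun_scal : c d / c * d}.
Proof. by move=> c d; apply: cfunP => z. Qed.
Fact cfun_scalC c f : cfun_scal c * f = f * cfun_scal c.
Proof. by apply: cfunP => z; rewrite !rmorphM mulrC. Qed.
Fact cfun_starK : involutive cfun_star.
Proof. by move=> f; apply: cfunP => z; exact: conjCK. Qed.
Fact cfun_starD : {morph cfun_star : f g / f + g}.
Proof. by move=> f g; apply: cfunP => z; exact: (rmorphD Num.conj (ceval z f) (ceval z g)). Qed.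
Fact cfun_starM f g : cfun_star (f * g) = cfun_star g * cfun_star f.
Proof.
apply: cfunP => z; rewrite rmorphM [RHS]mulrC; exact: (rmorphM Num.conj (ceval z f) (ceval z g)).
Qed.
Fact cfun_star_scal c : cfun_star (cfun_scal c) = cfun_scal c^*.
Proof. by apply: cfunP => z. Qed.

HB.instance Definition _ := isStarAlgebra.Build R cfun
  cfun_scal1 cfun_scalD cfun_scalM cfun_scalC
  cfun_starK cfun_starD cfun_starM cfun_star_scal.

Fact translate_continuous (w : circle R) (f : cfun) :
  continuous (fun z : circle R => val f (w^-1 * z)%g).
Proof.
move=> z; apply: (@continuous_comp _ _ _ (fun z => (w^-1 * z)%g) (val f)).
  exact: circle_translate_continuous.
exact: (elimT (asboolP _) (valP f)).
Qed.

(* z |-> f (w^-1 z): both the action beta_w and the left translation Lt_w *)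
Definition translate (w : circle R) (f : cfun) : cfun :=
  mkcfun (@translate_continuous w f).

(* supremum norm *)
Definition cfun_norm (f : cfun) : R :=
  sup [set complex.Re `|ceval z f| | z in [set: circle R]].

End ContinuousFunctions.

Section AlgebraR.
Variables (R : realType) (N : nat).

Definition eval_mx (z : circle R) (F : 'M[cfun R]_N) : 'M[R[i]]_N :=
  map_mx (ceval z) F.

Definition shift_mx : 'M[R[i]]_N := \matrix_(i, j) (j == ordS i)%:R.

Definition omega : circle R := cis N%:R^-1.

(* C(S^1, M_N) is represented by 'M[cfun R]_N. *)
Definition algR_pred : {pred 'M[cfun R]_N} := fun F =>
  `[< forall z, eval_mx (omega * z)%g F =
        shift_mx *m eval_mx z F *m (map_mx Num.conj shift_mx^T) >].

Local Notation u := shift_mx.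
Local Notation u' := (map_mx Num.conj shift_mx^T).

Lemma shift_mxKl : u *m u' = 1%:M.
Proof.
apply/matrixP => i j; rewrite !mxE (bigD1 (ordS i))//= !mxE eqxx mul1r big1.
  by rewrite addr0 rmorph_nat (can_eq (@ordSK N)).
by move=> k /negPf ki; rewrite !mxE ki mul0r.
Qed.

Lemma shift_mxKr : u' *m u = 1%:M.
Proof. by apply: mulmx1C; exact: shift_mxKl. Qed.

Lemma shift_mx_conj (X : 'M[R[i]]_N) i j :
  (u *m X *m u') i j = X (ordS i) (ordS j).
Proof.
rewrite mxE (bigD1 (ordS j))//= big1 ?addr0.
  rewrite !mxE eqxx rmorph1 mulr1 (bigD1 (ordS i))//= big1 ?addr0.
    by rewrite !mxE eqxx mul1r.
  by move=> k /negPf ki; rewrite !mxE ki mul0r.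
by move=> k /negPf kj; rewrite !mxE kj rmorph0 mulr0.
Qed.

Lemma algR_predP (F : 'M[cfun R]_N) :
  reflect (forall z i j,
    ceval (omega * z)%g (F i j) = ceval z (F (ordS i) (ordS j)))
  (F \in algR_pred).
Proof.
apply: (iffP (asboolP _)) => FR z.
  by move=> i j; have /matrixP/(_ i j) := FR z; rewrite shift_mx_conj !mxE.
by apply/matrixP => i j; rewrite shift_mx_conj !mxE.
Qed.

Fact algR_subring : GRing.subring_closed algR_pred.
Proof.
split=> [|F G /algR_predP FR /algR_predP GR|F G /algR_predP FR /algR_predP GR].
- by apply/algR_predP => z i j; rewrite !mxE !rmorph_nat (can_eq (@ordSK N)).
- by apply/algR_predP => z i j; rewrite !mxE !rmorphB/= FR GR.
- apply/algR_predP => z i j; rewrite !mxE !rmorph_sum/=.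
  rewrite [RHS](reindex_inj (can_inj (@ordSK N)))/=.
  by apply: eq_bigr => k _; rewrite !rmorphM/= FR GR.
Qed.
HB.instance Definition _ := GRing.isSubringClosed.Build _ algR_pred
  algR_subring.

Definition algR : Type := {F : 'M[cfun R]_N | F \in algR_pred}.
Definition AlgR (F : 'M[cfun R]_N) (FR : F \in algR_pred) : algR :=
  exist _ F FR.
HB.instance Definition _ := [isSub of algR for (@proj1_sig _ _)].
HB.instance Definition _ := [Choice of algR by <:].
HB.instance Definition _ := GRing.SubChoice_isSubPzRing.Build _ _ algR
  algR_subring.

Fact algR_scal_subproof (c : R[i]) : scal c \in algR_pred.
Proof.
by apply/algR_predP => z i j; rewrite !mxE (can_eq (@ordSK N)); case: eqP.
Qed.
Fact algR_star_subproof (F : algR) : star (val F) \in algR_pred.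
Proof.
apply/algR_predP => z i j; rewrite !mxE; congr Num.conj.
exact: (algR_predP _ (valP F)).
Qed.

Definition algR_scal c : algR := AlgR (algR_scal_subproof c).
Definition algR_star F : algR := AlgR (algR_star_subproof F).

Fact algR_scal1 : algR_scal 1 = 1.
Proof. by apply: val_inj; rewrite /= scal1. Qed.
Fact algR_scalD : {morph algR_scal : c d / c + d}.
Proof. by move=> c d; apply: val_inj; rewrite /= scalD. Qed.
Fact algR_scalM : {morph algR_scal : c d / c * d}.
Proof. by move=> c d; apply: val_inj; rewrite /= scalM. Qed.
Fact algR_scalC c F : algR_scal c * F = F * algR_scal c.
Proof. by apply: val_inj; rewrite /= scalC. Qed.
Fact algR_starK : involutive algR_star.
Proof. by move=> F; apply: val_inj; rewrite /= starK. Qed.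
Fact algR_starD : {morph algR_star : F G / F + G}.
Proof. by move=> F G; apply: val_inj; rewrite /= starD. Qed.
Fact algR_starM F G : algR_star (F * G) = algR_star G * algR_star F.
Proof. by apply: val_inj; rewrite /= starM. Qed.
Fact algR_star_scal c : algR_star (algR_scal c) = algR_scal c^*.
Proof. by apply: val_inj; rewrite /= star_scal. Qed.

HB.instance Definition _ := isStarAlgebra.Build R algR
  algR_scal1 algR_scalD algR_scalM algR_scalC
  algR_starK algR_starD algR_starM algR_star_scal.

Fact gamma_subproof (w : circle R) (F : algR) :
  map_mx (translate w) (val F) \in algR_pred.
Proof.
apply/algR_predP => z i j; rewrite !mxE.
have := algR_predP _ (valP F) (w^-1 * z)%g i j.
by rewrite /ceval/= !mulgA [(omega * _)%g]circleMC.
Qed.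
Definition gamma w F : algR := AlgR (gamma_subproof w F).

Lemma omegaX : (0 < N)%N -> (omega ^+ N)%g = 1%g.
Proof. by move=> N0; rewrite /omega cisX divrr ?cis1// unitfE pnatr_eq0 -lt0n. Qed.

Fact xi_subproof (f : cfun R) :
  diag_mx (\row_(j < N) translate (omega ^- j)%g f) \in algR_pred.
Proof.
apply/algR_predP => z i j; rewrite !mxE (can_eq (@ordSK N)).
case: eqP => _; last by rewrite !mulr0n !rmorph0.
rewrite !mulr1n /ceval/=; congr (val f _).
rewrite !invgK mulgA -expgSr; congr (_ * _)%g.
rewrite {1}(divn_eq i.+1 N) expgnDr mulnC expgnA omegaX ?expg1n ?mul1g//.
exact: leq_ltn_trans (ltn_ord i).
Qed.
Definition xi f : algR := AlgR (xi_subproof f).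

Definition iota_R (F : algR) : 'M[cfun R]_N := val F.

End AlgebraR.

Section Construction.
Variables (R : realType) (N : nat) (theta : R) (r0 r1 : nat).
Variable l : 'I_2 -> 'I_2 -> nat -> nat.

(* M_n(M_m(D)) = M_nm(D) *)
Definition flatten_mx (D : Type) (n m : nat) (X : 'M['M[D]_m]_n) :
    'M[D]_(n * m) :=
  \matrix_(p, q) X (mxtens_unindex p).1 (mxtens_unindex q).1
                   (mxtens_unindex p).2 (mxtens_unindex q).2.

(* psi^(k)_n, the tensor product of id_{M_n} with c |-> 1_{M_k} (x) psi(c) *)
Definition amplify (C D : starAlgType R) (psi : C -> D) (k n : nat)
    (X : 'M[C]_n) : 'M[D]_(n * k) :=
  flatten_mx (map_mx (fun c => (psi c)%:M : 'M[D]_k) X).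

Definition block_diag (D : starAlgType R) (m n : nat) (X : 'I_m -> 'M[D]_n) :
    'M[D]_(m * n) :=
  flatten_mx (\matrix_(i, j) if i == j then X i else 0).

(* (r_0(n), r_1(n)); the factors are ordered so that the connecting maps below
   typecheck without casts. *)
Fixpoint ranks (n : nat) : nat * nat :=
  if n is m.+1 then
    ((ranks m).1 * l 0%R 0%R m + (ranks m).2 * l 0%R 1%R m,
     (ranks m).1 * l 1%R 0%R m * N + 2 * N * ((ranks m).2 * l 1%R 1%R m))%N
  else (r0, r1).

Definition sysA (n : nat) : starAlgType R :=
  ('M[algR R N]_((ranks n).1) * 'M[cfun R]_((ranks n).2))%type.

Definition sys_action (n : nat) (z : circle R) (a : sysA n) : sysA n :=
  (map_mx (gamma z) a.1, map_mx (translate z) a.2).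

(* 0, 1/N, ..., (N-1)/N, theta, theta + 1/N, ..., theta + (N-1)/N *)
Definition rotation_angle (j : 'I_(2 * N)) : R :=
  if (j < N)%N then j%:R / N%:R else theta + (j - N)%:R / N%:R.

Definition sys_map (n : nat) (a : sysA n) : sysA n.+1 :=
  (block_mx (amplify id (l 0 0 n) a.1) 0
            0 (amplify (@xi R N) (l 0 1 n) a.2),
   block_mx (flatten_mx (amplify (@iota_R R N) (l 1 0 n) a.1)) 0
            0 (block_diag (fun j =>
                 amplify (translate (cis (rotation_angle j))) (l 1 1 n) a.2))).

End Construction.

(* Direct limit in the category of C*-algebras, by its universal property.  No
   norm on the A_ n enters: a *-homomorphism between C*-algebras is
   automatically contractive.  Testing against unital B only is no restriction,
   because the *-homomorphisms need not be unital and every C*-algebra embeds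
   in its unitization. *)
Definition is_direct_limit (R : realType) (A_ : nat -> starAlgType R)
    (nu : forall n, A_ n -> A_ n.+1) (A : cstarType R)
    (mu : forall n, A_ n -> A) : Prop :=
  let cocone (B : cstarType R) (phi : forall n, A_ n -> B) :=
    (forall n, star_hom (phi n)) /\
    (forall n a, phi n.+1 (nu n a) = phi n a) in
  cocone A mu /\
  forall (B : cstarType R) (phi : forall n, A_ n -> B), cocone B phi ->
    exists! psi : A -> B, star_hom psi /\ forall n a, psi (mu n a) = phi n a.

Section Dynamics.
Variables (R : realType) (A : cstarType R).
Implicit Types (alpha : circle R -> A -> A) (F B I : set A) (S : set (cfun R)).
Implicit Types (a b p s x y : A) (phi : cfun R -> A) (e : R).

Definition is_action alpha : Prop :=
  [/\ forall z, star_hom (alpha z),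
      forall a, alpha 1%g a = a,
      forall z w a, alpha (z * w)%g a = alpha z (alpha w a) &
      forall a z0, cnorm (alpha z a - alpha z0 a) @[z --> z0] --> (0 : R)].

Definition fixed alpha : set A := [set a | forall z, alpha z a = a].

(* Cuntz subequivalence in the C*-subalgebra B *)
Definition cuntz_le B a b : Prop :=
  exists2 v : nat -> A, forall n, B (v n) &
    cnorm (v n * b * star (v n) - a) @[n --> \oo] --> (0 : R).

Definition closed_ideal I : Prop :=
  [/\ I 0, forall a b, I a -> I b -> I (a + b),
      forall a b, I a -> I (a * b) /\ I (b * a) &
      forall (u : nat -> A) a, (forall n, I (u n)) ->
        cnorm (u n - a) @[n --> \oo] --> (0 : R) -> I a].

Definition simple_algebra : Prop :=
  (1 : A) <> 0 /\ forall I, closed_ideal I -> I = [set 0] \/ I = [set: A].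

Definition separable_algebra : Prop :=
  exists2 D : set A, countable D &
    forall a e, 0 < e -> exists2 d, D d & cnorm (a - d) < e.

Definition infinite_dimensional : Prop :=
  ~ exists n (b : 'I_n -> A), forall a, exists c : 'I_n -> R[i],
      a = \sum_(i < n) scal (c i) * b i.

(* unital completely positive maps C(S^1) -> pAp *)
Definition ucp p phi : Prop :=
  [/\ clinear phi, phi 1 = p, forall f, corner p (phi f) &
      forall k (X : 'M[cfun R]_k), positive X ->
        positive_in [set Y : 'M[A]_k | forall i j, corner p (Y i j)]
          (map_mx phi X)].

Definition contractive phi : Prop := forall f, cnorm (phi f) <= cfun_norm f.

Definition approx_central_mult alpha F S e phi : Prop :=
  [/\ forall f1 f2, S f1 -> S f2 ->
        cnorm (phi (f1 * f2) - phi f1 * phi f2) < e,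
      forall f a, S f -> F a -> cnorm (phi f * a - a * phi f) < e &
      forall f, S f -> (ereal_sup [set (cnorm (phi (translate z f)
          - alpha z (phi f)))%:E | z in [set: circle R]] < e%:E)%E].

Definition trpc_conditions alpha F S e x y p phi : Prop :=
  [/\ approx_central_mult alpha F S e phi,
      cuntz_le setT (1 - p) x,
      cuntz_le (fixed alpha) (1 - p) y,
      cuntz_le (fixed alpha) (1 - p) p &
      1 - e < cnorm (p * x * p)].

Definition mtrp_conditions alpha F1 F2 S e x p s phi : Prop :=
  [/\ approx_central_mult alpha F1 S e phi,
      cuntz_le setT (1 - p) x,
      star s * s = 1 - p /\ positive (p - s * star s),
      forall a, F2 a -> cnorm (s * a - a * s) < e &
      1 - e < cnorm (p * x * p)].

(* The two properties below are defined for actions on such algebras only, so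
   this is part of having them. *)
Definition admissible_algebra : Prop :=
  [/\ infinite_dimensional, simple_algebra & separable_algebra].

Definition tracial_Rokhlin_with_comparison alpha : Prop :=
  admissible_algebra /\
  forall F S e x y, finite_set F -> finite_set S -> 0 < e ->
    positive x -> cnorm x = 1 -> positive_in (fixed alpha) y -> y <> 0 ->
  exists p phi,
    [/\ is_projection p, fixed alpha p, ucp p phi &
        trpc_conditions alpha F S e x y p phi].

Definition modified_tracial_Rokhlin alpha : Prop :=
  admissible_algebra /\
  forall F1 F2 S e x, finite_set F1 -> finite_set F2 -> F2 `<=` fixed alpha ->
    finite_set S -> 0 < e -> positive x -> cnorm x = 1 ->
  exists p s phi,
    [/\ is_projection p, fixed alpha p, partial_isometry s, fixed alpha s &
        [/\ ucp p phi, contractive phi &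
            mtrp_conditions alpha F1 F2 S e x p s phi]].

End Dynamics.

(* Main.v *)
Require Import Defs.
From HB Require Import structures.
From mathcomp Require Import all_boot all_order all_algebra complex mxtens.
From mathcomp Require Import all_classical all_reals all_analysis.
From mathcomp Require Import ring lra zify.

Set Implicit Arguments.
Unset Strict Implicit.
Unset Printing Implicit Defensive.

Import Order.TTheory GRing.Theory Num.Theory numFieldNormedType.Exports.

Local Open Scope classical_set_scope.
Local Open Scope complex_scope.
Local Open Scope ring_scope.


(** Let p_n be the unit of the summand M_{r_1(n)}(C(S^1)) of A_n, seen in A.
    The functions on the circle, as scalar matrices in this summand, form a
    copy of C(S^1) with unit p_n on which alpha acts by translation and which
    commutes with A_n (rokhlin).  As the union of the A_n is dense, this map
    satisfies the conditions of approximate equivariance, centrality and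
    multiplicativity for large n, and p = p_n is the projection to take.

    The partial isometry s comes from two inclusions between the summands.
    After a step of the system, the C(S^1)-component contains the R-component,
    embedded by iota, as a direct summand, because l_{1,0} >= l_{0,0} and
    l_{1,1} >= l_{0,1} and because xi is a sum of rotations that occur among the
    2N rotations of the step (sub_mx_intertwine).  Conversely, the identity of
    R is contained in xi o iota (xi_iota_shift).  Together they show that after
    a second step the image of 1 - p_{n+1} is carried below p_{n+1} by a fixed
    partial isometry which commutes with A_n (transfer_isometry, sys_swap).
    One consequence is that the C(S^1)-component alone determines the norm
    (cnorm_sys), whence |p x p| > 1 - e.

    For the comparison of 1 - p_n with a positive element d^* d of norm one,
    d^* d is first compressed to within distance < 1 of a minimal diagonal
    projection e of some A_m: up to a small error d lies in a matrix algebra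
    over C(S^1), a constant column turns it into a function which is large
    somewhere, and further steps of the system put its rotations by multiples
    of theta side by side on the diagonal; theta is irrational, so these are
    large everywhere together, and a partition of unity compresses them to 1
    (compress_to_unit).  If d is fixed by alpha, averaging over roots of unity
    makes the function almost constant, and the compression can be done with
    fixed elements (fixed_compress_to_unit).  Newton's iteration turns the
    approximate compression into Cuntz subequivalence (cuntz_le_of_close).  On
    the other hand the ranks of the images of e satisfy the same recursion as
    the sizes r_j(n), so they are at least a constant proportion of them, while
    the part of A_{n+1} occupied by 1 - p_n is of smaller order by the
    hypotheses on the limits; hence 1 - p_n lies below e, in the fixed point
    algebra (one_sub_proj_compare).

    The algebras A_n carry no norm.  A is described by its universal property:
    density of the images and mu 1 = 1 follow from uniqueness (limit_dense,
    limit1), and A is nonzero because bounded coherent sequences modulo null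
    sequences form a nonzero cocone (limit_one_neq0).  Norms in A are estimated
    by bounds valid in every C*-seminorm (hom_bound), ultimately because a
    *-homomorphism maps unitaries to partial isometries. *)

(** * Matrices over unital *-algebras *)

Section StarHoms.
Variable R : realType.
Implicit Types A B C : starAlgType R.

Lemma star0 A : star (0 : A) = 0.
Proof. by apply: (addrI (star 0 : A)); rewrite -starD !addr0. Qed.

Lemma star1 A : star (1 : A) = 1.
Proof. by rewrite -[LHS]mulr1 -[X in _ * X]starK -starM mulr1 starK. Qed.

Lemma starN A (a : A) : star (- a) = - star a.
Proof. by apply/eqP; rewrite -subr_eq0 opprK -starD addNr star0. Qed.

Lemma starB A (a b : A) : star (a - b) = star a - star b.
Proof. by rewrite starD starN. Qed.

Lemma star_sum A I (r : seq I) (P : pred I) (F : I -> A) :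
  star (\sum_(i <- r | P i) F i) = \sum_(i <- r | P i) star (F i).
Proof. exact: (big_morph (star : A -> A) (@starD R A) (@star0 A)). Qed.

Lemma star_nat A n : star (n%:R : A) = n%:R.
Proof. by elim: n => [|n IH]; rewrite ?star0// -natr1 starD IH star1. Qed.

Lemma scal0 A : scal 0 = 0 :> A.
Proof. by apply: (addrI (scal 0 : A)); rewrite -scalD !addr0. Qed.

Lemma scalN A c : scal (- c) = - scal c :> A.
Proof. by apply/eqP; rewrite -subr_eq0 opprK -scalD addNr scal0. Qed.

Lemma star_scal_real A (x : R) : star (scal x%:C) = scal x%:C :> A.
Proof. by rewrite star_scal; congr scal; exact: conjc_real. Qed.

Lemma scal_nat A n : scal n%:R = n%:R :> A.
Proof. by elim: n => [|n IH]; rewrite ?scal0// -natr1 scalD IH scal1 natr1. Qed.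

Lemma half_add A (a : A) : scal (2^-1)%:C * a + scal (2^-1)%:C * a = a.
Proof.
rewrite -mulrDl -scalD -rmorphD /=.
have -> : 2^-1 + 2^-1 = 1 :> R by lra.
by rewrite scal1 mul1r.
Qed.

Section Properties.
Variables (A B : starAlgType R) (f : A -> B).
Hypothesis hf : star_hom f.

Lemma star_homD a b : f (a + b) = f a + f b.
Proof. by case: hf => -[]. Qed.
Lemma star_homM a b : f (a * b) = f a * f b.
Proof. by case: hf. Qed.
Lemma star_homS a : f (star a) = star (f a).
Proof. by case: hf. Qed.
Lemma star_homZ c a : f (scal c * a) = scal c * f a.
Proof. by case: hf => -[]. Qed.
Lemma star_hom0 : f 0 = 0.
Proof. by apply: (addrI (f 0)); rewrite -star_homD !addr0. Qed.
Lemma star_homN a : f (- a) = - f a.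
Proof. by apply/eqP; rewrite -subr_eq0 opprK -star_homD addNr star_hom0. Qed.
Lemma star_homB a b : f (a - b) = f a - f b.
Proof. by rewrite star_homD star_homN. Qed.
Lemma star_hom_sum I (r : seq I) (P : pred I) (F : I -> A) :
  f (\sum_(i <- r | P i) F i) = \sum_(i <- r | P i) f (F i).
Proof. exact: (big_morph f star_homD star_hom0). Qed.
Lemma star_hom_proj : is_projection (f 1).
Proof. by split; rewrite -?star_homS -?star_homM ?star1 ?mulr1. Qed.
Lemma star_homX a n : f (a ^+ n.+1) = f a ^+ n.+1.
Proof. by elim: n => // n IH; rewrite exprS star_homM IH -exprS. Qed.
Lemma star_homMn a n : f (a *+ n) = f a *+ n.
Proof. by elim: n => [|n IH]; rewrite ?star_hom0// !mulrS star_homD IH. Qed.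
End Properties.

Lemma star_hom_id A : star_hom (@id A).
Proof. by []. Qed.

Lemma star_hom_comp A B C (f : A -> B) (g : B -> C) :
  star_hom f -> star_hom g -> star_hom (g \o f).
Proof.
move=> hf hg; split=> [|a b|a]; [split=> [a b|c a]| |] => /=.
- by rewrite (star_homD hf) (star_homD hg).
- by rewrite (star_homZ hf) (star_homZ hg).
- by rewrite (star_homM hf) (star_homM hg).
- by rewrite (star_homS hf) (star_homS hg).
Qed.

Lemma star_hom_fst A B : star_hom (fun x : A * B => x.1).
Proof. by []. Qed.
Lemma star_hom_snd A B : star_hom (fun x : A * B => x.2).
Proof. by []. Qed.

Lemma star_hom_pair A B C (f : A -> B) (g : A -> C) :
  star_hom f -> star_hom g -> star_hom (fun a => (f a, g a)).
Proof.
move=> hf hg; split=> [|a b|a]; [split=> [a b|c a]| |] => /=.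
- by rewrite (star_homD hf) (star_homD hg).
- by rewrite (star_homZ hf) (star_homZ hg).
- by rewrite (star_homM hf) (star_homM hg).
- by rewrite (star_homS hf) (star_homS hg).
Qed.

Lemma mx_scalE A n (c : R[i]) : scal c = (scal c)%:M :> 'M[A]_n.
Proof. by []. Qed.

Lemma mx_scalME A n (c : R[i]) (X : 'M[A]_n) i j :
  (scal c * X) i j = scal c * X i j.
Proof. by rewrite mx_scalE -mulmxE -diag_const_mx mul_diag_mx !mxE. Qed.

Lemma mx_starE A n (X : 'M[A]_n) i j : star X i j = star (X j i).
Proof. by rewrite mxE. Qed.

Lemma star_hom_map_mx A B n (f : A -> B) : star_hom f ->
  star_hom (map_mx f : 'M[A]_n -> 'M[B]_n).
Proof.
move=> hf; split=> [|X Y|X]; [split=> [X Y|c X]| |]; apply/matrixP => i j.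
- by rewrite !mxE (star_homD hf).
- by rewrite mxE !mx_scalME mxE (star_homZ hf).
- rewrite !mxE (star_hom_sum hf); apply: eq_bigr => k _.
  by rewrite (star_homM hf) !mxE.
- by rewrite !mxE (star_homS hf).
Qed.

Lemma star_hom_scalar_mx A n : star_hom (fun a : A => a%:M : 'M[A]_n).
Proof.
split=> [|X Y|X]; [split=> [X Y|c X]| |].
- by rewrite raddfD.
- exact: scalar_mxM.
- exact: scalar_mxM.
- apply/matrixP => i j; rewrite !mxE eq_sym.
  by case: eqP => _; rewrite ?mulr1n ?mulr0n ?star0.
Qed.

Lemma big_mxtens (V : nmodType) m n (F : 'I_(m * n) -> V) :
  \sum_p F p = \sum_i \sum_j F (mxtens_index (i, j)).
Proof.
rewrite pair_big/= (reindex (fun ij : 'I_m * 'I_n => mxtens_index ij))/=.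
  by apply: eq_bigr => -[].
by exists (@mxtens_unindex m n) => x _; rewrite (mxtens_indexK, mxtens_unindexK).
Qed.

Lemma mxtens_index_eq m n (i i' : 'I_m) (j j' : 'I_n) :
  (mxtens_index (i, j) == mxtens_index (i', j')) = (i == i') && (j == j').
Proof. by rewrite (can_eq (@mxtens_indexK m n)). Qed.

Lemma flatten_mxE (D : Type) n m (X : 'M['M[D]_m]_n) i j k l :
  flatten_mx X (mxtens_index (i, k)) (mxtens_index (j, l)) = X i j k l.
Proof. by rewrite mxE !mxtens_indexK. Qed.

Lemma matrix_tensP (D : Type) m n p q (X Y : 'M[D]_(m * n, p * q)) :
  (forall i k j l, X (mxtens_index (i, k)) (mxtens_index (j, l)) =
                   Y (mxtens_index (i, k)) (mxtens_index (j, l))) -> X = Y.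
Proof.
move=> XY; apply/matrixP => u v.
by case: (mxtens_indexP u) => i k; case: (mxtens_indexP v) => j l.
Qed.

Lemma star_hom_flatten A m n : star_hom (@flatten_mx A m n).
Proof.
split=> [|X Y|X]; [split=> [X Y|c X]| |]; apply: matrix_tensP => i k j l.
- by rewrite flatten_mxE [RHS]mxE !flatten_mxE !mxE.
- by rewrite mx_scalME !flatten_mxE !mx_scalME.
- rewrite flatten_mxE !mxE big_mxtens summxE; apply: eq_bigr => a _.
  by rewrite -mulmxE mxE; apply: eq_bigr => b _; rewrite !flatten_mxE.
- by rewrite mx_starE !flatten_mxE !mxE.
Qed.

Lemma amplifyE A B (psi : A -> B) k n (X : 'M[A]_n) i j a b :
  amplify psi k X (mxtens_index (i, a)) (mxtens_index (j, b)) =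
  psi (X i j) *+ (a == b).
Proof. by rewrite /amplify flatten_mxE !mxE. Qed.

Lemma star_hom_amplify A B (psi : A -> B) k n :
  star_hom psi -> star_hom (@amplify R A B psi k n).
Proof.
move=> hpsi; apply: star_hom_comp (star_hom_flatten _ _ _).
apply: star_hom_map_mx; apply: star_hom_comp hpsi (@star_hom_scalar_mx _ _).
Qed.

Lemma amplify1 A B (psi : A -> B) k n : star_hom psi -> psi 1 = 1 ->
  amplify psi k (1 : 'M[A]_n) = 1.
Proof.
move=> hpsi psi1; apply: matrix_tensP => i a j b.
rewrite amplifyE !mxE mxtens_index_eq.
by case: eqP => _ /=; rewrite ?mulr1n ?psi1 ?mulr0n ?(star_hom0 hpsi) ?mul0rn.
Qed.

Lemma block_diagE A m n (X : 'I_m -> 'M[A]_n) i j a b :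
  block_diag X (mxtens_index (i, a)) (mxtens_index (j, b)) = X i a b *+ (i == j).
Proof.
by rewrite /block_diag flatten_mxE mxE; case: eqP => _; rewrite ?mxE ?mulr1n.
Qed.

Lemma star_hom_block_diag A B m n (F : 'I_m -> A -> 'M[B]_n) :
  (forall i, star_hom (F i)) -> star_hom (fun a => block_diag (F^~ a)).
Proof.
move=> hF; split=> [|a b|a]; [split=> [a b|c a]| |];
    apply: matrix_tensP => i k j l; cbv beta.
- by rewrite [RHS]mxE !block_diagE (star_homD (hF i)) mxE mulrnDl.
- by rewrite mx_scalME !block_diagE (star_homZ (hF i)) mx_scalME mulrnAr.
- rewrite block_diagE (star_homM (hF i)) [RHS]mxE big_mxtens (bigD1 i)//=.
  rewrite [X in _ = _ + X]big1 => [|s si]; last first.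
    by apply: big1 => t _; rewrite block_diagE eq_sym (negPf si) mulr0n mul0r.
  rewrite mxE addr0 -sumrMnl; apply: eq_bigr => t _.
  by rewrite !block_diagE eqxx mulr1n mulrnAr.
- rewrite mx_starE !block_diagE (star_homS (hF i)) mxE eq_sym.
  by case: eqP => [->|_]; rewrite ?mulr1n ?mulr0n ?star0.
Qed.

Lemma star_hom_block A B m n (f : A -> 'M[B]_m) (g : A -> 'M[B]_n) :
  star_hom f -> star_hom g -> star_hom (fun a => block_mx (f a) 0 0 (g a)).
Proof.
move=> hf hg; split=> [|a b|a]; [split=> [a b|c a]| |].
- by rewrite add_block_mx !addr0 (star_homD hf) (star_homD hg).
- rewrite (star_homZ hf) (star_homZ hg) !mx_scalE -!mulmxE.
  by rewrite [_%:M in RHS]scalar_mx_block mulmx_block !(mulmx0, mul0mx, addr0, add0r).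
- rewrite (star_homM hf) (star_homM hg); symmetry; etransitivity.
    exact: mulmx_block.
  by rewrite !(mulmx0, mul0mx, addr0, add0r).
- apply/matrixP => i j; rewrite mx_starE (star_homS hf) (star_homS hg).
  by case: (split_ordP i) => i' ->; case: (split_ordP j) => j' ->;
    rewrite !(block_mxEul, block_mxEur, block_mxEdl, block_mxEdr) mxE ?star0// mxE star0.
Qed.
End StarHoms.

(** * Rectangular matrices and intertwiners *)

Section Rectangular.
Variable R : realType.
Implicit Types A B : starAlgType R.

Definition adj A m n (X : 'M[A]_(m, n)) : 'M[A]_(n, m) :=
  \matrix_(i, j) star (X j i).

Lemma adjM A m n p (X : 'M[A]_(m, n)) (Y : 'M[A]_(n, p)) :
  adj (X *m Y) = adj Y *m adj X.
Proof.
apply/matrixP => i j; rewrite !mxE star_sum; apply: eq_bigr => k _.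
by rewrite !mxE starM.
Qed.

Lemma adj_block A m n p q (X : 'M[A]_(m, p)) (Y : 'M[A]_(m, q)) (Z : 'M[A]_(n, p))
    (T : 'M[A]_(n, q)) :
  adj (block_mx X Y Z T) = block_mx (adj X) (adj Z) (adj Y) (adj T).
Proof.
apply/matrixP => i j; rewrite mxE.
by case: (split_ordP i) => i' ->; case: (split_ordP j) => j' ->;
  rewrite !(block_mxEul, block_mxEur, block_mxEdl, block_mxEdr) mxE.
Qed.

Lemma adj0 A m n : adj (0 : 'M[A]_(m, n)) = 0.
Proof. by apply/matrixP => i j; rewrite !mxE star0. Qed.

Lemma star_hom_mulmx A B (f : A -> B) m n p (X : 'M[A]_(m, n)) (Y : 'M[A]_(n, p)) :
  star_hom f -> map_mx f (X *m Y) = map_mx f X *m map_mx f Y.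
Proof.
move=> hf; apply/matrixP => i j; rewrite !mxE (star_hom_sum hf).
by apply: eq_bigr => k _; rewrite !mxE (star_homM hf).
Qed.

Lemma star_hom_map0 A B (f : A -> B) m n : star_hom f ->
  map_mx f (0 : 'M[A]_(m, n)) = 0.
Proof. by move=> hf; apply/matrixP => i j; rewrite !mxE (star_hom0 hf). Qed.

Lemma star_hom_adj A B (f : A -> B) m n (X : 'M[A]_(m, n)) :
  star_hom f -> map_mx f (adj X) = adj (map_mx f X).
Proof. by move=> hf; apply/matrixP => i j; rewrite !mxE (star_homS hf). Qed.

Definition inj_mx A m n (tau : 'I_n -> 'I_m) : 'M[A]_(m, n) :=
  \matrix_(i, j) (i == tau j)%:R.

Lemma adj_inj_mx A m n (tau : 'I_n -> 'I_m) : injective tau ->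
  adj (inj_mx A tau) *m inj_mx A tau = 1%:M.
Proof.
move=> tauI; apply/matrixP => i j; rewrite !mxE (bigD1 (tau j))//= big1.
  by rewrite !mxE eqxx mulr1 addr0 star_nat eq_sym (inj_eq tauI).
by move=> k kj; rewrite !mxE (negPf kj) mulr0.
Qed.

Lemma mulmx_inj_mx A m n p (Y : 'M[A]_(p, m)) (tau : 'I_n -> 'I_m) i j :
  (Y *m inj_mx A tau) i j = Y i (tau j).
Proof.
rewrite mxE (bigD1 (tau j))//= big1 ?addr0; last first.
  by move=> k kj; rewrite !mxE (negPf kj) mulr0.
by rewrite !mxE eqxx mulr1.
Qed.

(** X occurs in Y on the rows and columns in the range of tau, and Y maps this
    range to itself. *)
Lemma inj_mx_intertwine A m n (X : 'M[A]_n) (Y : 'M[A]_m) (tau : 'I_n -> 'I_m) :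
  injective tau ->
  (forall i j, Y (tau i) (tau j) = X i j) ->
  (forall p j, Y p (tau j) != 0 -> exists i, p = tau i) ->
  Y *m inj_mx A tau = inj_mx A tau *m X.
Proof.
move=> tauI YX Y0; apply/matrixP => p j; rewrite mulmx_inj_mx mxE.
have [[i ->]|np] := pselect (exists i, p = tau i).
  rewrite YX (bigD1 i)//= big1 ?addr0 => [|k ki].
    by rewrite !mxE eqxx mul1r.
  by rewrite !mxE (inj_eq tauI) eq_sym (negPf ki) mul0r.
rewrite big1 => [|k _]; first by apply/eqP/negPn/negP => /Y0.
by rewrite !mxE; case: eqP => [pk|_]; rewrite ?mul0r//; case: np; exists k.
Qed.

Lemma map_inj_mx A B (psi : A -> B) m n (tau : 'I_n -> 'I_m) :
  star_hom psi -> psi 1 = 1 -> map_mx psi (inj_mx A tau) = inj_mx B tau.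
Proof.
move=> hpsi psi1; apply/matrixP => i j; rewrite !mxE; case: eqP => _ //.
by rewrite (star_hom0 hpsi).
Qed.

Lemma mx_natE A n k i j : (k%:R : 'M[A]_n) i j = k%:R *+ (i == j).
Proof. by rewrite -(scal_nat 'M[A]_n k) mx_scalE mxE scal_nat. Qed.

End Rectangular.

Section Evaluation.
Variable R : realType.
Local Notation S1 := (circle R).
Implicit Types (f g : cfun R) (z w : S1).

Lemma cevalM z f g : ceval z (f * g) = ceval z f * ceval z g. Proof. by []. Qed.
Lemma ceval_star z f : ceval z (star f) = Num.conj (ceval z f). Proof. by []. Qed.
Lemma ceval_scal z c : ceval z (scal c : cfun R) = c. Proof. by []. Qed.
Lemma ceval_translate z w f : ceval z (translate w f) = ceval (w^-1 * z)%g f.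
Proof. by []. Qed.
Lemma ceval1 z : ceval z (1 : cfun R) = 1. Proof. by []. Qed.
Lemma ceval_nat z n : ceval z (n%:R : cfun R) = n%:R.
Proof. by rewrite rmorph_nat. Qed.

Lemma star_hom_translate w : star_hom (@translate R w).
Proof. by split=> [|f g|f]; [split=> [f g|c f]| |]; apply: cfunP => z. Qed.

Lemma translate_nat w n : translate w (n%:R : cfun R) = n%:R.
Proof. by apply: cfunP => z; rewrite ceval_translate !ceval_nat. Qed.

Lemma translate1 w : translate w (1 : cfun R) = 1.
Proof. exact: translate_nat w 1%N. Qed.

Lemma translate_id f : translate 1%g f = f.
Proof. by apply: cfunP => z; rewrite ceval_translate invg1 mul1g. Qed.

Lemma translateM w w' f : translate (w * w')%g f = translate w (translate w' f).
Proof. by apply: cfunP => z; rewrite !ceval_translate invgM mulgA. Qed.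

Variable N : nat.

Lemma omegaX_mod m : (0 < N)%N -> (omega R N ^+ (m %% N) = omega R N ^+ m)%g.
Proof.
by move=> N0; rewrite [in RHS](divn_eq m N) expgnDr mulnC expgnA omegaX// expg1n mul1g.
Qed.

Lemma star_hom_iota : star_hom (@iota_R R N).
Proof. by []. Qed.

Lemma star_hom_xi : star_hom (@xi R N).
Proof.
split=> [|f g|f]; [split=> [f g|c f]| |]; apply: val_inj => /=.
- by apply/matrixP => i j; rewrite !mxE (star_homD (star_hom_translate _)) mulrnDl.
- apply/matrixP => i j; rewrite mx_scalME !mxE.
  by rewrite (star_homZ (star_hom_translate _)) mulrnAr.
- rewrite -mulmxE mulmx_diag; congr diag_mx.
  by apply/rowP => j; rewrite !mxE (star_homM (star_hom_translate _)).
- apply/matrixP => i j; rewrite mx_starE !mxE (star_homS (star_hom_translate _)) eq_sym.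
  by case: eqP => [->|_]; rewrite ?mulr1n ?mulr0n ?star0.
Qed.

Lemma val_algR_nat n : val (n%:R : algR R N) = n%:R.
Proof. exact: (rmorph_nat val n). Qed.

Lemma xi_nat n : xi N (n%:R : cfun R) = n%:R.
Proof.
apply: val_inj; rewrite rmorph_nat /=; apply/matrixP => i j.
by rewrite !mxE translate_nat mx_natE.
Qed.

Lemma xi1 : xi N (1 : cfun R) = 1. Proof. exact: xi_nat 1%N. Qed.

Lemma gamma_scal_nat z (n : nat) : gamma z (n%:R : algR R N) = n%:R.
Proof.
apply: val_inj; rewrite [LHS]/= !val_algR_nat; apply/matrixP => i j.
by rewrite mxE mx_natE -mulrnA translate_nat.
Qed.

Lemma star_hom_gamma z : star_hom (@gamma R N z).
Proof.
have h := star_hom_map_mx N (star_hom_translate z).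
split=> [|f g|f]; [split=> [f g|c f]| |]; apply: val_inj => /=.
- exact: (star_homD h).
- exact: (star_homZ h).
- exact: (star_homM h).
- exact: (star_homS h).
Qed.

Lemma algR_eval (F : algR R N) z (k : nat) i j :
  ceval (omega R N ^+ k * z)%g (val F i j) =
  ceval z (val F (iter k (@ordS N) i) (iter k (@ordS N) j)).
Proof.
elim: k i j => [|k IH] i j; first by rewrite expg0 mul1g.
by rewrite expgS -mulgA (algR_predP _ (valP F)) IH -!iterSr.
Qed.

Lemma iter_ordS k (i : 'I_N) : iter k (@ordS N) i = ((i + k) %% N)%N :> nat.
Proof.
elim: k => [|k IH]; first by rewrite addn0 modn_small.
by rewrite iterS /= IH -addn1 modnDml addn1 addnS.
Qed.

Lemma iter_ordSC (i j : 'I_N) : iter i (@ordS N) j = iter j (@ordS N) i.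
Proof. by apply: val_inj; rewrite /= !iter_ordS addnC. Qed.

Lemma iter_ordS_inj k : injective (iter k (@ordS N)).
Proof. by elim: k => // k IH i j /(can_inj (@ordSK N)) /IH. Qed.

Fact algR_shift_subproof (k : nat) :
  (\matrix_(a, b) (b == iter k (@ordS N) a)%:R : 'M[cfun R]_N) \in @algR_pred R N.
Proof.
apply/algR_predP => z i j; rewrite !mxE !ceval_nat.
by rewrite -iterSr iterS (can_eq (@ordSK N)).
Qed.

(** The unitary u^k, which belongs to R as u commutes with itself. *)
Definition algR_shift k : algR R N := AlgR (algR_shift_subproof k).

Lemma gamma_shift z k : gamma z (algR_shift k) = algR_shift k.
Proof. by apply: val_inj; apply/matrixP => i j; rewrite !mxE translate_nat. Qed.

Lemma star_shift_shift k : star (algR_shift k) * algR_shift k = 1.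
Proof.
apply: val_inj; apply/matrixP => i j; rewrite /= !mxE.
have [c cE] : exists c, iter k (@ordS N) c = i.
  by have [g gK Kg] := injF_bij (@iter_ordS_inj k); exists (g i).
rewrite (bigD1 c)//= big1 ?addr0 => [|d dc]; last first.
  rewrite !mxE -[X in X == _]cE (inj_eq (@iter_ordS_inj k)) eq_sym (negPf dc).
  by rewrite star0 mul0r.
by rewrite !mxE cE eqxx star1 mul1r eq_sym.
Qed.

(** The identity of R is contained in xi o iota: the column of the unitaries u^y
    intertwines F with the N x N matrix of the xi (F x y).  In the entry (a, b)
    both sides are F (a + x) b, by the symmetry F (omega^a z) = u^a F(z) u^-a. *)
Lemma xi_iota_shift (F : algR R N) (x : 'I_N) :
  \sum_y xi N (iota_R F x y) * algR_shift y = algR_shift x * F.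
Proof.
apply: val_inj; rewrite raddf_sum /=; apply/matrixP => a b; rewrite summxE.
rewrite -mulmxE [RHS]mxE [RHS](bigD1 (iter x (@ordS N) a))//=.
rewrite [X in _ = _ + X]big1 ?addr0; last first.
  by move=> k kn; rewrite [X in X * _]mxE (negPf kn) mul0r.
rewrite [X in _ = X * _]mxE eqxx mul1r.
have [g gK Kg] := injF_bij (@iter_ordS_inj a).
rewrite (bigD1 (g b))//= [X in _ + X]big1 ?addr0; last first.
  move=> y yb; rewrite mxE big1// => c _; rewrite !mxE.
  have [ac|//] := eqVneq a c; last by rewrite mulr0n mul0r.
  rewrite -ac iter_ordSC -[b]Kg (inj_eq (@iter_ordS_inj a)) eq_sym (negPf yb).
  by rewrite mulr0.
rewrite mul_diag_mx !mxE iter_ordSC Kg eqxx mulr1.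
apply: cfunP => z; rewrite ceval_translate invgK /iota_R algR_eval Kg.
by rewrite iter_ordSC.
Qed.

End Evaluation.

(** * One step of the inductive system *)

Section OneStep.
Variables (R : realType) (N : nat) (theta : R).
Hypothesis N_gt0 : (0 < N)%N.

Definition stage m0 m1 : starAlgType R := ('M[algR R N]_m0 * 'M[cfun R]_m1)%type.

Variables (m0 m1 k00 k01 k10 k11 : nat).

Local Notation M0 := (m0 * k00 + m1 * k01)%N.
Local Notation M1 := (m0 * k10 * N + 2 * N * (m1 * k11))%N.

(** One connecting map, with the sizes and multiplicities as parameters, so that
    it can be studied apart from the recursion for the sizes. *)
Definition step_map (a : stage m0 m1) : stage M0 M1 :=
  (block_mx (amplify id k00 a.1) 0 0 (amplify (@xi R N) k01 a.2),
   block_mx (flatten_mx (amplify (@iota_R R N) k10 a.1)) 0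
            0 (block_diag (fun j : 'I_(2 * N) =>
                 amplify (translate (cis (rotation_angle theta j))) k11 a.2))).

Lemma star_hom_step_map : star_hom step_map.
Proof.
have h1 := star_hom_fst 'M[algR R N]_m0 'M[cfun R]_m1.
have h2 := star_hom_snd 'M[algR R N]_m0 'M[cfun R]_m1.
apply: star_hom_pair; apply: star_hom_block.
- exact: star_hom_comp h1 (star_hom_amplify _ _ (@star_hom_id _ _)).
- exact: star_hom_comp h2 (star_hom_amplify _ _ (@star_hom_xi _ _)).
- apply: star_hom_comp (star_hom_flatten _ _ _).
  exact: star_hom_comp h1 (star_hom_amplify _ _ (@star_hom_iota _ _)).
- apply: star_hom_block_diag => j.
  exact: star_hom_comp h2 (star_hom_amplify _ _ (@star_hom_translate _ _)).
Qed.

Lemma flatten1 (D : starAlgType R) n m : flatten_mx (1 : 'M['M[D]_m]_n) = 1.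
Proof.
apply: matrix_tensP => i k j l; rewrite flatten_mxE !mxE mxtens_index_eq.
by case: (i == j) => /=; rewrite mxE.
Qed.

Lemma block_diag1 (D : starAlgType R) n m : block_diag (fun _ : 'I_m => 1 : 'M[D]_n) = 1.
Proof.
apply: matrix_tensP => i k j l; rewrite block_diagE !mxE mxtens_index_eq.
by case: (i == j) => /=.
Qed.

Lemma one_mx (D : starAlgType R) n : 1 = 1%:M :> 'M[D]_n. Proof. by []. Qed.

Lemma step_map1 : step_map 1 = 1.
Proof.
rewrite /step_map /=.
rewrite (amplify1 _ _ (@star_hom_id _ _))// (amplify1 _ _ (@star_hom_xi _ _)) ?xi1//.
rewrite (amplify1 _ _ (@star_hom_iota _ _))// flatten1.
under [X in block_diag X]eq_fun do rewrite (amplify1 _ _ (@star_hom_translate _ _)) ?translate1//.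
by rewrite block_diag1 !one_mx -!scalar_mx_block.
Qed.

Lemma step_map_p01 : step_map (0, 1) =
  (block_mx 0 0 0 1, block_mx 0 0 0 1).
Proof.
rewrite /step_map /=.
rewrite (star_hom0 (star_hom_amplify _ _ (@star_hom_id _ _))).
rewrite (star_hom0 (star_hom_amplify _ _ (@star_hom_iota _ _))).
rewrite (star_hom0 (star_hom_flatten _ _ _)).
rewrite (amplify1 _ _ (@star_hom_xi _ _)) ?xi1//.
under [X in block_diag X]eq_fun do rewrite (amplify1 _ _ (@star_hom_translate _ _)) ?translate1//.
by rewrite block_diag1.
Qed.

Lemma step_map_p10 : step_map (1, 0) =
  (block_mx 1 0 0 0, block_mx 1 0 0 0).
Proof.
rewrite /step_map /=.
rewrite (star_hom0 (star_hom_amplify _ _ (@star_hom_xi _ _))).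
under [X in block_diag X]eq_fun do
  rewrite (star_hom0 (star_hom_amplify _ _ (@star_hom_translate _ _))).
have -> : block_diag (fun _ : 'I_(2 * N) => 0 : 'M[cfun R]_(m1 * k11)) = 0.
  by apply: matrix_tensP => i k j l; rewrite block_diagE !mxE mul0rn.
rewrite (amplify1 _ _ (@star_hom_id _ _))//.
by rewrite (amplify1 _ _ (@star_hom_iota _ _))// flatten1.
Qed.

(** The index in 0, ..., N-1 of the rotation by omega^-x. *)
Fact inv_angle_subproof (x : 'I_N) : ((N - x) %% N < 2 * N)%N.
Proof. by rewrite mul2n -addnn ltn_addl// ltn_mod. Qed.
Definition inv_angle x : 'I_(2 * N) := Ordinal (inv_angle_subproof x).

Lemma omegaXn k : (omega R N ^+ k)%g = cis (k%:R / N%:R).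
Proof. by rewrite /omega cisX. Qed.

Lemma cis_inv_angle x : cis (rotation_angle theta (inv_angle x)) = (omega R N ^- x)%g.
Proof.
rewrite /rotation_angle ltn_mod N_gt0 -omegaXn omegaX_mod//.
by rewrite expgnFr ?omegaX// ?mul1g// ltnW.
Qed.

Lemma inv_angle_inj : injective inv_angle.
Proof.
move=> x y /(congr1 val) /= xy; apply: val_inj => /=.
have hx := ltn_ord x; have hy := ltn_ord y.
have [x0|x0] := posnP x; have [y0|y0] := posnP y; rewrite ?x0 ?y0//.
- move: xy; rewrite x0 subn0 modnn modn_small; last by rewrite ltn_subrL y0.
  by lia.
- move: xy; rewrite y0 subn0 modnn modn_small; last by rewrite ltn_subrL x0.
  by lia.
- by move: xy; rewrite !modn_small ?ltn_subrL ?x0 ?y0//; lia.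
Qed.

Hypotheses (k00_le : (k00 <= k10)%N) (k01_le : (k01 <= k11)%N).

(** Copy (i, c) of the R-summand, at position x of M_N, goes to the same
    position of iota; copy (i, c) of the C(S^1)-summand at position x goes to
    the rotation by omega^-x, as xi is the sum of these rotations. *)
Definition sub_index (q : 'I_(M0 * N)) : 'I_M1 :=
  let x := (mxtens_unindex q).2 in
  match fintype.split (mxtens_unindex q).1 with
  | inl u => let v := mxtens_unindex u in
      lshift _ (mxtens_index (mxtens_index (v.1, widen_ord k00_le v.2), x))
  | inr u => let v := mxtens_unindex u in
      rshift _ (mxtens_index (inv_angle x, mxtens_index (v.1, widen_ord k01_le v.2)))
  end.

Let split_lshift m n (i : 'I_m) : fintype.split (lshift n i) = inl i :=
  unsplitK (inl i).
Let split_rshift m n (i : 'I_n) : fintype.split (rshift m i) = inr i :=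
  unsplitK (inr i).

Lemma sub_index_l i c x :
  sub_index (mxtens_index (lshift _ (mxtens_index (i, c)), x)) =
  lshift _ (mxtens_index (mxtens_index (i, widen_ord k00_le c), x)).
Proof. by rewrite /sub_index !mxtens_indexK split_lshift !mxtens_indexK. Qed.

Lemma sub_index_r i c x :
  sub_index (mxtens_index (rshift _ (mxtens_index (i, c)), x)) =
  rshift _ (mxtens_index (inv_angle x, mxtens_index (i, widen_ord k01_le c))).
Proof. by rewrite /sub_index !mxtens_indexK split_rshift !mxtens_indexK. Qed.

Variant sub_indexed : 'I_(M0 * N) -> Type :=
| SubIndexL i c x : sub_indexed (mxtens_index (lshift _ (mxtens_index (i, c)), x))
| SubIndexR i c x : sub_indexed (mxtens_index (rshift _ (mxtens_index (i, c)), x)).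

Lemma sub_indexedP q : sub_indexed q.
Proof.
case: (mxtens_indexP q) => t x; case: (split_ordP t) => u ->;
  by case: (mxtens_indexP u) => i c; constructor.
Qed.

Lemma mxtens_index_inj m n (i i' : 'I_m) (j j' : 'I_n) :
  mxtens_index (i, j) = mxtens_index (i', j') -> i = i' /\ j = j'.
Proof. by move=> /(can_inj (@mxtens_indexK m n)) []. Qed.

Lemma sub_index_inj : injective sub_index.
Proof.
move=> p q; case: (sub_indexedP p) => i c x; case: (sub_indexedP q) => j d y;
  rewrite !(sub_index_l, sub_index_r).
- move=> /lshift_inj/mxtens_index_inj[/mxtens_index_inj[-> /(congr1 val)/= cd] ->].
  by rewrite (val_inj cd : c = d).
- by move=> /eqP; rewrite eq_lrshift.
- by move=> /eqP; rewrite eq_rlshift.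
- move=> /rshift_inj/mxtens_index_inj[/inv_angle_inj -> /mxtens_index_inj[-> /(congr1 val)/= cd]].
  by rewrite (val_inj cd : c = d).
Qed.

Lemma map_mxE' (C D : Type) m n (f : C -> D) (X : 'M[C]_(m, n)) i j :
  map_mx f X i j = f (X i j).
Proof. by rewrite mxE. Qed.

Lemma widen_ord_eq m n (h : (m <= n)%N) (i j : 'I_m) :
  (widen_ord h i == widen_ord h j) = (i == j).
Proof. by []. Qed.

Definition sub_mx : 'M[cfun R]_(M1, M0 * N) := inj_mx _ sub_index.

Lemma adj_sub_mx : adj sub_mx *m sub_mx = 1%:M.
Proof. exact: adj_inj_mx sub_index_inj. Qed.

(** The C(S^1)-component of the image of a contains its R-component, embedded by
    iota: the amplified copies of iota match because of k00 <= k10, and the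
    diagonal entries of xi are N of the 2N rotations. *)
Lemma sub_mx_intertwine (a : stage m0 m1) :
  (step_map a).2 *m sub_mx =
  sub_mx *m flatten_mx (map_mx (@iota_R R N) (step_map a).1).
Proof.
apply: inj_mx_intertwine; first exact: sub_index_inj.
- move=> p q; case: (sub_indexedP p) => i c x; case: (sub_indexedP q) => j d y;
    rewrite !(sub_index_l, sub_index_r) [RHS]flatten_mxE map_mxE' /step_map /=.
  + rewrite !block_mxEul flatten_mxE !amplifyE widen_ord_eq.
    by case: (c == d).
  + by rewrite !block_mxEur !mxE.
  + by rewrite !block_mxEdl !mxE.
  + rewrite !block_mxEdr block_diagE !amplifyE widen_ord_eq (inj_eq inv_angle_inj).
    case: (c == d); last by rewrite !mulr0n mul0rn /= !mxE.
    by rewrite !mulr1n /= !mxE cis_inv_angle.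
- move=> p q; case: (sub_indexedP q) => j d y; rewrite !(sub_index_l, sub_index_r);
  case: (split_ordP p) => u ->; rewrite /step_map /=.
  + rewrite block_mxEul; case: (mxtens_indexP u) => v x; case: (mxtens_indexP v) => i c.
    rewrite flatten_mxE amplifyE; have [-> _|_] := eqVneq c; last by rewrite mulr0n mxE eqxx.
    by exists (mxtens_index (lshift _ (mxtens_index (i, d)), x)); rewrite sub_index_l.
  + by rewrite block_mxEdl mxE eqxx.
  + by rewrite block_mxEur mxE eqxx.
  + rewrite block_mxEdr; case: (mxtens_indexP u) => x v; case: (mxtens_indexP v) => i c.
    rewrite block_diagE amplifyE; have [->|_] := eqVneq x; last by rewrite mulr0n eqxx.
    have [-> _|_] := eqVneq c; last by rewrite mulr0n eqxx.
    by exists (mxtens_index (rshift _ (mxtens_index (i, d)), y)); rewrite sub_index_r.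
Qed.

End OneStep.

(** * The partial isometry exchanging 1 - p with a part of p *)

Section Transfer.
Variables (R : realType) (N : nat) (theta : R).
Hypothesis N_gt0 : (0 < N)%N.

Lemma matrix_tensPl (D : Type) m n p (X Y : 'M[D]_(m * n, p)) :
  (forall i k j, X (mxtens_index (i, k)) j = Y (mxtens_index (i, k)) j) -> X = Y.
Proof. by move=> XY; apply/matrixP => q j; case: (mxtens_indexP q) => i k. Qed.

Lemma mulmxE_mxtens (D : starAlgType R) m n p q (X : 'M[D]_(m, n * p)) (Y : 'M[D]_(n * p, q)) i j :
  (X *m Y) i j = \sum_a \sum_b X i (mxtens_index (a, b)) * Y (mxtens_index (a, b)) j.
Proof. by rewrite mxE big_mxtens. Qed.

(** The column N^(-1/2) (u^0, ..., u^(N-1)), once for each of the m basis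
    vectors; the factor makes it an isometry. *)
Definition shift_col m : 'M[algR R N]_(m * N, m) :=
  \matrix_(p, j) ((scal (Num.sqrt (N%:R^-1 : R))%:C *
     algR_shift R N (mxtens_unindex p).2) *+ ((mxtens_unindex p).1 == j)).

Lemma shift_colE m i y j : shift_col m (mxtens_index (i, y)) j =
  (scal (Num.sqrt (N%:R^-1 : R))%:C * algR_shift R N y) *+ (i == j).
Proof. by rewrite mxE mxtens_indexK. Qed.

Lemma gamma_scal z c (F : algR R N) : gamma z (scal c * F) = scal c * gamma z F.
Proof. exact: star_homZ (star_hom_gamma N z) c F. Qed.

Lemma shift_col_fixed z m : map_mx (gamma z) (shift_col m) = shift_col m.
Proof.
apply: matrix_tensPl => i y j; rewrite map_mxE' !shift_colE.
by case: eqP => _; rewrite ?mulr0n ?(star_hom0 (star_hom_gamma N z))// !mulr1n gamma_scal gamma_shift.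
Qed.

Lemma adj_shift_col m : adj (shift_col m) *m shift_col m = 1%:M.
Proof.
have c2 : scal (Num.sqrt (N%:R^-1 : R))%:C * scal (Num.sqrt (N%:R^-1 : R))%:C
    = scal (N%:R^-1)%:C :> algR R N.
  by rewrite -scalM -rmorphM -expr2 sqr_sqrtr// invr_ge0 ler0n.
apply/matrixP => i j; rewrite mulmxE_mxtens (bigD1 j)//= [X in _ + X]big1 ?addr0 => [|a aj]; last first.
  by apply: big1 => y _; rewrite shift_colE (negPf aj) mulr0n mulr0.
under eq_bigr => y _.
  rewrite mxE !shift_colE eqxx mulr1n.
  have -> : star ((scal (Num.sqrt (N%:R^-1 : R))%:C * algR_shift R N y) *+ (j == i)) *
    (scal (Num.sqrt (N%:R^-1 : R))%:C * algR_shift R N y) = scal (N%:R^-1)%:C *+ (i == j) :> algR R N.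
    rewrite eq_sym; case: eqP => _; last by rewrite !mulr0n star0 mul0r.
    rewrite !mulr1n starM star_scal_real -mulrA [X in _ * X]mulrA c2.
    by rewrite mulrA -scalC -mulrA star_shift_shift mulr1.
  over.
rewrite sumr_const card_ord mxE -mulrnA mulnC mulrnA; congr (_ *+ _).
rewrite -[LHS]mulr_natr -(scal_nat (algR R N)) -scalM -(rmorph_nat (real_complex R) N) -rmorphM.
by rewrite mulVf ?pnatr_eq0 -?lt0n// rmorph1 scal1.
Qed.

(** This is xi_iota_shift for matrices. *)
Lemma shift_col_intertwine m (X : 'M[algR R N]_m) :
  map_mx (@xi R N) (flatten_mx (map_mx (@iota_R R N) X)) *m shift_col m =
  shift_col m *m X.
Proof.
apply: matrix_tensPl => i x j; rewrite mulmxE_mxtens mxE (bigD1 j)//= [X in _ + X]big1 ?addr0 => [|a aj]; last first.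
  by apply: big1 => y _; rewrite shift_colE (negPf aj) mulr0n mulr0.
rewrite [RHS](bigD1 i)//= [X in _ = _ + X]big1 ?addr0; last first.
  by move=> a ai; rewrite shift_colE eq_sym (negPf ai) mulr0n mul0r.
rewrite shift_colE eqxx mulr1n -mulrA -xi_iota_shift mulr_sumr.
apply: eq_bigr => y _; rewrite map_mxE' flatten_mxE map_mxE' shift_colE eqxx mulr1n.
by rewrite mulrA -scalC mulrA.
Qed.

Variables (m0 m1 k00 k01 k10 k11 : nat).
Hypotheses (k00_le : (k00 <= k01)%N) (k10_le : (k10 <= k11)%N).

(** k copies of V, mapping into the first k of k' copies of the target. *)
Definition amplify_rect (D : starAlgType R) m n k k' (le_kk : (k <= k')%N)
    (V : 'M[D]_(m, n)) : 'M[D]_(m * k', n * k) :=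
  \matrix_(p, q) (V (mxtens_unindex p).1 (mxtens_unindex q).1 *+
    ((mxtens_unindex p).2 == widen_ord le_kk (mxtens_unindex q).2)).

Lemma amplify_rectE (D : starAlgType R) m n k k' (le_kk : (k <= k')%N)
    (V : 'M[D]_(m, n)) i c j d :
  amplify_rect le_kk V (mxtens_index (i, c)) (mxtens_index (j, d)) =
  V i j *+ (c == widen_ord le_kk d).
Proof. by rewrite mxE !mxtens_indexK. Qed.

Lemma map_amplify_rect (C D : starAlgType R) (f : C -> D) m n k k' (le_kk : (k <= k')%N)
    (V : 'M[C]_(m, n)) : star_hom f ->
  map_mx f (amplify_rect le_kk V) = amplify_rect le_kk (map_mx f V).
Proof. by move=> hf; apply/matrixP => p q; rewrite !mxE (star_homMn hf). Qed.

Lemma adj_amplify_rect (D : starAlgType R) m n k k' (le_kk : (k <= k')%N)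
    (V : 'M[D]_(m, n)) : adj V *m V = 1%:M ->
  adj (amplify_rect le_kk V) *m amplify_rect le_kk V = 1%:M.
Proof.
move=> /matrixP VV; apply: matrix_tensP => i c j d; rewrite mulmxE_mxtens.
transitivity (\sum_a star (V a i) * V a j *+ (c == d)).
  apply: eq_bigr => a _; rewrite (bigD1 (widen_ord le_kk d))//= big1 ?addr0.
    rewrite mxE !amplify_rectE eqxx mulr1n widen_ord_eq eq_sym.
    by case: eqP => _; rewrite ?mulr1n// !mulr0n star0 mul0r.
  by move=> e ed; rewrite !amplify_rectE (negPf ed) mulr0n mulr0.
rewrite sumrMnl; move: (VV i j); rewrite !mxE mxtens_index_eq.
under eq_bigr do rewrite mxE.
by move=> ->; rewrite -mulrnA mulnb.
Qed.

Lemma amplify_rect_intertwine (C D : starAlgType R) m n k k' (le_kk : (k <= k')%N)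
    (psi : C -> D) (X : 'M[D]_n) (Y : 'M[C]_m) (V : 'M[D]_(m, n)) :
  map_mx psi Y *m V = V *m X ->
  amplify psi k' Y *m amplify_rect le_kk V = amplify_rect le_kk V *m amplify id k X.
Proof.
move=> /matrixP YV; apply: matrix_tensP => i c j d; rewrite !mulmxE_mxtens.
transitivity (\sum_a psi (Y i a) * V a j *+ (c == widen_ord le_kk d)).
  apply: eq_bigr => a _; rewrite (bigD1 (widen_ord le_kk d))//= big1 ?addr0.
    by rewrite amplify_rectE amplifyE eqxx mulr1n mulrnAl.
  by move=> e ed; rewrite amplify_rectE (negPf ed) mulr0n mulr0.
transitivity (\sum_a V i a * X a j *+ (c == widen_ord le_kk d)); last first.
  apply: eq_bigr => a _; rewrite (bigD1 d)//= big1 ?addr0.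
    by rewrite amplify_rectE amplifyE eqxx mulr1n mulrnAl.
  by move=> e ed; rewrite amplifyE (negPf ed) mulr0n mulr0.
rewrite !sumrMnl; congr (_ *+ _); move: (YV i j); rewrite !mxE => <-.
by apply: eq_bigr => a _; rewrite mxE.
Qed.

(** The block of the connecting map which is rotated by the angle 0. *)
Definition unrotated (i : 'I_(m1 * k11)) : 'I_(2 * N * (m1 * k11)) :=
  mxtens_index (inv_angle N_gt0 (Ordinal N_gt0), i).

(** The copies for k10 stand before the position in M_N in one of the two
    iterated matrix algebras, and after it in the other. *)
Definition swap_index m (q : 'I_(m * k10 * N)) : 'I_(m * N * k10) :=
  let u := mxtens_unindex q in let v := mxtens_unindex u.1 in
  mxtens_index (mxtens_index (v.1, u.2), v.2).

Lemma swap_indexE m (j : 'I_m) d x :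
  swap_index (mxtens_index (mxtens_index (j, d), x)) = mxtens_index (mxtens_index (j, x), d).
Proof. by rewrite /swap_index !mxtens_indexK. Qed.

Lemma unrotated_inj : injective unrotated.
Proof. by move=> i j /mxtens_index_inj[]. Qed.

Lemma swap_index_inj m : injective (@swap_index m).
Proof.
move=> p q; case: (mxtens_indexP p) => u x; case: (mxtens_indexP q) => v y.
case: (mxtens_indexP u) => i c; case: (mxtens_indexP v) => j d; rewrite !swap_indexE.
by move=> /mxtens_index_inj[/mxtens_index_inj[-> ->] ->].
Qed.

Definition rot_amplify m (J : 'M[cfun R]_(m1, m * N)) :
    'M[cfun R]_(2 * N * (m1 * k11), m * k10 * N) :=
  inj_mx _ unrotated *m amplify_rect k10_le J *m inj_mx _ (@swap_index m).

Lemma adj_rot_amplify m (J : 'M[cfun R]_(m1, m * N)) :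
  adj J *m J = 1%:M -> adj (rot_amplify J) *m rot_amplify J = 1%:M.
Proof.
move=> JJ; rewrite /rot_amplify !adjM -!mulmxA [adj (inj_mx _ unrotated) *m _]mulmxA.
rewrite (adj_inj_mx _ unrotated_inj) mul1mx [adj (amplify_rect _ _) *m _]mulmxA.
by rewrite adj_amplify_rect// mul1mx adj_inj_mx//; exact: swap_index_inj.
Qed.

Lemma map_rot_amplify z m (J : 'M[cfun R]_(m1, m * N)) :
  map_mx (translate z) (rot_amplify J) = rot_amplify (map_mx (translate z) J).
Proof.
have h := star_hom_translate z; rewrite /rot_amplify !(star_hom_mulmx _ _ h).
by rewrite !(map_inj_mx _ h) ?translate1// map_amplify_rect.
Qed.

Lemma rot_amplify_intertwine m (J : 'M[cfun R]_(m1, m * N)) (X : 'M[algR R N]_m)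
    (Y : 'M[cfun R]_m1) :
  Y *m J = J *m flatten_mx (map_mx (@iota_R R N) X) ->
  block_diag (fun j : 'I_(2 * N) =>
    amplify (translate (cis (rotation_angle theta j))) k11 Y) *m rot_amplify J =
  rot_amplify J *m flatten_mx (amplify (@iota_R R N) k10 X).
Proof.
move=> YJ; pose rot0 := translate (cis (rotation_angle theta (inv_angle N_gt0 (Ordinal N_gt0)))).
have rot0E : map_mx rot0 Y = Y.
  by apply/matrixP => i j; rewrite mxE /rot0 cis_inv_angle// expg0 invg1 translate_id.
rewrite /rot_amplify !mulmxA.
rewrite (@inj_mx_intertwine _ _ _ _ (amplify rot0 k11 Y) _ _ unrotated_inj); first last.
- move=> p j; case: (mxtens_indexP p) => a i; rewrite block_diagE.
  by have [-> _|_] := eqVneq a; [exists i|rewrite mulr0n eqxx].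
- by move=> i j; rewrite block_diagE eqxx.
rewrite -[_ *m amplify rot0 _ _ *m _]mulmxA (amplify_rect_intertwine _ (X := flatten_mx (map_mx (@iota_R R N) X))); last first.
  by rewrite rot0E.
rewrite mulmxA -!mulmxA; congr (_ *m (_ *m _)).
apply: inj_mx_intertwine; first exact: swap_index_inj.
- move=> p q; case: (mxtens_indexP p) => u x; case: (mxtens_indexP q) => v y.
  case: (mxtens_indexP u) => i c; case: (mxtens_indexP v) => j d.
  rewrite !swap_indexE [LHS](amplifyE (@id (cfun R))) [in LHS]flatten_mxE.
  rewrite [RHS]flatten_mxE (amplifyE (@iota_R R N)) map_mxE'.
  by case: (c == d); rewrite // !mulr0n mxE.
- move=> p _ _; case: (mxtens_indexP p) => u c; case: (mxtens_indexP u) => i x.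
  by exists (mxtens_index (mxtens_index (i, c), x)); rewrite swap_indexE.
Qed.

(** Suppose that Y contains X, embedded by iota, by means of the isometry J.
    Then xi(Y) contains xi(iota(X)), which contains X by shift_col_intertwine,
    so that among the summands of the next stage the copies of X in the
    R-component are equivalent to a part of the copies of xi(Y).  In the
    C(S^1)-component the unrotated copies of Y already contain those of
    iota(X).  All isometries have fixed entries. *)
Lemma transfer_isometry (J : 'M[cfun R]_(m1, m0 * N)) :
  adj J *m J = 1%:M -> (forall z, map_mx (translate z) J = J) ->
  exists s : stage R N (m0 * k00 + m1 * k01) (m0 * k10 * N + 2 * N * (m1 * k11)),
  [/\ forall z, (map_mx (gamma z) s.1, map_mx (translate z) s.2) = s,
      star s * s = step_map theta k00 k01 k10 k11 (1, 0),
      step_map theta k00 k01 k10 k11 (0, 1) * s = s &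
      forall X Y, Y *m J = J *m flatten_mx (map_mx (@iota_R R N) X) ->
        step_map theta k00 k01 k10 k11 (X, Y) * s =
        s * step_map theta k00 k01 k10 k11 (X, Y)].
Proof.
move=> JJ Jfix.
pose V := map_mx (@xi R N) J *m shift_col m0.
have xifix z f : gamma z (xi N f) = xi N (translate z f).
  apply: val_inj; apply/matrixP => i j; rewrite !mxE (star_homMn (star_hom_translate z)).
  by congr (_ *+ _); rewrite -!translateM circleMC.
have Vfix z : map_mx (gamma z) V = V.
  rewrite /V (star_hom_mulmx _ _ (star_hom_gamma N z)) shift_col_fixed; congr (_ *m _).
  by apply/matrixP => i j; rewrite !map_mxE' xifix -[in RHS](Jfix z) map_mxE'.
have VV : adj V *m V = 1%:M.
  rewrite /V adjM -!mulmxA [adj (map_mx _ _) *m _]mulmxA.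
  rewrite -(star_hom_adj _ (@star_hom_xi R N)) -(star_hom_mulmx _ _ (@star_hom_xi R N)) JJ.
  have -> : map_mx (@xi R N) 1%:M = 1%:M :> 'M[algR R N]_(m0 * N).
    apply/matrixP => i j; rewrite !mxE (star_homMn (@star_hom_xi R N)).
    by rewrite xi1.
  by rewrite mul1mx adj_shift_col.
have VXY X Y : Y *m J = J *m flatten_mx (map_mx (@iota_R R N) X) ->
    map_mx (@xi R N) Y *m V = V *m X.
  move=> YJ; rewrite /V mulmxA -(star_hom_mulmx _ _ (@star_hom_xi R N)) YJ.
  by rewrite (star_hom_mulmx _ _ (@star_hom_xi R N)) -!mulmxA shift_col_intertwine.
clearbody V.
pose S0 := amplify_rect k00_le V; pose S1 := rot_amplify J.
exists (block_mx 0 0 S0 0, block_mx 0 0 S1 0); split.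
- move=> z; rewrite /= !map_block_mx !(star_hom_map0 _ _ (star_hom_gamma N z)).
  rewrite !(star_hom_map0 _ _ (star_hom_translate z)) /S1 map_rot_amplify Jfix.
  by rewrite /S0 (map_amplify_rect _ _ (star_hom_gamma N z)) Vfix.
- rewrite step_map_p10; congr (_, _).
    rewrite -[LHS]/(adj (block_mx 0 0 S0 0) *m block_mx 0 0 S0 0) adj_block mulmx_block.
    by rewrite !adj0 !(mulmx0, mul0mx, addr0, add0r) adj_amplify_rect.
  rewrite -[LHS]/(adj (block_mx 0 0 S1 0) *m block_mx 0 0 S1 0) adj_block mulmx_block.
  by rewrite !adj0 !(mulmx0, mul0mx, addr0, add0r) adj_rot_amplify.
- rewrite step_map_p01; congr (_, _); rewrite -[LHS]/(_ *m _) mulmx_block.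
    by rewrite !(mulmx0, mul0mx, addr0, add0r) mul1mx.
  by rewrite !(mulmx0, mul0mx, addr0, add0r) mul1mx.
- move=> X Y YJ; congr (_, _); rewrite -[LHS]/(_ *m _) -[RHS]/(_ *m _) !mulmx_block.
    rewrite !(mulmx0, mul0mx, addr0, add0r) (amplify_rect_intertwine _ (VXY _ _ YJ)).
    by [].
  by rewrite !(mulmx0, mul0mx, addr0, add0r) /= (rot_amplify_intertwine YJ).
Qed.

End Transfer.

(** * Ranks of diagonal 0/1 projections *)

Section DiagonalRank.
Variable R : realType.
Implicit Types D C : starAlgType R.

(** E is the identity on k of the basis vectors. *)
Definition diag_rank D n (E : 'M[D]_n) (k : nat) :=
  exists2 sigma : 'I_k -> 'I_n, injective sigma &
    forall i j, E i (sigma j) = (i == sigma j)%:R.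

(** An index set of any shape may replace 'I_k. *)
Lemma diag_rankI D n (E : 'M[D]_n) (T : finType) (sigma : T -> 'I_n) k :
  (k <= #|T|)%N -> injective sigma ->
  (forall i j, E i (sigma j) = (i == sigma j)%:R) -> diag_rank E k.
Proof.
move=> kT sI sE; exists (fun j => sigma (enum_val (widen_ord kT j))).
  by move=> i j /sI/enum_val_inj/(congr1 val)/= ij; apply: val_inj.
by move=> i j; exact: sE.
Qed.

Lemma diag_rankS D n (E : 'M[D]_n) k k' : (k <= k')%N ->
  diag_rank E k' -> diag_rank E k.
Proof.
by move=> kk [sigma sI sE]; apply: (diag_rankI (sigma := sigma)); rewrite ?card_ord.
Qed.

Lemma diag_rank0 D n : diag_rank (0 : 'M[D]_n) 0.
Proof. by apply: (@diag_rankI _ _ _ 'I_0 (fun i => match i with Ordinal _ h => False_rect _ (notF h) end)) => [|[]|? []]. Qed.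

Lemma diag_rank_delta D n (i : 'I_n) : diag_rank (delta_mx i i : 'M[D]_n) 1.
Proof.
apply: (@diag_rankI _ _ _ unit (fun _ => i)); first by rewrite card_unit.
  by move=> [] [].
by move=> j _; rewrite mxE eqxx andbT.
Qed.

Lemma diag_rank_amplify C D (psi : C -> D) n k k' (E : 'M[C]_n) :
  star_hom psi -> psi 1 = 1 -> diag_rank E k ->
  diag_rank (amplify psi k' E) (k * k').
Proof.
move=> hpsi psi1 [sigma sI sE].
apply: (diag_rankI (T := ('I_k * 'I_k')%type) (sigma := fun u => mxtens_index (sigma u.1, u.2))).
- by rewrite card_prod !card_ord.
- by move=> [i c] [j d] /mxtens_index_inj[/sI /= -> ->].
- move=> p [j d]; case: (mxtens_indexP p) => i c /=.
  rewrite amplifyE sE mxtens_index_eq; case: (i == _); case: (c == d) => /=;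
    by rewrite ?psi1 ?(star_hom0 hpsi) ?mul0rn.
Qed.

Lemma diag_rank_flatten D n m k (E : 'M['M[D]_m]_n) :
  diag_rank E k -> diag_rank (flatten_mx E) (k * m).
Proof.
move=> [sigma sI sE].
apply: (diag_rankI (T := ('I_k * 'I_m)%type) (sigma := fun u => mxtens_index (sigma u.1, u.2))).
- by rewrite card_prod !card_ord.
- by move=> [i c] [j d] /mxtens_index_inj[/sI /= -> ->].
- move=> p [j d]; case: (mxtens_indexP p) => i c /=.
  rewrite flatten_mxE sE mxtens_index_eq mx_natE; case: (i == _); case: (c == d) => /=;
    by rewrite ?mulr1n ?mulr0n.
Qed.

Lemma diag_rank_block_diag D m n k (X : 'I_m -> 'M[D]_n) :
  (forall i, diag_rank (X i) k) -> diag_rank (block_diag X) (m * k).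
Proof.
move=> XR.
have /choice[s sP] i : exists s : 'I_k -> 'I_n,
    injective s /\ forall a j, X i a (s j) = (a == s j)%:R.
  by have [s sI sE] := XR i; exists s.
apply: (diag_rankI (T := ('I_m * 'I_k)%type) (sigma := fun u => mxtens_index (u.1, s u.1 u.2))).
- by rewrite card_prod !card_ord.
- by move=> [i c] [j d] /mxtens_index_inj[/= <- /(proj1 (sP i)) ->].
- move=> p [j d]; case: (mxtens_indexP p) => i c /=.
  rewrite block_diagE mxtens_index_eq; have [->|_] /= := eqVneq i; last by rewrite mulr0n.
  by rewrite mulr1n (proj2 (sP j)).
Qed.

Lemma diag_rank_block D m n k k' (X : 'M[D]_m) (Y : 'M[D]_n) :
  diag_rank X k -> diag_rank Y k' -> diag_rank (block_mx X 0 0 Y) (k + k').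
Proof.
move=> [s sI sE] [t tI tE].
apply: (diag_rankI (T := ('I_k + 'I_k')%type) (sigma := fun u =>
  match u with inl i => lshift _ (s i) | inr j => rshift _ (t j) end)).
- by rewrite card_sum !card_ord.
- move=> [i|i] [j|j].
  + by move=> /lshift_inj/sI ->.
  + by move=> /eqP; rewrite eq_lrshift.
  + by move=> /eqP; rewrite eq_rlshift.
  + by move=> /rshift_inj/tI ->.
- move=> p [j|j]; case: (split_ordP p) => u ->;
  rewrite !(block_mxEul, block_mxEur, block_mxEdl, block_mxEdr).
  + by rewrite sE eq_lshift.
  + by rewrite eq_rlshift mxE.
  + by rewrite eq_lrshift mxE.
  + by rewrite tE eq_rshift.
Qed.

(** If E is the identity on the range of the isometry T, then w = U T^* gives
    w E w^* = U U^*. *)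
Lemma diag_rank_compress D n k (E : 'M[D]_n) (sigma : 'I_k -> 'I_n) :
  injective sigma -> diag_rank E k ->
  exists2 tau : 'I_k -> 'I_n, injective tau &
    let w := inj_mx D sigma *m adj (inj_mx D tau) in
    w *m E *m adj w = inj_mx D sigma *m adj (inj_mx D sigma).
Proof.
move=> sI [tau tI tE]; exists tau => //=.
have ET : E *m inj_mx D tau = inj_mx D tau.
  by apply/matrixP => i j; rewrite mulmx_inj_mx tE mxE.
rewrite adjM; have -> X : adj (adj X) = X :> 'M[D]_(n, k).
  by apply/matrixP => i j; rewrite !mxE starK.
rewrite -!mulmxA; congr (_ *m _); rewrite [E *m _]mulmxA ET mulmxA adj_inj_mx//.
by rewrite mul1mx.
Qed.

Lemma inj_mx_lshift D m n : inj_mx D (@lshift m n) *m adj (inj_mx D (@lshift m n)) =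
  block_mx 1 0 0 0.
Proof.
have -> : inj_mx D (@lshift m n) = col_mx 1%:M 0.
  apply/matrixP => i j; rewrite mxE; case: (split_ordP i) => u ->.
    by rewrite col_mxEu mxE eq_lshift.
  by rewrite col_mxEd eq_rlshift mxE.
have -> : adj (col_mx 1%:M (0 : 'M[D]_(n, m))) = row_mx 1%:M 0.
  apply/matrixP => i j; rewrite mxE; case: (split_ordP j) => u ->.
    by rewrite col_mxEu row_mxEl !mxE eq_sym star_nat.
  by rewrite col_mxEd row_mxEr !mxE star0.
by rewrite mul_col_row !(mulmx0, mul0mx, mulmx1).
Qed.

End DiagonalRank.

Section StepRank.
Variables (R : realType) (N : nat) (theta : R) (m0 m1 k00 k01 k10 k11 : nat).

Lemma diag_rank_step_map (X : stage R N m0 m1) k k' :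
  diag_rank X.1 k -> diag_rank X.2 k' ->
  diag_rank (step_map theta k00 k01 k10 k11 X).1 (k * k00 + k' * k01) /\
  diag_rank (step_map theta k00 k01 k10 k11 X).2 (k * k10 * N + 2 * N * (k' * k11)).
Proof.
move=> X1 X2; split; apply: diag_rank_block.
- exact: diag_rank_amplify (@star_hom_id _ _) _ X1.
- exact: diag_rank_amplify (@star_hom_xi _ _) (@xi1 _ _) X2.
- apply: diag_rank_flatten.
  exact: diag_rank_amplify (@star_hom_iota _ _) _ X1.
- apply: diag_rank_block_diag => j.
  exact: diag_rank_amplify (@star_hom_translate _ _) (@translate1 _ _) X2.
Qed.

(** The image of (1, 0) is the projection on the first m0 k00 and m0 k10 N basis
    vectors of the two components. *)
Lemma step_map_compress
    (E : stage R N (m0 * k00 + m1 * k01) (m0 * k10 * N + 2 * N * (m1 * k11))) :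
  diag_rank E.1 (m0 * k00) -> diag_rank E.2 (m0 * k10 * N) ->
  exists2 w : stage R N (m0 * k00 + m1 * k01) (m0 * k10 * N + 2 * N * (m1 * k11)),
    forall z, (map_mx (gamma z) w.1, map_mx (translate z) w.2) = w &
    w * E * star w = step_map theta k00 k01 k10 k11 (1, 0).
Proof.
move=> /(diag_rank_compress (@lshift_inj _ _))[t0 _ H0].
move=> /(diag_rank_compress (@lshift_inj _ _))[t1 _ H1].
exists (inj_mx _ (@lshift _ _) *m adj (inj_mx _ t0), inj_mx _ (@lshift _ _) *m adj (inj_mx _ t1)).
  move=> z; congr (_, _) => /=.
    rewrite (star_hom_mulmx _ _ (star_hom_gamma N z)) (star_hom_adj _ (star_hom_gamma N z)).
    by rewrite !(map_inj_mx _ (star_hom_gamma N z))//; exact: (gamma_scal_nat N z 1%N).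
  rewrite (star_hom_mulmx _ _ (star_hom_translate z)) (star_hom_adj _ (star_hom_translate z)).
  by rewrite !(map_inj_mx _ (star_hom_translate z)) ?translate1.
rewrite step_map_p10; congr (_, _).
  by etransitivity; [exact: H0|exact: inj_mx_lshift].
by etransitivity; [exact: H1|exact: inj_mx_lshift].
Qed.

End StepRank.

(** * C*-seminorms *)

Section Modulus.
Variable R : realType.
Implicit Types c d : R[i].

(** The norm of a complex number is itself a complex number. *)
Definition cmod c : R := complex.Re `|c|.

Lemma cmodE c : cmod c = ComplexField.Normc.normc c.
Proof. by case: c => a b; rewrite /cmod normc_def. Qed.

Lemma normCmod c : `|c| = (cmod c)%:C.
Proof. by rewrite /cmod normc_def. Qed.

Lemma cmod_ge0 c : 0 <= cmod c.
Proof. by rewrite /cmod normc_def /= sqrtr_ge0. Qed.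

Lemma cmodM c d : cmod (c * d) = cmod c * cmod d.
Proof. by rewrite !cmodE; exact: ComplexField.Normc.normcM. Qed.

Lemma cmodD c d : cmod (c + d) <= cmod c + cmod d.
Proof. by rewrite !cmodE; exact: le_normcD. Qed.

Lemma cmodN c : cmod (- c) = cmod c.
Proof. by rewrite /cmod normrN. Qed.

Lemma cmodR (x : R) : cmod x%:C = `|x|.
Proof. by rewrite /cmod normc_def /= expr0n addr0 sqrtr_sqr. Qed.

Lemma cmod_conj c : cmod (Num.conj c) = cmod c.
Proof. by rewrite /cmod norm_conjC. Qed.

Lemma cmod0 : cmod 0 = 0. Proof. by rewrite /cmod normr0. Qed.
Lemma cmod1 : cmod 1 = 1. Proof. by rewrite /cmod normr1. Qed.

Lemma cmodV c : cmod c^-1 = (cmod c)^-1.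
Proof. by rewrite {1}/cmod normfV normCmod -fmorphV. Qed.

Lemma cmod_eq0 c : cmod c = 0 -> c = 0.
Proof. by move=> c0; apply/eqP; rewrite -normr_eq0 normCmod c0. Qed.

Lemma conj_mul c : Num.conj c * c = (cmod c ^+ 2)%:C.
Proof. by rewrite mulrC -normCK normCmod rmorphXn. Qed.

Lemma cmod_sum I (r : seq I) (P : pred I) (F : I -> R[i]) :
  cmod (\sum_(i <- r | P i) F i) <= \sum_(i <- r | P i) cmod (F i).
Proof.
elim/big_rec2: _ => [|i x y _ xy]; first by rewrite cmod0.
by apply: le_trans (cmodD _ _) _; rewrite lerD2l.
Qed.

(** An action of the scalars which is submultiplicative for g is
    multiplicative, as c is invertible. *)
Lemma cmod_homogeneous V (act : R[i] -> V -> V) (g : V -> R) :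
  (forall c d v, act c (act d v) = act (c * d) v) -> (forall v, act 1 v = v) ->
  (forall v, 0 <= g v) -> (forall c v, g (act c v) <= cmod c * g v) ->
  forall c v, g (act c v) = cmod c * g v.
Proof.
move=> actM act1 g0 le c v; apply/le_anti; rewrite le /=.
have [->|c0] := eqVneq c 0; first by rewrite cmod0 mul0r.
have := le c^-1 (act c v); rewrite actM mulVf// act1 cmodV ler_pdivlMl//.
rewrite lt_neqAle cmod_ge0 andbT eq_sym; apply: contraNneq c0 => /cmod_eq0 ->.
by rewrite eqxx.
Qed.

Lemma normC_lt c (e : R) : (`|c| < e%:C) = (cmod c < e).
Proof. by rewrite normCmod ltcR. Qed.

Lemma complex_gt0E (e : R[i]) : 0 < e -> e = (complex.Re e)%:C /\ 0 < complex.Re e.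
Proof. by case: e => a b; rewrite ltcE /= => /andP[/eqP -> ->]. Qed.

Lemma complex_cvgP (T : topologicalType) (f : T -> R[i]^o) (z : T) :
  {for z, continuous f} <->
  forall e : R, 0 < e -> \forall w \near z, cmod (f w - f z) < e.
Proof.
split=> [cf e e0|cf].
  have /cvgrPdist_lt/(_ e%:C) := cf; rewrite ltcR => /(_ e0).
  by apply: filterS => w; rewrite distrC normC_lt.
apply/cvgrPdist_lt => e /complex_gt0E[-> /cf].
by apply: filterS => w; rewrite -normC_lt distrC.
Qed.

Lemma continuous_real_complex (T : topologicalType) (g : T -> R) :
  continuous g -> continuous (fun z => (g z)%:C : R[i]^o).
Proof.
move=> cg z; apply/complex_cvgP => e e0.
have /cvgrPdist_lt/(_ _ e0) := cg z; apply: filterS => w.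
by rewrite -rmorphB cmodR distrC.
Qed.

Lemma continuous_cmod (T : topologicalType) (f : T -> R[i]^o) :
  continuous f -> continuous (fun z => cmod (f z)).
Proof.
move=> cf z; apply/cvgrPdist_lt => e e0.
have /complex_cvgP/(_ _ e0) := cf z; apply: filterS => w; apply: le_lt_trans.
have h1 : cmod (f w) <= cmod (f w - f z) + cmod (f z) by rewrite -{1}[f w](subrK (f z)) cmodD.
have h2 : cmod (f z) <= cmod (f w - f z) + cmod (f w).
  by rewrite -[cmod (f w - f z)]cmodN opprB -{1}[f z](subrK (f w)) cmodD.
by rewrite ler_norml; lra.
Qed.

End Modulus.

Section Seminorm.
Variables (R : realType) (D : starAlgType R).

(** C*-seminorms: the norms of C*-algebras without definiteness and without
    completeness. *)
Definition cstar_seminorm (nu : D -> R) :=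
  [/\ forall a b, nu (a + b) <= nu a + nu b,
      forall c a, nu (scal c * a) = cmod c * nu a,
      forall a b, nu (a * b) <= nu a * nu b &
      forall a, nu (star a * a) = nu a ^+ 2].

Variable nu : D -> R.
Hypothesis hnu : cstar_seminorm nu.
Implicit Types a b p : D.

Lemma snormD a b : nu (a + b) <= nu a + nu b. Proof. by case: hnu. Qed.
Lemma snormZ c a : nu (scal c * a) = cmod c * nu a. Proof. by case: hnu. Qed.
Lemma snormM a b : nu (a * b) <= nu a * nu b. Proof. by case: hnu. Qed.
Lemma snorm_star_mul a : nu (star a * a) = nu a ^+ 2. Proof. by case: hnu. Qed.

Lemma snorm0 : nu 0 = 0.
Proof. by rewrite -(mulr0 (scal 0)) snormZ cmod0 mul0r. Qed.

Lemma snormN a : nu (- a) = nu a.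
Proof. by rewrite -mulN1r -(scal1 (s := D)) -scalN snormZ cmodN cmod1 mul1r. Qed.

Lemma snorm_ge0 a : 0 <= nu a.
Proof.
have := snormD a (- a); rewrite subrr snorm0 snormN.
by lra.
Qed.

Lemma snormB a b : nu (a - b) <= nu a + nu b.
Proof. by rewrite -(snormN b) snormD. Qed.

Lemma snorm_half a : nu (scal (2^-1)%:C * a) = nu a / 2.
Proof. by rewrite snormZ cmodR ger0_norm ?invr_ge0// mulrC. Qed.

Lemma snorm_dist a b : nu (a - b) = nu (b - a).
Proof. by rewrite -snormN opprB. Qed.

Lemma snorm_tri b a c : nu (a - c) <= nu (a - b) + nu (b - c).
Proof. by rewrite -(subrK b a) -[X in nu X]addrA subrK snormD. Qed.

Lemma snorm_star a : nu (star a) = nu a.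
Proof.
suff h b : nu b <= nu (star b) by apply/le_anti; rewrite h -{2}(starK a) h.
have := snorm_ge0 b; rewrite le_eqVlt => /predU1P[<-|b0]; first exact: snorm_ge0.
by rewrite -(ler_pM2r b0) -expr2 -snorm_star_mul snormM.
Qed.

Lemma snorm_proj p : is_projection p -> nu p <= 1.
Proof.
move=> [ps pp]; have := snorm_star_mul p; rewrite ps pp.
have := snorm_ge0 p; rewrite le_eqVlt => /predU1P[<- _|p0]; first exact: ler01.
by rewrite expr2 -{1}(mulr1 (nu p)) => /(mulfI (lt0r_neq0 p0)) <-.
Qed.

Lemma snorm_piso a : is_projection (star a * a) -> nu a <= 1.
Proof.
move=> /snorm_proj; rewrite snorm_star_mul => h.
by rewrite -(@ler_pXn2r _ 2) ?nnegrE ?snorm_ge0 ?expr1n.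
Qed.

Lemma snorm1 : nu 1 <= 1.
Proof. by apply: snorm_proj; split; rewrite ?star1 ?mulr1. Qed.

Lemma snorm_sum I (r : seq I) (P : pred I) (F : I -> D) :
  nu (\sum_(i <- r | P i) F i) <= \sum_(i <- r | P i) nu (F i).
Proof.
elim/big_rec2: _ => [|i x y _ xy]; first by rewrite snorm0.
by apply: le_trans (snormD _ _) _; rewrite lerD2l.
Qed.

Lemma snormX2 a k : star a = a -> nu (a ^+ (2 ^ k)) = nu a ^+ (2 ^ k).
Proof.
move=> sa; elim: k => [|k IH]; first by rewrite !expr1.
rewrite expnS mulnC !exprM -IH -snorm_star_mul; congr nu.
have -> : star (a ^+ (2 ^ k)) = a ^+ (2 ^ k); last by rewrite expr2.
elim: (2 ^ k)%N => [|m IHm]; first by rewrite expr0 star1.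
by rewrite exprS starM IHm sa -exprSr exprS.
Qed.

(** The standard way in which exact inequalities between C*-seminorms follow
    from inequalities up to a constant. *)
Lemma power_trick (x y C : R) : 0 <= x -> 0 <= y ->
  (forall k, x ^+ (2 ^ k) <= C * y ^+ (2 ^ k)) -> x <= y.
Proof.
move=> x0 y0 H; rewrite leNgt; apply/negP => xy.
have := y0; rewrite le_eqVlt => /predU1P[yE|{}y0].
  move: (H 0%N); rewrite expn0 !expr1 -yE mulr0 => x0'.
  by move: xy; rewrite -yE ltNge x0'.
pose t := x / y - 1.
have t0 : 0 < t by rewrite subr_gt0 ltr_pdivlMr// mul1r.
have bern n : 1 + n%:R * t <= (1 + t) ^+ n.
  elim: n => [|n IH]; first by rewrite mul0r addr0 expr0.
  rewrite exprSr; apply: (@le_trans _ _ ((1 + n%:R * t) * (1 + t))); last first.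
    by rewrite ler_wpM2r// addr_ge0// ltW.
  rewrite -natr1 -subr_ge0.
  have -> : (1 + n%:R * t) * (1 + t) - (1 + (n%:R + 1) * t) = n%:R * t * t by ring.
  by rewrite !mulr_ge0// ltW.
have Hk k : 1 + (2 ^ k)%:R * t <= C.
  apply: le_trans (bern _) _; rewrite /t addrC subrK exprMn exprVn.
  by rewrite ler_pdivrMr ?exprn_gt0.
have [n Cn] : exists n, C < n%:R * t.
  exists (Num.bound `|C / t|); rewrite -ltr_pdivrMr//.
  exact: le_lt_trans (ler_norm _) (archi_boundP (normr_ge0 _)).
have := Hk n; rewrite leNgt => /negP; apply; apply: lt_trans Cn _.
rewrite ltr_pwDl// ler_wpM2r ?(ltW t0)// ler_nat ltnW//; exact: ltn_expl.
Qed.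

End Seminorm.

Lemma cnorm_seminorm (R : realType) (A : cstarType R) : cstar_seminorm (@cnorm R A).
Proof. by split; [exact: cnormD|exact: cnormZ|exact: cnormM|exact: cnorm_star]. Qed.

(** h is the real part of the unitary h + i y, which a *-homomorphism maps to a
    partial isometry. *)
Lemma hom_cos_le1 (R : realType) (C D : starAlgType R) (nu : D -> R) (pi : C -> D) h y :
  cstar_seminorm nu -> star_hom pi -> star h = h -> star y = y -> y * h = h * y ->
  y * y = 1 - h * h -> nu (pi h) <= 1.
Proof.
move=> hnu hpi hs ys yh yy; pose U := h + scal 'i * y.
have ii : scal 'i * scal 'i = -1 :> C.
  by rewrite -scalM -(scal1 (s := C)) -scalN; congr scal; rewrite -expr2; exact: sqr_i.
have Us : star U = h - scal 'i * y.
  rewrite /U starD starM hs ys star_scal -scalC -mulNr -scalN.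
  by congr (_ + scal _ * _); apply/eqP; rewrite eq_complex /= !oppr0 !eqxx.
have UU : star U * U = 1.
  rewrite Us /U mulrDl !mulrDr !mulNr -[scal 'i * y * h]mulrA yh.
  have -> : h * (scal 'i * y) = scal 'i * (h * y) by rewrite mulrA -scalC mulrA.
  have -> : scal 'i * y * (scal 'i * y) = - (y * y).
    by rewrite -mulrA [y * _]mulrA -scalC -mulrA mulrA ii mulN1r.
  by rewrite opprK addrA addrK yy addrC subrK.
have nU : nu (pi U) <= 1.
  apply: (snorm_piso hnu); rewrite -(star_homS hpi) -(star_homM hpi) UU.
  exact: star_hom_proj.
have -> : h = scal (2^-1)%:C * (U + star U).
  by rewrite Us /U addrACA subrr addr0 mulrDr half_add.
rewrite (star_homZ hpi) (snorm_half hnu) (star_homD hpi) (star_homS hpi).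
by have := snormD hnu (pi U) (star (pi U)); rewrite (snorm_star hnu); lra.
Qed.

Section FunctionsOnCircle.
Variable R : realType.
Local Notation S1 := (circle R).
Implicit Types (f g : cfun R) (z w : S1).

Lemma cfun_continuous f : continuous (val f : S1 -> R[i]^o).
Proof. exact: (elimT (asboolP _) (valP f)). Qed.

Definition rcfun (g : S1 -> R) (cg : continuous g) : cfun R :=
  mkcfun (continuous_real_complex cg).

Lemma ceval_rcfun (g : S1 -> R) (cg : continuous g) z :
  ceval z (rcfun cg) = (g z)%:C.
Proof. by []. Qed.

Lemma continuous_cmod_cfun f : continuous (fun z => cmod (ceval z f)).
Proof. exact: continuous_cmod (@cfun_continuous f). Qed.

Lemma sqrt_cont (g : S1 -> R) : continuous g -> continuous (fun z => Num.sqrt (g z)).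
Proof. by move=> cg z; apply: (continuous_comp (cg z)); exact: sqrt_continuous. Qed.

Section ContractiveHoms.
Variables (D : starAlgType R) (nu : D -> R).
Hypothesis hnu : cstar_seminorm nu.
Variable pi : cfun R -> D.
Hypothesis hpi : star_hom pi.

(** If |f| <= 1 then 1 - h^2 has a square root for h = |f|^2. *)
Lemma star_hom_contractive f (M : R) : (forall z, cmod (ceval z f) <= M) -> nu (pi f) <= M.
Proof.
(* Division by M + e rather than M avoids the case M = 0. *)
wlog M1 : f M / M = 1.
  move=> H fM; have M0 : 0 <= M by apply: le_trans (fM 1%g); exact: cmod_ge0.
  apply/ler_addgt0Pr => e e0; have Me : 0 < M + e by lra.
  have -> : f = scal (M + e)%:C * (scal ((M + e)^-1)%:C * f).
    by rewrite mulrA -scalM -rmorphM mulfV ?lt0r_neq0// scal1 mul1r.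
  rewrite (star_homZ hpi) (snormZ hnu) cmodR gtr0_norm// -[leRHS]mulr1 ler_pM2l//.
  apply: H => // z; rewrite cevalM ceval_scal cmodM cmodR gtr0_norm ?invr_gt0//.
  by rewrite mulrC ler_pdivrMr// mul1r (le_trans (fM z))// lerDl ltW.
rewrite {M}M1 => f1.
have [h hh] : exists h, h = star f * f by exists (star f * f).
have hE z : ceval z h = (cmod (ceval z f) ^+ 2)%:C.
  by rewrite hh cevalM ceval_star conj_mul.
have cg : continuous (fun z => Num.sqrt (1 - cmod (ceval z f) ^+ 4)).
  apply: sqrt_cont => z; apply: (@cvgB R R^o _ (nbhs z) _ (cst 1) (fun z => cmod (ceval z f) ^+ 4)).
    exact: cvg_cst.
  apply: (@continuous_comp _ _ _ (fun z => cmod (ceval z f)) (fun x : R => x ^+ 4)).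
    exact: continuous_cmod_cfun.
  exact: exprn_continuous.
have nh : nu (pi h) <= 1.
  apply: (hom_cos_le1 (y := rcfun cg) hnu hpi); first by rewrite hh starM starK.
  - by apply: cfunP => z; rewrite ceval_star ceval_rcfun; exact: conjc_real.
  - by apply: cfunP => z; rewrite !cevalM mulrC.
  - apply: cfunP => z; rewrite -[RHS]/(1 - ceval z (h * h)) !cevalM hE ceval_rcfun -!rmorphM.
    rewrite -(rmorph1 (real_complex R)) -rmorphB /= -!expr2.
    by rewrite sqr_sqrtr -?exprM// subr_ge0 exprn_ile1//; exact: cmod_ge0.
rewrite -(@ler_pXn2r _ 2) ?nnegrE ?(snorm_ge0 hnu)// expr1n.
by rewrite -(snorm_star_mul hnu) -(star_homS hpi) -(star_homM hpi) -hh.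
Qed.

End ContractiveHoms.
End FunctionsOnCircle.

(** * The circle *)

Section CircleFacts.
Variable R : realType.
Local Notation S1 := (circle R).
Implicit Types (f g : cfun R) (z w : S1) (s t u e : R).

Lemma circle_nbhsP (z : S1) (U : set S1) : nbhs z U <->
  exists2 d : R, 0 < d & forall w, cmod (val w - val z) < d -> U w.
Proof.
split=> [|[d d0 dU]].
  move=> [_ [[W oW <-] Wz] WU].
  have /nbhs_ballP[e e0 eW] : nbhs (val z : R[i]^o) W by exact: open_nbhs_nbhs.
  have [eE e0'] := complex_gt0E e0.
  exists (complex.Re e) => // w wz; apply: WU; apply: eW.
  by rewrite -ball_normE /ball_ /= distrC eE normC_lt.
have /complex_cvgP/(_ d d0) : {for z, continuous (val : S1 -> R[i]^o)}.
  exact: initial_continuous.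
by apply: filterS => w; exact: dU.
Qed.

Lemma cmod_circle z : cmod (val z) = 1.
Proof. by have := valP z; rewrite normCmod => /eqP[]. Qed.

Lemma cmod_le_abs (a b : R) : cmod (a +i* b) <= `|a| + `|b|.
Proof.
rewrite [_ +i* _]complexE /=; apply: le_trans (cmodD _ _) _.
by rewrite cmodM !cmodR /cmod normc_def /= expr0n expr1n add0r sqrtr1 mul1r.
Qed.

Lemma continuous_cis : continuous (@cis R).
Proof.
apply: continuous_comp_initial => t; apply/complex_cvgP => e e0.
have ct : continuous (fun t : R => 2 * pi * t) by exact: mulrl_continuous.
have /cvgrPdist_lt/(_ (e / 2)) hc : {for t, continuous (cos \o (fun t : R => 2 * pi * t))}.
  by apply: continuous_comp; [exact: ct|exact: continuous_cos].
have /cvgrPdist_lt/(_ (e / 2)) hs : {for t, continuous (sin \o (fun t : R => 2 * pi * t))}.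
  by apply: continuous_comp; [exact: ct|exact: continuous_sin].
have e2 : 0 < e / 2 by lra.
near=> w; apply: le_lt_trans (cmod_le_abs _ _) _.
rewrite distrC [X in _ + X]distrC.
have : `|cos (2 * pi * t) - cos (2 * pi * w)| < e / 2 by near: w; exact: hc.
have : `|sin (2 * pi * t) - sin (2 * pi * w)| < e / 2 by near: w; exact: hs.
by lra.
Unshelve. all: by end_near. Qed.

(** The angle is given by the arc cosine of the real part. *)
Lemma cis_surj z : exists2 t, -1 <= t <= 1 & z = cis t.
Proof.
have := cmod_circle z; case: z => -[x y] z1 /=; rewrite /cmod normc_def /= => xy1.
have xy : x ^+ 2 + y ^+ 2 = 1.
  by rewrite -(sqr_sqrtr (a := x ^+ 2 + y ^+ 2)) ?xy1 ?expr1n// addr_ge0 ?sqr_ge0.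
have x1 : -1 <= x <= 1.
  by rewrite -ler_norml -(@ler_pXn2r _ 2) ?nnegrE// expr1n real_normK ?num_real// -xy lerDl sqr_ge0.
have pi0 := pi_gt0 R.
have a0 := acos_ge0 x1; have api := acos_lepi x1.
have sa : sin (acos x) = `|y|.
  by rewrite sin_acos// -sqrtr_sqr; congr Num.sqrt; rewrite -xy addrC addKr.
have ca : cos (acos x) = x by rewrite acosK// in_itv.
have ta : 0 <= acos x / (2 * pi) <= 1.
  by rewrite divr_ge0 ?mulr_ge0 ?pi_ge0//= ler_pdivrMr ?mulr_gt0// mul1r; lra.
have te : 2 * pi * (acos x / (2 * pi)) = acos x.
  by rewrite mulrC divfK// mulf_neq0 ?pnatr_eq0// gt_eqF.
have [y0|y0] := leP 0 y.
  exists (acos x / (2 * pi)); first by case/andP: ta => *; apply/andP; split; lra.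
  by apply: val_inj; rewrite /= te ca sa ger0_norm.
exists (- (acos x / (2 * pi))); first by case/andP: ta => *; apply/andP; split; lra.
by apply: val_inj; rewrite /= mulrN te cosN sinN ca sa ltr0_norm// opprK.
Qed.

Lemma circle_compact : compact [set: S1].
Proof.
have -> : [set: S1] = @cis R @` `[-1, 1].
  by apply/seteqP; split=> // z _; have [t t1 ->] := cis_surj z; exists t; rewrite //= in_itv.
apply: continuous_compact; last exact: segment_compact.
by apply: continuous_subspaceT; exact: continuous_cis.
Qed.

Lemma cfun_uniform f e : 0 < e ->
  exists2 d : R, 0 < d & forall z w, cmod (val w - val z) < d -> cmod (ceval w f - ceval z f) < e.
Proof.
move=> e0; have e2 : 0 < e / 2 by lra.
pose P (d : R) z := forall w, cmod (val w - val z) < d -> cmod (ceval w f - ceval z f) < e.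
have /compact_near_coveringP/(_ R 0^'+ P) H := circle_compact.
have : \forall d \near 0^'+, forall z, P d z.
  have : \forall d \near 0^'+, [set: S1] `<=` P d.
    apply: H => z _.
    have /complex_cvgP/(_ _ e2) /circle_nbhsP[d d0 hd] := @cfun_continuous R f z.
    have d2 : 0 < d / 2 by lra.
    exists ([set w | cmod (val w - val z) < d / 2], [set r : R | r < d / 2]) => /=.
      split; first by apply/circle_nbhsP; exists (d / 2).
      exact: nbhs_right_lt.
    move=> [w r] [/= wz rd] v vw.
    have h1 : cmod (ceval v f - ceval z f) < e / 2.
      apply: hd; rewrite -(subrK (val w) (val v)) -addrA.
      by apply: le_lt_trans (cmodD _ _) _; lra.
    have h2 : cmod (ceval w f - ceval z f) < e / 2 by apply: hd; lra.
    rewrite -(subrK (ceval z f) (ceval v f)) -addrA.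
    apply: le_lt_trans (cmodD _ _) _; rewrite -[X in _ + X]cmodN opprB.
    by lra.
  by apply: filterS => d Hd z; exact: Hd.
move=> hP; have [d [dP d0]] : exists d : R, (forall z, P d z) /\ 0 < d.
  near (0 : R)^'+ => d; exists d; split; last by near: d; exact: nbhs_right_gt.
  by near: d.
by exists d.
Unshelve. all: by end_near. Qed.

Lemma cis_small e : 0 < e ->
  exists2 d : R, 0 < d & forall t, `|t| < d -> cmod (val (cis t) - 1) < e.
Proof.
move=> e0; have : nbhs (0 : R) [set t | cmod (val (cis t) - 1) < e].
  have : nbhs (cis (0 : R)) [set w | cmod (val w - 1) < e].
    by apply/circle_nbhsP; exists e; rewrite ?cis0.
  exact: (@continuous_cis 0).
move=> /nbhs_ballP[d d0 H]; exists d => // t td; apply: H.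
by rewrite -ball_normE /ball_ /= sub0r normrN.
Qed.

Lemma cfun_uniform_cis f e : 0 < e ->
  exists2 d : R, 0 < d & forall t z, `|t| < d -> cmod (ceval (cis t * z)%g f - ceval z f) < e.
Proof.
move=> /(cfun_uniform f)[d d0 Hd]; have [r r0 Hr] := cis_small d0.
exists r => // t z /Hr td; apply: Hd => /=.
by rewrite -[X in _ - X]mul1r -mulrBl cmodM cmod_circle mulr1.
Qed.

Lemma cfun_bounded f : exists2 M : R, 0 <= M & forall z, cmod (ceval z f) <= M.
Proof.
have /compact_bounded[M [Mr HM]] : compact ((fun z => cmod (ceval z f)) @` [set: S1]).
  apply: (@continuous_compact _ R^o); last exact: circle_compact.
  by apply: continuous_subspaceT; exact: continuous_cmod_cfun.
exists (`|M| + 1) => [|z]; first by rewrite addr_ge0.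
have := HM (`|M| + 1); rewrite ltr_pwDr ?ler_norm// => /(_ isT _ (imageT _ z)).
exact: le_trans (ler_norm _).
Qed.

(** f is bounded, so the supremum in cfun_norm is a true one. *)
Lemma cfun_norm_ge f z : cmod (ceval z f) <= cfun_norm f.
Proof.
rewrite /cfun_norm; apply: ub_le_sup; last by exists z.
by have [M _ HM] := cfun_bounded f; exists M => _ [w _ <-]; exact: HM.
Qed.

(** By the pigeonhole principle two multiples of t are close modulo 1; they
    differ by some s, nonzero as t is irrational, and modulo 1 u is within |s| of
    a multiple of s. *)
Lemma irrational_dense t u e : irrational t -> 0 < e ->
  exists (j : nat) (m : int), `|u - j%:R * t - m%:~R| < e.
Proof.
move=> irr e0.
have [M Me] : exists M : nat, (0 < M)%N /\ 1 / M%:R < e.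
  exists (Num.bound (1 / e)).+1; split=> //.
  rewrite ltr_pdivrMr ?ltr0n// mulrC -ltr_pdivrMr//.
  apply: lt_trans (archi_boundP _) _; first by rewrite divr_ge0// ltW.
  by rewrite ltr_nat.
have {Me}[M0 Me] := Me; have M0' : 0 < M%:R :> R by rewrite ltr0n.
pose fr (j : nat) : R := j%:R * t - (Num.floor (j%:R * t))%:~R.
have fr0 j : 0 <= fr j by rewrite subr_ge0 floor_le.
have fr1 j : fr j < 1 by rewrite ltrBlDl -[ltRHS]intrD1 floorD1_gt.
have box j : (Num.truncn (M%:R * fr j) < M)%N.
  rewrite -(ltr_nat R); have /andP[+ _] := truncn_itv (mulr_ge0 (ltW M0') (fr0 j)).
  by move=> /le_lt_trans; apply; rewrite -[ltRHS]mulr1 ltr_pM2l.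
pose b (j : 'I_M.+1) : 'I_M := Ordinal (box j).
have [i [j [ij bij]]] : exists i j, i != j /\ b i = b j.
  have /injectivePn[i [j ij bij]] : ~~ injectiveb b.
    apply/negP => /injectiveP /leq_card; rewrite !card_ord.
    by rewrite ltnn.
  by exists i, j.
wlog lij : i j ij bij / (i < j)%N.
  move=> H; have [/H|/H|/val_inj/eqP] := ltngtP i j; [exact| |by rewrite (negPf ij)].
  by apply=> //; rewrite eq_sym.
have frij : `|fr j - fr i| < 1 / M%:R.
  have ti := truncn_itv (mulr_ge0 (ltW M0') (fr0 i)).
  have tj := truncn_itv (mulr_ge0 (ltW M0') (fr0 j)).
  have E : Num.truncn (M%:R * fr i) = Num.truncn (M%:R * fr j) by case: bij.
  move: ti tj; rewrite E -natr1 => /andP[i1 i2] /andP[j1 j2].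
  rewrite ltr_pdivlMr// -[X in _ * X]gtr0_norm// -normrM ltr_norml mulrBl.
  by rewrite ![_ * M%:R]mulrC; apply/andP; split; lra.
pose d := (j - i)%N.
have [m mE] : exists m : int, fr j - fr i = d%:R * t - m%:~R.
  exists (Num.floor (j%:R * t) - Num.floor (i%:R * t)).
  by rewrite /fr /d natrB ?(ltnW lij)// rmorphB /=; ring.
have d0 : (0 < d)%N by rewrite subn_gt0.
set s := fr j - fr i in frij mE.
have s0 : s != 0.
  apply/eqP => s0; apply: irr; exists (m%:Q / d%:R) => //.
  rewrite fmorph_div /= ratr_int ratr_nat.
  have -> : m%:~R = d%:R * t :> R by apply/eqP; rewrite -subr_eq0 -oppr_eq0 opprB -mE s0.
  by rewrite mulrC mulKf// pnatr_eq0 -lt0n.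
have [n [k nk]] : exists (n : nat) (k : int), `|u + k%:~R - n%:R * s| <= `|s|.
  have [sp|sn] := ltP 0 s.
    exists (Num.truncn ((u - (Num.floor u)%:~R) / s)), (- Num.floor u).
    have x0 : 0 <= (u - (Num.floor u)%:~R) / s by rewrite divr_ge0 ?(ltW sp)// subr_ge0; exact: floor_le.
    have /andP[] := truncn_itv x0; rewrite ler_pdivlMr// ltr_pdivrMr// -natr1 rmorphN /=.
    set q := _%:R; rewrite mulrDl mul1r => h1 h2.
    by rewrite (gtr0_norm sp) ler_norml; apply/andP; split; lra.
  have {}sn : s < 0 by rewrite lt_neqAle s0.
  (* u is moved to [-1, 0), so that the quotient by s is nonnegative. *)
  exists (Num.truncn ((u - (Num.floor u)%:~R - 1) / s)), (- Num.floor u - 1).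
  have u1 : u - (Num.floor u)%:~R - 1 <= 0.
    by have := floorD1_gt u; rewrite intrD1; lra.
  have x0 : 0 <= (u - (Num.floor u)%:~R - 1) / s by rewrite mulr_le0// invr_le0 ltW.
  have /andP[] := truncn_itv x0; rewrite ler_ndivlMr// ltr_ndivrMr// -natr1 rmorphB rmorphN /=.
  set q := _%:R; rewrite mulrDl mul1r => h1 h2.
  by rewrite (ltr0_norm sn) ler_norml; apply/andP; split; lra.
exists (n * d)%N, (- k - n%:Z * m).
have -> : u - (n * d)%:R * t - (- k - n%:Z * m)%:~R = u + k%:~R - n%:R * s.
  by rewrite mE natrM rmorphB rmorphN rmorphM /=; ring.
by apply: le_lt_trans nk _; apply: lt_trans frij Me.
Qed.

Lemma cis_int (m : int) : cis (m%:~R : R) = 1%g.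
Proof.
have nat1 n : cis (n%:R : R) = 1%g by rewrite -[n%:R]mulr1 -cisX cis1 expg1n.
case: m => n; first exact: nat1.
rewrite NegzE rmorphN /=; apply: (can_inj (mulgK (cis (n.+1%:R : R)))).
by rewrite -cisD addNr cis0 nat1 mulg1.
Qed.

(** The rotations of the open set where f is large cover the circle, which is
    compact. *)
Lemma orbit_cover theta f c : irrational theta -> (exists z, c < complex.Re (ceval z f)) ->
  exists k, forall z, exists2 j : nat, (j <= k)%N &
    c < complex.Re (ceval z (translate (cis (j%:R * theta)) f)).
Proof.
move=> irr [z0 z0c].
have Re_cont (g : cfun R) (z : S1) : c < complex.Re (ceval z g) ->
    exists2 d : R, 0 < d & forall w, cmod (val w - val z) < d -> c < complex.Re (ceval w g).
  move=> zc; have e0 : 0 < complex.Re (ceval z g) - c by rewrite subr_gt0.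
  have [d d0 Hd] := cfun_uniform g e0; exists d => // w /Hd.
  have : `|complex.Re (ceval w g - ceval z g)| <= cmod (ceval w g - ceval z g).
    by rewrite -lecR -normCmod; exact: normc_ge_Re.
  case: (ceval w g) (ceval z g) => a b [a' b'] /=.
  by rewrite ler_norml => /andP[h1 h2] h3; lra.
have orb z : exists j : nat, c < complex.Re (ceval z (translate (cis (j%:R * theta)) f)).
  have [d d0 Hd] := Re_cont _ _ z0c; have [r r0 Hr] := cis_small d0.
  have [u _ uE] := cis_surj (z * z0^-1)%g.
  have [j [m jm]] := irrational_dense u irr r0.
  exists j; rewrite ceval_translate; apply: Hd.
  have -> : ((cis (j%:R * theta))^-1 * z = cis (u - j%:R * theta - m%:~R) * z0)%g.
    apply: (can_inj (mulKg (cis (j%:R * theta)))); rewrite mulVKg mulgA -cisD.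
    have -> : j%:R * theta + (u - j%:R * theta - m%:~R) = u - m%:~R by ring.
    have -> : cis (u - m%:~R) = cis u by rewrite -mulrNz cisD cis_int mulg1.
    by rewrite -uE mulgVK.
  by rewrite -[X in _ - X]mul1r -mulrBl cmodM cmod_circle mulr1; exact: Hr.
pose P (k : nat) z := exists2 j : nat, (j <= k)%N &
    c < complex.Re (ceval z (translate (cis (j%:R * theta)) f)).
have /compact_near_coveringP/(_ nat \oo P) H := circle_compact.
have : \forall k \near \oo, [set: S1] `<=` P k.
  apply: H => z _; have [j /Re_cont[d d0 Hd]] := orb z.
  exists ([set w | cmod (val w - val z) < d], [set k | (j <= k)%N]) => /=.
    by split; [apply/circle_nbhsP; exists d|exact: nbhs_infty_ge].
  by move=> [w k] [/= /Hd ? jk]; exists j.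
by move=> [k _ /(_ k (leqnn k)) Hk]; exists k => z; exact: Hk.
Qed.

(** Averages over the finite subgroups of the circle serve instead of the
    integral. *)
Definition circle_avg k f : cfun R :=
  scal (k%:R^-1)%:C * \sum_(j < k) translate (omega R k ^+ j)%g f.

Lemma ceval_avg k f z : ceval z (circle_avg k f) =
  (k%:R^-1)%:C * \sum_(j < k) ceval ((omega R k ^+ j)^-1 * z)%g f.
Proof.
rewrite /circle_avg cevalM ceval_scal; congr (_ * _).
by rewrite rmorph_sum.
Qed.

Lemma circle_avg_invariant k f z m : (0 < k)%N ->
  ceval (omega R k ^+ m * z)%g (circle_avg k f) = ceval z (circle_avg k f).
Proof.
move=> k0; elim: m => [|m IH]; first by rewrite expg0 mul1g.
rewrite -IH expgS -mulgA; move: (_ * z)%g => {IH}w; rewrite !ceval_avg; congr (_ * _).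
rewrite (reindex_inj (can_inj (@ordSK k))) /=; apply: eq_bigr => j _; congr ceval.
apply: (can_inj (mulKg (omega R k ^+ (j.+1 %% k))%g)); rewrite mulVKg.
by rewrite omegaX_mod// expgS -mulgA mulVKg.
Qed.

Lemma circle_near_root k z : (0 < k)%N -> exists (j : 'I_k) (t : R),
  0 <= t < 1 / k%:R /\ z = (omega R k ^+ j * cis t)%g.
Proof.
move=> k0; have k0' : 0 < k%:R :> R by rewrite ltr0n.
have [t0 t0E zE] : exists2 t : R, 0 <= t & z = cis t.
  have [t /andP[t1 _] ->] := cis_surj z; exists (t + 1); first by lra.
  by rewrite cisD cis1 mulg1.
have x0 : 0 <= t0 * k%:R by rewrite mulr_ge0// ltW.
have /andP[] := truncn_itv x0; set m := Num.truncn _ => m1 m2.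
have mk : (m %% k < k)%N by rewrite ltn_mod.
exists (Ordinal mk), (t0 - m%:R / k%:R); split.
  rewrite subr_ge0 ler_pdivrMr// m1 /= ltr_pdivlMr// mulrBl divfK ?gt_eqF//.
  by move: m2; rewrite -natr1; lra.
by rewrite /= omegaX_mod// omegaXn -cisD addrC subrK.
Qed.

(** The average is invariant under the roots of unity, and every point is close
    to one of them. *)
Lemma circle_avg_const f e : 0 < e -> exists K, forall k, (K <= k)%N -> (0 < k)%N ->
  forall z, cmod (ceval z (circle_avg k f) - ceval 1%g (circle_avg k f)) <= e.
Proof.
move=> e0; have [d d0 Hd] := cfun_uniform_cis f e0.
exists (Num.bound (1 / d)).+1 => k Kk k0 z.
have k0' : 0 < k%:R :> R by rewrite ltr0n.
have kd : 1 / k%:R < d.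
  rewrite ltr_pdivrMr// mulrC -ltr_pdivrMr//.
  apply: lt_le_trans (archi_boundP _) _; first by rewrite divr_ge0// ltW.
  by rewrite ler_nat ltnW.
have [m [t [/andP[t0 tk] ->]]] := circle_near_root z k0.
rewrite circle_avg_invariant// !ceval_avg -mulrBr -sumrB cmodM cmodR gtr0_norm ?invr_gt0//.
rewrite ler_pdivrMl//; apply: le_trans (cmod_sum _ _ _) _.
have -> : k%:R * e = \sum_(j < k) e by rewrite sumr_const card_ord mulr_natl.
apply: ler_sum => j _; apply: ltW.
rewrite circleMC mulg1; apply: Hd.
by rewrite ger0_norm//; exact: lt_trans tk kd.
Qed.

End CircleFacts.

(** * Direct limits *)

Section ClosedSubalgebra.
Variables (R : realType) (A : cstarType R).

Definition star_subalgebra (S : set A) :=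
  [/\ S 1, forall a b, S a -> S b -> S (a - b),
      forall a b, S a -> S b -> S (a * b),
      forall c, S (scal c) & forall a, S a -> S (star a)].

Definition limit_closed (S : set A) := forall (u : nat -> A) a, (forall n, S (u n)) ->
  cnorm (u n - a) @[n --> \oo] --> (0 : R) -> S a.

(** Bundled with its proofs of closedness, so that the type of its elements can
    be made a C*-algebra. *)
Record closed_subalgebra := ClosedSubalgebra {
  csub_set : set A;
  csub_star : star_subalgebra csub_set;
  csub_limit : limit_closed csub_set }.

Section Algebra.
Variable B : closed_subalgebra.

Definition csub_pred : {pred A} := fun a => `[< csub_set B a >].

Fact csub_subring : GRing.subring_closed csub_pred.
Proof.
have [S1 SB SM _ _] := csub_star B.
split=> [|a b /asboolP Sa /asboolP Sb|a b /asboolP Sa /asboolP Sb]; apply/asboolP.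
- exact: S1.
- exact: SB.
- exact: SM.
Qed.
HB.instance Definition _ := GRing.isSubringClosed.Build _ csub_pred csub_subring.

Definition csub : Type := {a : A | a \in csub_pred}.
HB.instance Definition _ := [isSub of csub for (@proj1_sig _ _)].
HB.instance Definition _ := [Choice of csub by <:].
HB.instance Definition _ := GRing.SubChoice_isSubPzRing.Build _ _ csub csub_subring.

Definition mkcsub a (Sa : csub_set B a) : csub := exist _ a (introT (asboolP _) Sa).

Fact csub_scal_subproof c : csub_set B (scal c).
Proof. by have [] := csub_star B. Qed.
Fact csub_star_subproof (a : csub) : csub_set B (star (val a)).
Proof. by have [_ _ _ _ h] := csub_star B; apply: h; exact: (elimT (asboolP _) (valP a)). Qed.

Definition csub_scal c : csub := mkcsub (csub_scal_subproof c).
Definition csub_inv (a : csub) : csub := mkcsub (csub_star_subproof a).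

Fact csub_scal1 : csub_scal 1 = 1. Proof. by apply: val_inj; rewrite /= scal1. Qed.
Fact csub_scalD : {morph csub_scal : c d / c + d}.
Proof. by move=> c d; apply: val_inj; rewrite /= scalD. Qed.
Fact csub_scalM : {morph csub_scal : c d / c * d}.
Proof. by move=> c d; apply: val_inj; rewrite /= scalM. Qed.
Fact csub_scalC c a : csub_scal c * a = a * csub_scal c.
Proof. by apply: val_inj; rewrite /= scalC. Qed.
Fact csub_invK : involutive csub_inv.
Proof. by move=> a; apply: val_inj; rewrite /= starK. Qed.
Fact csub_invD : {morph csub_inv : a b / a + b}.
Proof. by move=> a b; apply: val_inj; rewrite /= starD. Qed.
Fact csub_invM a b : csub_inv (a * b) = csub_inv b * csub_inv a.
Proof. by apply: val_inj; rewrite /= starM. Qed.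
Fact csub_inv_scal c : csub_inv (csub_scal c) = csub_scal c^*.
Proof. by apply: val_inj; rewrite /= star_scal. Qed.
HB.instance Definition _ := isStarAlgebra.Build R csub csub_scal1 csub_scalD
  csub_scalM csub_scalC csub_invK csub_invD csub_invM csub_inv_scal.

Definition csub_norm (a : csub) : R := cnorm (val a).

Fact csub_norm_eq0 a : csub_norm a = 0 -> a = 0.
Proof. by move=> /cnorm_eq0 a0; apply: val_inj. Qed.
Fact csub_normD a b : csub_norm (a + b) <= csub_norm a + csub_norm b.
Proof. exact: cnormD. Qed.
Fact csub_normZ c a : csub_norm (scal c * a) = complex.Re `|c| * csub_norm a.
Proof. exact: cnormZ. Qed.
Fact csub_normM a b : csub_norm (a * b) <= csub_norm a * csub_norm b.
Proof. exact: cnormM. Qed.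
Fact csub_norm_star a : csub_norm (star a * a) = csub_norm a ^+ 2.
Proof. exact: cnorm_star. Qed.
Fact csub_complete (u : nat -> csub) :
  (forall e : R, 0 < e -> exists k, forall m n,
    (k <= m)%N -> (k <= n)%N -> csub_norm (u m - u n) < e) ->
  exists l : csub, csub_norm (u n - l) @[n --> \oo] --> (0 : R).
Proof.
move=> /(cnorm_complete (fun n => val (u n)))[l ul].
have Sl : csub_set B l.
  by apply: csub_limit ul => n; exact: (elimT (asboolP _) (valP (u n))).
by exists (mkcsub Sl).
Qed.
HB.instance Definition _ := isCStar.Build R csub csub_norm_eq0 csub_normD
  csub_normZ csub_normM csub_norm_star csub_complete.

Lemma star_hom_csub_val : star_hom (val : csub -> A).
Proof. by []. Qed.

End Algebra.

Definition norm_closure (S : set A) : set A :=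
  [set a | forall e : R, 0 < e -> exists2 b, S b & cnorm (a - b) < e].

Let hn := cnorm_seminorm A.

Lemma star_subalgebra_closure S : star_subalgebra S -> star_subalgebra (norm_closure S).
Proof.
move=> [S1 SB SM Sc Ss].
have SS a : S a -> norm_closure S a.
  by move=> Sa e e0; exists a; rewrite ?subrr ?(snorm0 hn).
split; [exact: SS| | |by move=> c; exact: SS|].
- move=> a b Sa Sb e e0; have e2 : 0 < e / 2 by lra.
  have [a' Sa' aa] := Sa _ e2; have [b' Sb' bb] := Sb _ e2.
  exists (a' - b'); first exact: SB.
  have -> : a - b - (a' - b') = (a - a') - (b - b').
    rewrite !opprB -!addrA; congr (_ + _).
    by rewrite [LHS]addrC -addrA [RHS]addrCA.
  by apply: le_lt_trans (snormB hn _ _) _; lra.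
- move=> a b Sa Sb e e0.
  have b0 : 0 < cnorm b + 1 by have := snorm_ge0 hn b; lra.
  have eb : 0 < e / 2 / (cnorm b + 1) by rewrite !divr_gt0.
  have [a' Sa' aa] := Sa _ eb.
  have a0 : 0 < cnorm a' + 1 by have := snorm_ge0 hn a'; lra.
  have ea : 0 < e / 2 / (cnorm a' + 1) by rewrite !divr_gt0.
  have [b' Sb' bb] := Sb _ ea.
  exists (a' * b'); first exact: SM.
  have -> : a * b - a' * b' = (a - a') * b + a' * (b - b').
    by rewrite mulrBl mulrBr addrA subrK.
  have h1 : cnorm (a - a') * cnorm b <= e / 2.
    apply: (@le_trans _ _ (e / 2 / (cnorm b + 1) * (cnorm b + 1))); last by rewrite divfK// gt_eqF.
    by apply: ler_pM; rewrite ?(snorm_ge0 hn) ?(ltW aa)// lerDl.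
  have h2 : cnorm a' * cnorm (b - b') < e / 2.
    apply: (@le_lt_trans _ _ ((cnorm a' + 1) * cnorm (b - b'))).
      by apply: ler_wpM2r; rewrite ?(snorm_ge0 hn)// lerDl.
    by rewrite mulrC -ltr_pdivlMr.
  apply: le_lt_trans (snormD hn _ _) _.
  by have := snormM hn (a - a') b; have := snormM hn a' (b - b'); lra.
- move=> a Sa e e0; have [a' Sa' aa] := Sa _ e0; exists (star a'); first exact: Ss.
  by rewrite -starB (snorm_star hn).
Qed.

Lemma norm_closure_limit S : limit_closed (norm_closure S).
Proof.
move=> u a Su ua e e0; have e2 : 0 < e / 2 by lra.
have /cvgr0Pnorm_lt/(_ _ e2)[n _ /(_ n (leqnn n)) un] := ua.
have [b Sb ub] := Su n _ e2; exists b => //.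
have := snorm_tri hn (u n) a b; rewrite (snorm_dist hn a (u n)).
move: un; rewrite /= ger0_norm ?(snorm_ge0 hn)//; lra.
Qed.

End ClosedSubalgebra.

Section DirectLimit.
Variables (R : realType) (A_ : nat -> starAlgType R) (nu : forall n, A_ n -> A_ n.+1).
Variables (A : cstarType R) (mu : forall n, A_ n -> A).
Hypothesis lim : is_direct_limit nu mu.
Let hn := cnorm_seminorm A.

Lemma limit_star_hom (n : nat) : star_hom (@mu n).
Proof. by case: lim => -[]. Qed.

Lemma limit_compat (n : nat) (a : A_ n) : mu (nu a) = mu a :> A.
Proof. by case: lim => -[_ h] _; exact: (h n). Qed.

Lemma limit_lift (n m : nat) (a : A_ n) : (n <= m)%N -> exists b : A_ m, mu b = mu a.
Proof.
move=> /subnK <-; elim: (m - n)%N => [|k [b bE]]; first by exists a.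
by exists (nu b); rewrite limit_compat.
Qed.

Lemma limit_unique (f g : A -> A) : star_hom f -> star_hom g ->
  (forall n a, f (mu (n := n) a) = mu a) -> (forall n a, g (mu (n := n) a) = mu a) ->
  f = g.
Proof.
move=> hf hg fmu gmu; case: lim => cmu /(_ A mu cmu)[h [_ hU]].
by rewrite -(hU f (conj hf fmu)) -(hU g (conj hg gmu)).
Qed.

(** Scalars are added, as the images need not contain 1 a priori. *)
Let U : set A := [set a | exists n (x : A_ n) c, a = mu x + scal c].

Let U_subalgebra : star_subalgebra U.
Proof.
have lift2 n (x : A_ n) m (y : A_ m) : exists k (x' y' : A_ k), mu x' = mu x /\ mu y' = mu y.
  have [x' hx] := limit_lift x (leq_maxl n m).
  by have [y' hy] := limit_lift y (leq_maxr n m); exists (maxn n m), x', y'.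
split.
- by exists 0%N, 0, 1; rewrite (star_hom0 (limit_star_hom _)) add0r scal1.
- move=> _ _ [n [x [c ->]]] [m [y [d ->]]].
  have [k [x' [y' [<- <-]]]] := lift2 _ x _ y.
  exists k, (x' - y'), (c - d); rewrite (star_homB (limit_star_hom _)) scalD scalN opprD.
  by rewrite addrACA.
- move=> _ _ [n [x [c ->]]] [m [y [d ->]]].
  have [k [x' [y' [<- <-]]]] := lift2 _ x _ y.
  exists k, (x' * y' + scal d * x' + scal c * y'), (c * d).
  rewrite !(star_homD (limit_star_hom _)) (star_homM (limit_star_hom _)).
  rewrite !(star_homZ (limit_star_hom _)) scalM mulrDl !mulrDr.
  by rewrite -(scalC d (mu x')) !addrA.
- by move=> c; exists 0%N, 0, c; rewrite (star_hom0 (limit_star_hom _)) add0r.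
- move=> _ [n [x [c ->]]]; exists n, (star x), (c^*).
  by rewrite starD star_scal (star_homS (limit_star_hom _)).
Qed.

Let B := ClosedSubalgebra (star_subalgebra_closure U_subalgebra) (@norm_closure_limit _ _ U).

(** The universal property retracts A onto the closure of the union of the
    images, whose inclusion is therefore onto. *)
Let limit_dense_scal a : norm_closure U a.
Proof.
have Bmu (n : nat) (x : A_ n) : csub_set B (mu x).
  by move=> e e0; exists (mu x); rewrite ?subrr ?(snorm0 hn)//;
    exists n, x, 0; rewrite scal0 addr0.
pose phi (n : nat) (x : A_ n) : csub B := mkcsub (Bmu n x).
have hphi n : star_hom (@phi n).
  have h := limit_star_hom n.
  split=> [|x y|x]; [split=> [x y|c x]| |]; apply: val_inj => /=.
  - exact: (star_homD h).
  - exact: (star_homZ h).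
  - exact: (star_homM h).
  - exact: (star_homS h).
have cphi (n : nat) (x : A_ n) : phi n.+1 (nu x) = phi n x.
  by apply: val_inj; exact: limit_compat.
case: lim => _ /(_ (csub B : cstarType R) phi (conj hphi cphi))[psi [[hpsi psimu] _]].
have /(congr1 (fun f => f a)) /= <- : val \o psi = id.
  apply: limit_unique => //; first exact: star_hom_comp hpsi (star_hom_csub_val B).
  by move=> n x; rewrite /= psimu.
exact: (elimT (asboolP _) (valP (psi a))).
Qed.

Hypothesis nu1 : forall n, nu 1 = 1 :> A_ n.+1.

Let mu1_const (n : nat) : mu (1 : A_ n) = mu (1 : A_ 0%N).
Proof. by elim: n => // n <-; rewrite -(nu1 n) limit_compat. Qed.

(** The image of 1 is a central projection which is a unit for the images, so
    multiplication by it is the identity by uniqueness. *)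
Lemma limit1 (n : nat) : mu (1 : A_ n) = 1.
Proof.
rewrite mu1_const; set e := mu _.
have eU a : U a -> e * a = a * e.
  move=> [m [x [c ->]]]; rewrite mulrDl mulrDr scalC; congr (_ + _).
  by rewrite /e -(mu1_const m) -!(star_homM (limit_star_hom _)) mul1r mulr1.
have eC a : e * a = a * e.
  apply/eqP; rewrite -subr_eq0; apply/eqP/cnorm_eq0/le_anti; rewrite (snorm_ge0 hn) andbT.
  apply/ler_addgt0Pr => d d0; rewrite add0r.
  have e0 : 0 < 2 * cnorm e + 1 by have := snorm_ge0 hn e; lra.
  have [b Ub ab] := limit_dense_scal a (divr_gt0 d0 e0).
  have -> : e * a - a * e = e * (a - b) - (a - b) * e.
    by rewrite mulrBr mulrBl (eU _ Ub) opprB addrA subrK.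
  apply: (@le_trans _ _ ((2 * cnorm e + 1) * cnorm (a - b))); last first.
    by rewrite mulrC -ler_pdivlMr// ltW.
  have := snormB hn (e * (a - b)) ((a - b) * e).
  have := snormM hn e (a - b); have := snormM hn (a - b) e.
  by have := snorm_ge0 hn (a - b); nra.
have [es ee] : is_projection e by exact: star_hom_proj (limit_star_hom _).
have : (fun a => e * a) = id.
  apply: limit_unique.
  - split=> [|a b|a]; [split=> [a b|c a]| |].
    + by rewrite mulrDr.
    + by rewrite mulrA -scalC mulrA.
    + by rewrite [RHS]mulrA -[X in _ = X * _]mulrA -(eC a) !mulrA ee.
    + by rewrite starM es eC.
  - exact: star_hom_id.
  - by move=> m x; rewrite /e -(mu1_const m) -(star_homM (limit_star_hom _)) mul1r.
  - by [].
by move=> /(congr1 (fun f => f 1)); rewrite mulr1.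
Qed.

Lemma limit_dense a (e : R) : 0 < e ->
  exists n0, forall n, (n0 <= n)%N -> exists x : A_ n, cnorm (a - mu x) < e.
Proof.
move=> /(limit_dense_scal a)[_ [n0 [x [c ->]]] ax]; exists n0 => n n0n.
have [x' x'E] := limit_lift x n0n; exists (x' + scal c).
rewrite (star_homD (limit_star_hom _)) x'E -[scal c]mulr1 (star_homZ (limit_star_hom _)).
by rewrite limit1 mulr1.
Qed.

Lemma limit_nontrivial (B' : cstarType R) (phi : forall n, A_ n -> B') :
  (forall n, star_hom (@phi n)) -> (forall n a, phi n.+1 (nu a) = phi n a) ->
  phi 0%N 1 <> 0 -> (1 : A) <> 0.
Proof.
move=> hphi cphi phi1 A0; apply: phi1.
case: lim => _ /(_ B' phi (conj hphi cphi))[psi [[hpsi psimu] _]].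
by rewrite -psimu limit1 A0 (star_hom0 hpsi).
Qed.

End DirectLimit.

(** * The operator norm of complex matrices *)

Section OperatorNorm.
Variable R : realType.
Local Notation C := R[i].

Definition vnorm d (v : 'cV[C]_d) : R := Num.sqrt (\sum_i cmod (v i 0) ^+ 2).

Lemma vnorm_sum_ge0 d (v : 'cV[C]_d) : 0 <= \sum_i cmod (v i 0) ^+ 2.
Proof. by apply: sumr_ge0 => i _; rewrite sqr_ge0. Qed.

Lemma vnorm_ge0 d (v : 'cV[C]_d) : 0 <= vnorm v.
Proof. exact: sqrtr_ge0. Qed.

Lemma vnorm_sqr d (v : 'cV[C]_d) : vnorm v ^+ 2 = \sum_i cmod (v i 0) ^+ 2.
Proof. by rewrite sqr_sqrtr ?vnorm_sum_ge0. Qed.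

Lemma vnorm_entry d (v : 'cV[C]_d) i : cmod (v i 0) <= vnorm v.
Proof.
rewrite -(@ler_pXn2r _ 2) ?nnegrE ?cmod_ge0 ?vnorm_ge0// vnorm_sqr (bigD1 i)//=.
by rewrite lerDl sumr_ge0// => j _; rewrite sqr_ge0.
Qed.

Lemma vnorm_le_sum d (v : 'cV[C]_d) : vnorm v <= \sum_i cmod (v i 0).
Proof.
have s0 : 0 <= \sum_i cmod (v i 0) by apply: sumr_ge0 => i _; exact: cmod_ge0.
rewrite -(@ler_pXn2r _ 2) ?nnegrE ?vnorm_ge0// vnorm_sqr expr2 mulr_suml.
apply: ler_sum => i _; rewrite expr2; apply: ler_wpM2l; first exact: cmod_ge0.
by rewrite (bigD1 i)//= lerDl sumr_ge0// => j _; exact: cmod_ge0.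
Qed.

Lemma cauchy_schwarz d (u v : 'cV[C]_d) :
  \sum_i cmod (u i 0) * cmod (v i 0) <= vnorm u * vnorm v.
Proof.
have [u0|u0] := eqVneq (vnorm u) 0.
  rewrite u0 mul0r big1// => i _; have := vnorm_entry u i; rewrite u0 => h.
  by rewrite (_ : cmod (u i 0) = 0) ?mul0r//; apply/le_anti; rewrite h cmod_ge0.
have [v0|v0] := eqVneq (vnorm v) 0.
  rewrite v0 mulr0 big1// => i _; have := vnorm_entry v i; rewrite v0 => h.
  by rewrite (_ : cmod (v i 0) = 0) ?mulr0//; apply/le_anti; rewrite h cmod_ge0.
have up : 0 < vnorm u by rewrite lt_neqAle eq_sym u0 vnorm_ge0.
have vp : 0 < vnorm v by rewrite lt_neqAle eq_sym v0 vnorm_ge0.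
pose s := vnorm v / vnorm u; have sp : 0 < s by rewrite divr_gt0.
apply: (@le_trans _ _ (\sum_i (s * cmod (u i 0) ^+ 2 + s^-1 * cmod (v i 0) ^+ 2) / 2)).
  apply: ler_sum => i _; rewrite ler_pdivlMr// -subr_ge0.
  have -> : s * cmod (u i 0) ^+ 2 + s^-1 * cmod (v i 0) ^+ 2 -
     cmod (u i 0) * cmod (v i 0) * 2 = s * (cmod (u i 0) - s^-1 * cmod (v i 0)) ^+ 2.
    by field; rewrite gt_eqF.
  by rewrite mulr_ge0 ?sqr_ge0 ?ltW.
rewrite -mulr_suml big_split /= -!mulr_sumr -!vnorm_sqr.
have -> : (s * vnorm u ^+ 2 + s^-1 * vnorm v ^+ 2) / 2 = vnorm u * vnorm v; last by [].
by rewrite /s; field; rewrite u0 v0.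
Qed.

Lemma vnormD d (u v : 'cV[C]_d) : vnorm (u + v) <= vnorm u + vnorm v.
Proof.
rewrite -(@ler_pXn2r _ 2) ?nnegrE ?vnorm_ge0 ?addr_ge0 ?vnorm_ge0// vnorm_sqr sqrrD !vnorm_sqr.
apply: (@le_trans _ _ (\sum_i (cmod (u i 0) ^+ 2 + cmod (u i 0) * cmod (v i 0) *+ 2 + cmod (v i 0) ^+ 2))).
  apply: ler_sum => i _; rewrite mxE -sqrrD ler_pXn2r ?nnegrE ?cmod_ge0 ?addr_ge0 ?cmod_ge0//.
  exact: cmodD.
rewrite 2!big_split /= sumrMnl lerD2r lerD2l ler_pMn2r//.
exact: cauchy_schwarz.
Qed.

Lemma vnormZ d c (v : 'cV[C]_d) : vnorm (c *: v) = cmod c * vnorm v.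
Proof.
rewrite /vnorm; under eq_bigr do rewrite mxE cmodM exprMn.
by rewrite -mulr_sumr sqrtrM ?sqr_ge0// sqrtr_sqr ger0_norm ?cmod_ge0.
Qed.

Definition cadj m n (X : 'M[C]_(m, n)) : 'M[C]_(n, m) := \matrix_(i, j) Num.conj (X j i).

(** |X v|^2 = <X^* X v, v>. *)
Lemma vnorm_mul_adj m n (X : 'M[C]_(m, n)) (v : 'cV[C]_n) :
  vnorm (X *m v) ^+ 2 <= vnorm (cadj X *m (X *m v)) * vnorm v.
Proof.
set w := X *m v; apply: le_trans (cauchy_schwarz _ _).
have E : (vnorm w ^+ 2)%:C = \sum_j Num.conj ((cadj X *m w) j 0) * v j 0.
  rewrite vnorm_sqr rmorph_sum /=.
  transitivity (\sum_i \sum_j Num.conj (w i 0) * (X i j * v j 0)).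
    by apply: eq_bigr => i _; rewrite -conj_mul {2}/w mxE mulr_sumr.
  rewrite exchange_big /=; apply: eq_bigr => j _; rewrite mxE rmorph_sum mulr_suml.
  by apply: eq_bigr => i _; rewrite rmorphM /= [cadj X j i]mxE conjCK mulrA [X in X * _]mulrC.
have : `|vnorm w ^+ 2| <= \sum_j cmod (Num.conj ((cadj X *m w) j 0) * v j 0).
  by rewrite -cmodR E cmod_sum.
rewrite ger0_norm ?sqr_ge0// => /le_trans; apply; apply: ler_sum => j _.
by rewrite cmodM cmod_conj.
Qed.

Definition opbound m n (X : 'M[C]_(m, n)) : set R :=
  [set M | 0 <= M /\ forall v, vnorm (X *m v) <= M * vnorm v].

Definition opnorm m n (X : 'M[C]_(m, n)) : R := inf (opbound X).

Lemma opbound_nonempty m n (X : 'M[C]_(m, n)) : opbound X (\sum_i \sum_j cmod (X i j)).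
Proof.
split; first by apply: sumr_ge0 => i _; apply: sumr_ge0 => j _; exact: cmod_ge0.
move=> v; apply: le_trans (vnorm_le_sum _) _; rewrite mulr_suml; apply: ler_sum => i _.
rewrite mxE mulr_suml; apply: le_trans (cmod_sum _ _ _) _; apply: ler_sum => j _.
by rewrite cmodM ler_wpM2l ?cmod_ge0 ?vnorm_entry.
Qed.

Lemma opbound_lb m n (X : 'M[C]_(m, n)) : lbound (opbound X) 0.
Proof. by move=> M []. Qed.

Lemma opbound_has_inf m n (X : 'M[C]_(m, n)) : has_inf (opbound X).
Proof. by split; [exists (\sum_i \sum_j cmod (X i j)); exact: opbound_nonempty|exists 0; exact: opbound_lb]. Qed.

Lemma opnorm_ge0 m n (X : 'M[C]_(m, n)) : 0 <= opnorm X.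
Proof.
apply: lb_le_inf; last exact: opbound_lb.
by have [] := opbound_has_inf X.
Qed.

Lemma opnorm_le m n (X : 'M[C]_(m, n)) M : 0 <= M ->
  (forall v, vnorm (X *m v) <= M * vnorm v) -> opnorm X <= M.
Proof. by move=> M0 XM; apply: ge_inf; [exists 0; exact: opbound_lb|split]. Qed.

Lemma opnormP m n (X : 'M[C]_(m, n)) v : vnorm (X *m v) <= opnorm X * vnorm v.
Proof.
have [v0|v0] := eqVneq (vnorm v) 0.
  have [_ /(_ v)] := opbound_nonempty X; by rewrite v0 !mulr0.
have vp : 0 < vnorm v by rewrite lt_neqAle eq_sym v0 vnorm_ge0.
rewrite -ler_pdivrMr//; apply: lb_le_inf; first by have [] := opbound_has_inf X.
by move=> M [_ XM]; rewrite ler_pdivrMr.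
Qed.

Lemma opnorm_entry m n (X : 'M[C]_(m, n)) i j : cmod (X i j) <= opnorm X.
Proof.
have dE : vnorm (delta_mx j 0 : 'cV[C]_n) = 1.
  rewrite /vnorm (bigD1 j)//= big1 => [|k kj]; last by rewrite mxE (negPf kj) cmod0 expr0n.
  by rewrite mxE !eqxx cmod1 expr1n addr0 sqrtr1.
have := opnormP X (delta_mx j 0); rewrite dE mulr1; apply: le_trans.
by apply: le_trans (vnorm_entry _ i); rewrite -colE mxE.
Qed.

Lemma opnormD m n (X Y : 'M[C]_(m, n)) : opnorm (X + Y) <= opnorm X + opnorm Y.
Proof.
apply: opnorm_le => [|v]; first by rewrite addr_ge0 ?opnorm_ge0.
rewrite mulmxDl mulrDl; apply: le_trans (vnormD _ _) _.
by rewrite lerD ?opnormP.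
Qed.

Lemma opnormM m n p (X : 'M[C]_(m, n)) (Y : 'M[C]_(n, p)) :
  opnorm (X *m Y) <= opnorm X * opnorm Y.
Proof.
apply: opnorm_le => [|v]; first by rewrite mulr_ge0 ?opnorm_ge0.
rewrite -mulmxA; apply: le_trans (opnormP _ _) _.
by rewrite -mulrA ler_wpM2l ?opnorm_ge0 ?opnormP.
Qed.

Lemma opnormZ m n c (X : 'M[C]_(m, n)) : opnorm (c *: X) = cmod c * opnorm X.
Proof.
apply: (cmod_homogeneous (act := *:%R)) c X => [c d X|X|X|c X].
- exact: scalerA.
- exact: scale1r.
- exact: opnorm_ge0.
- apply: opnorm_le => [|v]; first by rewrite mulr_ge0 ?opnorm_ge0 ?cmod_ge0.
  by rewrite -scalemxAl vnormZ -mulrA ler_wpM2l ?cmod_ge0 ?opnormP.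
Qed.

Lemma cadjK m n (X : 'M[C]_(m, n)) : cadj (cadj X) = X.
Proof. by apply/matrixP => i j; rewrite !mxE conjCK. Qed.

(** vnorm_mul_adj gives |Y|^2 <= |Y^* Y| for Y = X and for Y = X^*. *)
Lemma opnorm_star m n (X : 'M[C]_(m, n)) : opnorm (cadj X *m X) = opnorm X ^+ 2.
Proof.
have h1 p q (Y : 'M[C]_(p, q)) : opnorm Y ^+ 2 <= opnorm (cadj Y *m Y).
  rewrite -(sqr_sqrtr (opnorm_ge0 (cadj Y *m Y))) ler_pXn2r ?nnegrE ?opnorm_ge0 ?sqrtr_ge0//.
  apply: opnorm_le => [|v]; first exact: sqrtr_ge0.
  rewrite -(@ler_pXn2r _ 2) ?nnegrE ?vnorm_ge0 ?mulr_ge0 ?sqrtr_ge0 ?vnorm_ge0//.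
  rewrite exprMn (sqr_sqrtr (opnorm_ge0 _)); apply: le_trans (vnorm_mul_adj _ _) _.
  by rewrite mulmxA expr2 mulrA ler_wpM2r ?vnorm_ge0 ?opnormP.
have h2 p q (Y : 'M[C]_(p, q)) : opnorm Y <= opnorm (cadj Y).
  have [Y0|Y0] := eqVneq (opnorm Y) 0; first by rewrite Y0 opnorm_ge0.
  have Yp : 0 < opnorm Y by rewrite lt_neqAle eq_sym Y0 opnorm_ge0.
  rewrite -(ler_pM2r Yp) -expr2; apply: le_trans (h1 _ _ Y) _.
  exact: opnormM.
apply/le_anti; rewrite h1 andbT; apply: le_trans (opnormM _ _) _.
rewrite expr2 ler_wpM2r ?opnorm_ge0//; have := h2 _ _ (cadj X).
by rewrite cadjK.
Qed.

Lemma opnorm1 d : (0 < d)%N -> 1 <= opnorm (1%:M : 'M[C]_d).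
Proof.
move=> d0; have := opnorm_entry (1%:M : 'M[C]_d) (Ordinal d0) (Ordinal d0).
by rewrite mxE eqxx cmod1.
Qed.

Lemma eval_mxE d (z : circle R) (c : 'M[cfun R]_d) i j : eval_mx z c i j = ceval z (c i j).
Proof. by rewrite mxE. Qed.

Lemma eval_mxM d (z : circle R) (X Y : 'M[cfun R]_d) :
  eval_mx z (X * Y) = eval_mx z X *m eval_mx z Y.
Proof. exact: map_mxM. Qed.

Lemma eval_mx_star d (z : circle R) (X : 'M[cfun R]_d) :
  eval_mx z (star X) = cadj (eval_mx z X).
Proof. by apply/matrixP => i j; rewrite !mxE ceval_star. Qed.

Lemma eval_mx_seminorm d (z : circle R) :
  cstar_seminorm (fun X : 'M[cfun R]_d => opnorm (eval_mx z X)).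
Proof.
split=> [X Y|c X|X Y|X].
- by rewrite /eval_mx map_mxD opnormD.
- rewrite -opnormZ; congr opnorm.
  by apply/matrixP => i j; rewrite eval_mxE mx_scalME [RHS]mxE eval_mxE cevalM ceval_scal.
- by rewrite eval_mxM opnormM.
- by rewrite eval_mxM eval_mx_star opnorm_star.
Qed.

End OperatorNorm.

(** * Bounded sequences modulo null sequences *)

Section LimsupAlgebra.
Variable R : realType.

Record snorm_family := SnormFamily {
  sf_alg : nat -> starAlgType R;
  sf_norm : forall n, sf_alg n -> R;
  sf_seminorm : forall n, cstar_seminorm (@sf_norm n) }.

Variable X : snorm_family.
Let hn n := @sf_seminorm X n.

(** Boundedness is eventual because a coherent sequence is prescribed only from
    some index on. *)
Definition ev_bounded (x : forall n, sf_alg X n) (M : R) :=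
  exists k, forall n, (k <= n)%N -> sf_norm (x n) <= M.

Record bseq := BSeq {
  bseq_fun :> forall n, sf_alg X n;
  bseq_bounded : exists M, ev_bounded bseq_fun M }.

Lemma bseqP (x y : bseq) : (forall n, x n = y n) -> x = y.
Proof.
case: x y => [x xb] [y yb] /= xy; have E : x = y by exact: functional_extensionality_dep.
by case: y / E in yb xy *; congr BSeq; exact: Prop_irrelevance.
Qed.

HB.instance Definition _ := gen_eqMixin bseq.
HB.instance Definition _ := gen_choiceMixin bseq.

Lemma ev_bounded2 (x y z : forall n, sf_alg X n) M M' M'' :
  (forall n, sf_norm (x n) <= M -> sf_norm (y n) <= M' -> sf_norm (z n) <= M'') ->
  ev_bounded x M -> ev_bounded y M' -> ev_bounded z M''.
Proof.
move=> H [k hk] [l hl]; exists (maxn k l) => n; rewrite geq_max => /andP[kn ln].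
by apply: H; [exact: hk|exact: hl].
Qed.

Fact bseq_add_subproof (x y : bseq) : exists M, ev_bounded (fun n => x n + y n) M.
Proof.
have [M hM] := bseq_bounded x; have [M' hM'] := bseq_bounded y; exists (M + M').
apply: ev_bounded2 hM hM' => n h1 h2; apply: le_trans (snormD (hn n) _ _) _.
exact: lerD.
Qed.
Fact bseq_mul_subproof (x y : bseq) : exists M, ev_bounded (fun n => x n * y n) M.
Proof.
have [M hM] := bseq_bounded x; have [M' hM'] := bseq_bounded y; exists (M * M').
apply: ev_bounded2 hM hM' => n h1 h2; apply: le_trans (snormM (hn n) _ _) _.
by apply: ler_pM => //; exact: snorm_ge0 (hn n) _.
Qed.
Fact bseq_opp_subproof (x : bseq) : exists M, ev_bounded (fun n => - x n) M.
Proof.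
have [M [k hk]] := bseq_bounded x; exists M, k => n kn.
by rewrite (snormN (hn n)) hk.
Qed.
Fact bseq_star_subproof (x : bseq) : exists M, ev_bounded (fun n => star (x n)) M.
Proof.
have [M [k hk]] := bseq_bounded x; exists M, k => n kn.
by rewrite (snorm_star (hn n)) hk.
Qed.
Fact bseq_scal_subproof (c : R[i]) : exists M, ev_bounded (fun n => scal c) M.
Proof.
exists (cmod c), 0%N => n _; rewrite -[scal c]mulr1 (snormZ (hn n)).
by rewrite ler_piMr ?cmod_ge0// (snorm1 (hn n)).
Qed.

Definition bseq_add x y := BSeq (bseq_add_subproof x y).
Definition bseq_mul x y := BSeq (bseq_mul_subproof x y).
Definition bseq_opp x := BSeq (bseq_opp_subproof x).
Definition bseq_star x := BSeq (bseq_star_subproof x).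
Definition bseq_scal c := BSeq (bseq_scal_subproof c).

Definition null_seq (x : forall n, sf_alg X n) := forall e : R, 0 < e -> ev_bounded x e.
Definition bseq_eq (x y : bseq) := null_seq (fun n => x n - y n).

Lemma bseq_eq_refl x : bseq_eq x x.
Proof. by move=> e e0; exists 0%N => n _; rewrite subrr (snorm0 (hn n)) ltW. Qed.
Lemma bseq_eq_sym x y : bseq_eq x y -> bseq_eq y x.
Proof.
move=> xy e e0; have [k hk] := xy e e0; exists k => n kn.
by rewrite (snorm_dist (hn n)) hk.
Qed.
Lemma bseq_eq_trans y x z : bseq_eq x y -> bseq_eq y z -> bseq_eq x z.
Proof.
move=> xy yz e e0; have e2 : 0 < e / 2 by lra.
apply: ev_bounded2 (xy _ e2) (yz _ e2) => n h1 h2.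
by apply: le_trans (snorm_tri (hn n) (y n) _ _) _; lra.
Qed.

Definition bseq_eqb : rel bseq := fun x y => `[< bseq_eq x y >].
Fact bseq_eqb_refl : reflexive bseq_eqb.
Proof. by move=> x; apply/asboolP; exact: bseq_eq_refl. Qed.
Fact bseq_eqb_sym : symmetric bseq_eqb.
Proof. by move=> x y; apply/asboolP/asboolP; exact: bseq_eq_sym. Qed.
Fact bseq_eqb_trans : transitive bseq_eqb.
Proof. by move=> y x z /asboolP xy /asboolP yz; apply/asboolP; exact: bseq_eq_trans xy yz. Qed.
Definition bseq_equiv := EquivRel bseq_eqb bseq_eqb_refl bseq_eqb_sym bseq_eqb_trans.

Definition limsup_alg := {eq_quot bseq_equiv}%qT.
HB.instance Definition _ := Choice.on limsup_alg.

Definition cls (x : bseq) : limsup_alg := (\pi_limsup_alg x)%qT.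
Definition rep (a : limsup_alg) : bseq := repr a.

Lemma repK a : cls (rep a) = a. Proof. exact: reprK. Qed.
Lemma cls_eq x y : bseq_eq x y -> cls x = cls y.
Proof. by move=> xy; apply/eqmodP/asboolP. Qed.
Lemma rep_cls x : bseq_eq (rep (cls x)) x.
Proof. by apply/asboolP/(@eqmodP _ bseq_equiv); exact: repK. Qed.

Definition la_add a b := cls (bseq_add (rep a) (rep b)).
Definition la_mul a b := cls (bseq_mul (rep a) (rep b)).
Definition la_opp a := cls (bseq_opp (rep a)).
Definition la_star a := cls (bseq_star (rep a)).
Definition la_scal c := cls (bseq_scal c).

Lemma clsD x y : la_add (cls x) (cls y) = cls (bseq_add x y).
Proof.
apply: cls_eq => e e0; have e2 : 0 < e / 2 by lra.
apply: ev_bounded2 (rep_cls x e2) (rep_cls y e2) => n h1 h2 /=.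
by rewrite opprD addrACA; apply: le_trans (snormD (hn n) _ _) _; lra.
Qed.

Lemma clsM x y : la_mul (cls x) (cls y) = cls (bseq_mul x y).
Proof.
apply: cls_eq => e e0; set x' := rep _; set y' := rep _.
have [M hM] := bseq_bounded x; have [M' hM'] := bseq_bounded y'.
pose K := `|M| + `|M'| + 1; have K0 : 0 < K by rewrite ltr_wpDl// addr_ge0.
have eK : 0 < e / 2 / K by rewrite !divr_gt0.
have [k1 h1] := rep_cls x eK; have [k2 h2] := rep_cls y eK.
have [k3 h3] := hM; have [k4 h4] := hM'.
exists (maxn (maxn k1 k2) (maxn k3 k4)) => n; rewrite !geq_max => /andP[/andP[n1 n2] /andP[n3 n4]].
have {}h1 := h1 n n1; have {}h2 := h2 n n2; have {}h3 := h3 n n3; have {}h4 := h4 n n4.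
have -> : x' n * y' n - x n * y n = (x' n - x n) * y' n + x n * (y' n - y n).
  by rewrite mulrBl mulrBr addrA subrK.
apply: le_trans (snormD (hn n) _ _) _; rewrite [e](splitr e).
have half (a b m : R) : 0 <= a -> 0 <= b -> a <= e / 2 / K -> b <= m -> `|m| <= K -> a * b <= e / 2.
  move=> a0 b0 ae bm mK; apply: (@le_trans _ _ (e / 2 / K * K)); last by rewrite divfK// gt_eqF.
  by apply: ler_pM => //; apply: le_trans bm _; apply: le_trans (ler_norm _) mK.
apply: lerD; apply: le_trans (snormM (hn n) _ _) _.
  by apply: (half _ _ M'); rewrite ?(snorm_ge0 (hn n))// /K; have := normr_ge0 M; lra.
rewrite mulrC; apply: (half _ _ M); rewrite ?(snorm_ge0 (hn n))// /K.
by have := normr_ge0 M'; lra.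
Qed.

Lemma clsN x : la_opp (cls x) = cls (bseq_opp x).
Proof.
apply: cls_eq => e e0; have [k hk] := rep_cls x e0; exists k => n kn /=.
by rewrite -opprD (snormN (hn n)) hk.
Qed.

Lemma cls_star x : la_star (cls x) = cls (bseq_star x).
Proof.
apply: cls_eq => e e0; have [k hk] := rep_cls x e0; exists k => n kn /=.
by rewrite -starB (snorm_star (hn n)) hk.
Qed.

Fact la_addA : associative la_add.
Proof.
move=> a b c; rewrite -[a]repK -[b]repK -[c]repK !clsD; congr cls.
by apply: bseqP => n /=; rewrite addrA.
Qed.
Fact la_addC : commutative la_add.
Proof. by move=> a b; congr cls; apply: bseqP => n /=; rewrite addrC. Qed.
Fact la_add0 : left_id (la_scal 0) la_add.
Proof.
move=> a; rewrite -[a]repK clsD; congr cls.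
by apply: bseqP => n /=; rewrite scal0 add0r.
Qed.
Fact la_addN : left_inverse (la_scal 0) la_opp la_add.
Proof.
move=> a; rewrite -[a]repK clsN clsD; congr cls.
by apply: bseqP => n /=; rewrite scal0 addNr.
Qed.
HB.instance Definition _ := GRing.isZmodule.Build limsup_alg la_addA la_addC la_add0 la_addN.

Fact la_mulA : associative la_mul.
Proof.
move=> a b c; rewrite -[a]repK -[b]repK -[c]repK !clsM; congr cls.
by apply: bseqP => n /=; rewrite mulrA.
Qed.
Fact la_mul1 : left_id (la_scal 1) la_mul.
Proof.
move=> a; rewrite -[a]repK clsM; congr cls.
by apply: bseqP => n /=; rewrite scal1 mul1r.
Qed.
Fact la_mulr1 : right_id (la_scal 1) la_mul.
Proof.
move=> a; rewrite -[a]repK clsM; congr cls.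
by apply: bseqP => n /=; rewrite scal1 mulr1.
Qed.
Let la_addE (a b : limsup_alg) : a + b = la_add a b. Proof. by []. Qed.

Fact la_mulDl : left_distributive la_mul +%R.
Proof.
move=> a b c; rewrite -[a]repK -[b]repK -[c]repK.
rewrite !la_addE clsD !clsM clsD; congr cls.
by apply: bseqP => n /=; rewrite mulrDl.
Qed.
Fact la_mulDr : right_distributive la_mul +%R.
Proof.
move=> a b c; rewrite -[a]repK -[b]repK -[c]repK.
rewrite !la_addE clsD !clsM clsD; congr cls.
by apply: bseqP => n /=; rewrite mulrDr.
Qed.
HB.instance Definition _ := GRing.Zmodule_isPzRing.Build limsup_alg
  la_mulA la_mul1 la_mulr1 la_mulDl la_mulDr.

Lemma cls_add x y : cls x + cls y = cls (bseq_add x y). Proof. exact: clsD. Qed.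
Lemma cls_mul x y : cls x * cls y = cls (bseq_mul x y). Proof. exact: clsM. Qed.

Fact la_scal1 : la_scal 1 = 1. Proof. by []. Qed.
Fact la_scalD : {morph la_scal : c d / c + d}.
Proof. by move=> c d; rewrite cls_add; congr cls; apply: bseqP => n /=; rewrite scalD. Qed.
Fact la_scalM : {morph la_scal : c d / c * d}.
Proof. by move=> c d; rewrite cls_mul; congr cls; apply: bseqP => n /=; rewrite scalM. Qed.
Fact la_scalC c a : la_scal c * a = a * la_scal c.
Proof. by rewrite -[a]repK !cls_mul; congr cls; apply: bseqP => n /=; rewrite scalC. Qed.
Fact la_starK : involutive la_star.
Proof. by move=> a; rewrite -[a]repK !cls_star; congr cls; apply: bseqP => n /=; rewrite starK. Qed.
Fact la_starD : {morph la_star : a b / a + b}.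
Proof.
move=> a b; rewrite -[a]repK -[b]repK cls_add !cls_star cls_add; congr cls.
by apply: bseqP => n /=; rewrite starD.
Qed.
Fact la_starM a b : la_star (a * b) = la_star b * la_star a.
Proof.
rewrite -[a]repK -[b]repK cls_mul !cls_star cls_mul; congr cls.
by apply: bseqP => n /=; rewrite starM.
Qed.
Fact la_star_scal c : la_star (la_scal c) = la_scal c^*.
Proof. by rewrite cls_star; congr cls; apply: bseqP => n /=; rewrite star_scal. Qed.
HB.instance Definition _ := isStarAlgebra.Build R limsup_alg la_scal1 la_scalD
  la_scalM la_scalC la_starK la_starD la_starM la_star_scal.

(** The norm is limsup |x_n|. *)
Definition limsup_bounds (x : forall n, sf_alg X n) : set R :=
  [set M | 0 <= M /\ ev_bounded x M].
Definition limsup_norm (x : forall n, sf_alg X n) : R := inf (limsup_bounds x).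

Lemma limsup_norm_has_inf (x : bseq) : has_inf (limsup_bounds x).
Proof.
split; last by exists 0 => M [].
have [M [k hk]] := bseq_bounded x; exists M; split; last by exists k.
by apply: le_trans (hk k (leqnn k)); exact: snorm_ge0 (hn k) _.
Qed.

Lemma limsup_norm_ge0 (x : bseq) : 0 <= limsup_norm x.
Proof. by apply: lb_le_inf => [|M []//]; have [] := limsup_norm_has_inf x. Qed.

Lemma limsup_norm_le (x : bseq) M : 0 <= M -> ev_bounded x M -> limsup_norm x <= M.
Proof. by move=> M0 xM; apply: ge_inf; [exists 0 => ? []|split]. Qed.

Lemma limsup_norm_lt (x : bseq) M : limsup_norm x < M -> ev_bounded x M.
Proof.
move=> xM; have [K [K0 [k hk]] KM] := inf_lt (proj1 (limsup_norm_has_inf x)) xM.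
by exists k => n kn; apply: le_trans (hk n kn) (ltW KM).
Qed.

Lemma limsup_norm_eq (x y : bseq) : bseq_eq x y -> limsup_norm x <= limsup_norm y.
Proof.
move=> xy; apply/ler_addgt0Pr => e e0; have e2 : 0 < e / 2 by lra.
apply: limsup_norm_le; first by rewrite addr_ge0 ?limsup_norm_ge0// ltW.
have ye : ev_bounded y (limsup_norm y + e / 2) by apply: limsup_norm_lt; lra.
apply: ev_bounded2 (xy _ e2) ye => n h1 h2.
by rewrite -(subrK (y n) (x n)); apply: le_trans (snormD (hn n) _ _) _; lra.
Qed.

Definition la_norm (a : limsup_alg) : R := limsup_norm (rep a).

Lemma la_norm_cls x : la_norm (cls x) = limsup_norm x.
Proof.
apply/le_anti/andP; split; apply: limsup_norm_eq; first exact: rep_cls.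
by apply: bseq_eq_sym; exact: rep_cls.
Qed.

Lemma la_norm_ge0 a : 0 <= la_norm a. Proof. exact: limsup_norm_ge0. Qed.

Lemma la_norm_le (x : bseq) M : 0 <= M -> ev_bounded x M -> la_norm (cls x) <= M.
Proof. by rewrite la_norm_cls; exact: limsup_norm_le. Qed.

Lemma la_norm_lt (x : bseq) M : la_norm (cls x) < M -> ev_bounded x M.
Proof. by rewrite la_norm_cls; exact: limsup_norm_lt. Qed.

Fact la_norm_eq0 a : la_norm a = 0 -> a = 0.
Proof.
rewrite -[a]repK => a0; apply: cls_eq => e e0; have : la_norm (cls (rep a)) < e by rewrite a0.
by move=> /la_norm_lt[k hk]; exists k => n kn; rewrite /= scal0 subr0 hk.
Qed.

Fact la_normD a b : la_norm (a + b) <= la_norm a + la_norm b.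
Proof.
rewrite -[a]repK -[b]repK cls_add; apply/ler_addgt0Pr => e e0; have e2 : 0 < e / 2 by lra.
have ha : ev_bounded (rep a) (la_norm (cls (rep a)) + e / 2) by apply: la_norm_lt; lra.
have hb : ev_bounded (rep b) (la_norm (cls (rep b)) + e / 2) by apply: la_norm_lt; lra.
apply: la_norm_le; first by rewrite !addr_ge0 ?la_norm_ge0// ltW.
by apply: ev_bounded2 ha hb => n h1 h2 /=; apply: le_trans (snormD (hn n) _ _) _; lra.
Qed.

Fact la_normM a b : la_norm (a * b) <= la_norm a * la_norm b.
Proof.
rewrite -[a]repK -[b]repK cls_mul; set x := la_norm (cls (rep a)); set y := la_norm (cls (rep b)).
have x0 : 0 <= x := la_norm_ge0 _; have y0 : 0 <= y := la_norm_ge0 _.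
apply/ler_addgt0Pr => e e0.
have K0 : 0 < x + y + 1 by lra.
pose d := Num.min 1 (e / (x + y + 1)).
have d0 : 0 < d by rewrite lt_min ltr01 divr_gt0.
have dE : (x + d) * (y + d) <= x * y + e.
  have d1 : d <= 1 by rewrite ge_min lexx.
  have de : d * (x + y + 1) <= e by rewrite -ler_pdivlMr// ge_min lexx orbT.
  have : d * d <= d by rewrite ler_piMl// ltW.
  by lra.
have ha : ev_bounded (rep a) (x + d) by apply: la_norm_lt; rewrite ltrDl.
have hb : ev_bounded (rep b) (y + d) by apply: la_norm_lt; rewrite ltrDl.
apply: la_norm_le; first by rewrite addr_ge0 ?mulr_ge0// ltW.
apply: ev_bounded2 ha hb => n h1 h2 /=; apply: le_trans (snormM (hn n) _ _) _.
by apply: le_trans dE; apply: ler_pM => //; exact: snorm_ge0 (hn n) _.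
Qed.

Let la_normZ_le c a : la_norm (scal c * a) <= cmod c * la_norm a.
Proof.
rewrite -[a]repK cls_mul; set y := la_norm (cls (rep a)).
apply/ler_addgt0Pr => e e0.
have K0 : 0 < cmod c + 1 by have := cmod_ge0 c; lra.
have ha : ev_bounded (rep a) (y + e / (cmod c + 1)) by apply: la_norm_lt; rewrite ltrDl divr_gt0.
apply: la_norm_le; first by rewrite addr_ge0 ?mulr_ge0 ?cmod_ge0 ?la_norm_ge0// ltW.
have [k hk] := ha; exists k => n kn /=; rewrite (snormZ (hn n)).
apply: (@le_trans _ _ (cmod c * (y + e / (cmod c + 1)))); first by rewrite ler_wpM2l ?cmod_ge0 ?hk.
rewrite mulrDr lerD2l mulrA ler_pdivrMr// mulrC ler_wpM2l ?(ltW e0)//; lra.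
Qed.

Fact la_normZ c a : la_norm (scal c * a) = complex.Re `|c| * la_norm a.
Proof.
apply: (cmod_homogeneous (act := fun c a => scal c * a)) c a => [c d a|a||].
- by rewrite mulrA -scalM.
- by rewrite scal1 mul1r.
- exact: la_norm_ge0.
- exact: la_normZ_le.
Qed.

Fact la_norm_star a : la_norm (star a * a) = la_norm a ^+ 2.
Proof.
rewrite -[a]repK; have -> : star (cls (rep a)) = cls (bseq_star (rep a)) by exact: cls_star.
rewrite cls_mul; set x := rep a; have x0 := la_norm_ge0 (cls x).
apply/le_anti/andP; split.
  have xs : la_norm (cls (bseq_star x)) <= la_norm (cls x).
    apply/ler_addgt0Pr => e e0; apply: la_norm_le; first by rewrite addr_ge0// ltW.
    have [k hk] : ev_bounded x (la_norm (cls x) + e) by apply: la_norm_lt; rewrite ltrDl.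
    by exists k => n kn /=; rewrite (snorm_star (hn n)) hk.
  rewrite -cls_mul; apply: le_trans (la_normM _ _) _.
  by rewrite expr2 ler_wpM2r.
set y := la_norm (cls (bseq_mul _ _)); have y0 : 0 <= y := la_norm_ge0 _.
rewrite -[leRHS](sqr_sqrtr y0) ler_pXn2r ?nnegrE ?sqrtr_ge0//.
apply/ler_addgt0Pr => e e0.
have [k hk] : ev_bounded (bseq_mul (bseq_star x) x) ((Num.sqrt y + e) ^+ 2).
  apply: la_norm_lt; rewrite -/y -{1}(sqr_sqrtr y0) ltr_pXn2r ?nnegrE ?sqrtr_ge0//.
    by rewrite ltrDl.
  by rewrite addr_ge0 ?sqrtr_ge0// ltW.
have h0 : 0 <= Num.sqrt y + e by rewrite addr_ge0 ?sqrtr_ge0// ltW.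
apply: la_norm_le => //; exists k => n kn; have := hk n kn.
by rewrite /= (snorm_star_mul (hn n)) ler_pXn2r ?nnegrE ?(snorm_ge0 (hn n)).
Qed.

Lemma half_pow_gt0 k : 0 < (2 ^- k : R). Proof. by rewrite invr_gt0 exprn_gt0. Qed.

Lemma half_pow_small (e : R) : 0 < e -> exists k, 2 ^- k < e.
Proof.
move=> e0; exists (Num.bound (1 / e)); rewrite -[_ ^- _]mul1r ltr_pdivrMr ?exprn_gt0//.
rewrite mulrC -ltr_pdivrMr//; apply: lt_le_trans (archi_boundP _) _.
  by rewrite divr_ge0// ltW.
by rewrite -natrX ler_nat ltnW// ltn_expl.
Qed.

(** Diagonal argument: y follows the k-th sequence, of a subsequence converging
    fast, from the moment when the k first differences are known to be small. *)
Fact la_complete (u : nat -> limsup_alg) :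
  (forall e : R, 0 < e -> exists k, forall m n,
    (k <= m)%N -> (k <= n)%N -> la_norm (u m - u n) < e) ->
  exists l : limsup_alg, la_norm (u n - l) @[n --> \oo] --> (0 : R).
Proof.
move=> uC.
have /choice[f fP] k : exists m0, forall m n, (m0 <= m)%N -> (m0 <= n)%N ->
    la_norm (u m - u n) < 2 ^- k by exact: uC (half_pow_gt0 k).
pose g k := (\sum_(i < k.+1) f i)%N.
have fg k : (f k <= g k)%N by rewrite /g big_ord_recr /= leq_addl.
have gS k : (g k <= g k.+1)%N by rewrite /g [X in (_ <= X)%N]big_ord_recr /= leq_addr.
pose v k := rep (u (g k)).
pose step k n := sf_norm (v k.+1 n - v k n) <= 2 ^- k.
have step_ev k : exists n0, forall n, (n0 <= n)%N -> step k n.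
  have : la_norm (cls (bseq_add (v k.+1) (bseq_opp (v k)))) < 2 ^- k.
    rewrite -clsD -clsN !repK; apply: (fP k (g k.+1) (g k)) => //.
    exact: leq_trans (fg k) (gS k).
  by move=> /la_norm_lt[n0 hn0]; exists n0.
pose good k n := forall i, (i < k)%N -> step i n.
have good_ev k : exists n0, forall n, (n0 <= n)%N -> good k n.
  elim: k => [|k [n0 IH]]; first by exists 0%N.
  have [n1 h1] := step_ev k; exists (maxn n0 n1) => n; rewrite geq_max => /andP[h0n h1n] i.
  by rewrite ltnS leq_eqVlt => /predU1P[->|ik]; [exact: h1|exact: IH].
have goodP k l n : (k <= l)%N -> good l n -> sf_norm (v l n - v k n) <= 2 * 2 ^- k.
  move=> kl gl; suff : sf_norm (v l n - v k n) <= 2 * 2 ^- k - 2 * 2 ^- l.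
    by move=> /le_trans; apply; rewrite gerBl mulr_ge0// ltW// half_pow_gt0.
  move: gl; rewrite -(subnK kl); elim: (l - k)%N => [_|d IH gd].
    by rewrite !subrr (snorm0 (hn n)).
  have h1 := IH (fun i h => gd i (ltnW h)).
  have h2 : step (d + k)%N n by apply: gd; rewrite addSn.
  apply: le_trans (snorm_tri (hn n) (v (d + k)%N n) _ _) _.
  have -> : 2 ^- (d.+1 + k) = 2 ^- (d + k) / 2 :> R by rewrite addSn exprS invfM mulrC.
  by move: h2; rewrite /step addSn; lra.
have ex n : exists k, `[< good k n >] && (k <= n)%N by exists 0%N; rewrite andbT; apply/asboolP.
have ub n k : `[< good k n >] && (k <= n)%N -> (k <= n)%N by case/andP.
pose kap n := ex_maxn (ex n) (ub n).
have kapP n : good (kap n) n /\ forall k, good k n -> (k <= n)%N -> (k <= kap n)%N.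
  rewrite /kap; case: ex_maxnP => k /andP[/asboolP gk _] kmax; split=> // j gj jn.
  by apply: kmax; rewrite jn andbT; apply/asboolP.
pose y n := v (kap n) n.
have yv k : ev_bounded (fun n => v k n - y n) (2 * 2 ^- k).
  have [n0 h0] := good_ev k; exists (maxn k n0) => n; rewrite geq_max => /andP[kn n0n].
  have [h1 h2] := kapP n; rewrite (snorm_dist (hn n)); apply: goodP => //.
  by apply: h2 => //; exact: h0.
have yb : exists M, ev_bounded y M.
  have [M hM] := bseq_bounded (v 0%N); exists (2 * 2 ^- 0 + M).
  apply: ev_bounded2 (yv 0%N) hM => n h1 h2; rewrite -(subrK (v 0%N n) (y n)).
  by apply: le_trans (snormD (hn n) _ _) _; rewrite (snorm_dist (hn n)) lerD.
exists (cls (BSeq yb)); apply/cvgr0Pnorm_lt => e e0.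
have e3 : 0 < e / 3 by lra.
have [k ke] := half_pow_small e3.
exists (g k) => // n /= gn; rewrite ger0_norm ?la_norm_ge0//.
have -> : u n - cls (BSeq yb) = (u n - u (g k)) + (u (g k) - cls (BSeq yb)).
  by rewrite addrA subrK.
apply: le_lt_trans (la_normD _ _) _.
have h1 : la_norm (u n - u (g k)) < 2 ^- k by apply: fP => //; exact: leq_trans (fg k) _.
have h2 : la_norm (u (g k) - cls (BSeq yb)) <= 2 * 2 ^- k.
  rewrite -[u (g k)]repK; have -> : - cls (BSeq yb) = cls (bseq_opp (BSeq yb)) by exact: clsN.
  rewrite cls_add; apply: la_norm_le; last exact: yv.
  by rewrite mulr_ge0// ltW// half_pow_gt0.
by lra.
Qed.

HB.instance Definition _ := isCStar.Build R limsup_alg la_norm_eq0 la_normD la_normZ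
  la_normM la_norm_star la_complete.

Lemma cls_one_neq0 (e : R) : 0 < e -> (forall n, e <= sf_norm ((1 : sf_alg X n))) ->
  (1 : limsup_alg) <> 0.
Proof.
move=> e0 h E; have : la_norm (1 : limsup_alg) < e / 2.
  by rewrite E; have -> : la_norm 0 = 0 :=(snorm0 (cnorm_seminorm limsup_alg)); rewrite divr_gt0.
move=> /la_norm_lt[k /(_ k (leqnn k))] /=; rewrite scal1.
by have := h k; lra.
Qed.

End LimsupAlgebra.

(** A sequence of algebras with C*-seminorms which stay bounded along the
    connecting maps has a nonzero cocone, unless the units tend to 0. *)
Section Cocone.
Variables (R : realType) (X : snorm_family R).
Variable nu : forall n, sf_alg X n -> sf_alg X n.+1.
Hypothesis hnu : forall n, star_hom (@nu n).
Hypothesis nu1 : forall n, nu 1 = 1 :> sf_alg X n.+1.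

Definition coherent k (y : forall n, sf_alg X n) :=
  forall n, (k <= n)%N -> y n.+1 = nu (y n).

Lemma coherent_eq k y z : coherent k y -> coherent k z -> y k = z k ->
  forall n, (k <= n)%N -> y n = z n.
Proof.
move=> cy cz yz n /subnK <-; elim: (n - k)%N => [//|j IH].
by rewrite addSn cy ?leq_addl// cz ?leq_addl// IH.
Qed.

(** The values before the index k are arbitrary. *)
Lemma coherent_exists k (a : sf_alg X k) : exists2 y, y k = a & coherent k y.
Proof.
have ext (n : nat) : forall y0 : forall m, sf_alg X m, exists y : forall m, sf_alg X m,
    (forall m, (m <= n)%N -> y m = y0 m) /\ coherent n y.
  move=> y0; pose F := fix F m : sf_alg X m :=
    match m with 0%N => y0 0%N | m'.+1 => if (m' < n)%N then y0 m'.+1 else nu (F m') end.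
  exists F; split; first by case=> // m /= ->.
  by move=> m nm /=; rewrite ltnNge nm.
pose y0 m : sf_alg X m := match eqVneq k m with
  | EqNotNeq e => eq_rect k (fun j => sf_alg X j : Type) a m e
  | NeqNotEq _ => 0 end.
have y0k : y0 k = a.
  rewrite /y0; case: eqVneq => [e|]; last by rewrite eqxx.
  by rewrite (eq_axiomK e).
have [y [yE yc]] := ext k y0; exists y => //; by rewrite yE.
Qed.

Hypothesis bounded : forall k y, coherent k y -> exists M, ev_bounded y M.

Let pick k (a : sf_alg X k) := sval (cid2 (coherent_exists a)).
Let pick_coherent k (a : sf_alg X k) : coherent k (pick a).
Proof. by rewrite /pick; case: cid2. Qed.
Let pick_k k (a : sf_alg X k) : pick a k = a.
Proof. by rewrite /pick; case: cid2. Qed.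

(** Two coherent sequences with the same value at k agree from k on, so the
    class does not depend on the choice made here. *)
Definition to_limsup k (a : sf_alg X k) : limsup_alg X :=
  cls (BSeq (bounded (pick_coherent a))).

Lemma to_limsup_eq k (a : sf_alg X k) (y : bseq X) : coherent k y -> y k = a ->
  to_limsup a = cls y.
Proof.
move=> cy yk; apply: cls_eq => e e0; exists k => n kn /=.
rewrite (coherent_eq (@pick_coherent k a) cy)// ?pick_k ?yk// subrr.
by rewrite (snorm0 (@sf_seminorm _ X n)) ltW.
Qed.

Lemma star_hom_to_limsup k : star_hom (@to_limsup k).
Proof.
split=> [|a b|a]; [split=> [a b|c a]| |].
- rewrite /to_limsup [RHS]cls_add; apply: to_limsup_eq => [n kn|] /=.
    by rewrite !pick_coherent// (star_homD (@hnu n)).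
  by rewrite !pick_k.
- rewrite /to_limsup [RHS]cls_mul; apply: to_limsup_eq => [n kn|] /=.
    by rewrite !pick_coherent// (star_homZ (@hnu n)).
  by rewrite !pick_k.
- rewrite /to_limsup [RHS]cls_mul; apply: to_limsup_eq => [n kn|] /=.
    by rewrite !pick_coherent// (star_homM (@hnu n)).
  by rewrite !pick_k.
- rewrite /to_limsup [RHS]cls_star; apply: to_limsup_eq => [n kn|] /=.
    by rewrite !pick_coherent// (star_homS (@hnu n)).
  by rewrite !pick_k.
Qed.

Lemma to_limsup_compat k (a : sf_alg X k) : to_limsup (nu a) = to_limsup a.
Proof.
apply: to_limsup_eq => [n kn|] /=; first by rewrite pick_coherent// ltnW.
by rewrite pick_coherent// pick_k.
Qed.

Lemma to_limsup1 k : to_limsup (1 : sf_alg X k) = 1.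
Proof.
apply: to_limsup_eq => [n kn|] /=; last by rewrite scal1.
by rewrite !scal1 nu1.
Qed.

End Cocone.

(** * Bounds for *-homomorphisms on the algebras of the system *)

Section UniversalBounds.
Variable R : realType.
Implicit Types D E : starAlgType R.

Lemma cstar_seminorm_comp D E (nu : E -> R) (f : D -> E) :
  star_hom f -> cstar_seminorm nu -> cstar_seminorm (nu \o f).
Proof.
move=> hf hnu; split=> [a b|c a|a b|a] /=.
- by rewrite (star_homD hf) (snormD hnu).
- by rewrite (star_homZ hf) (snormZ hnu).
- by rewrite (star_homM hf) (snormM hnu).
- by rewrite (star_homM hf) (star_homS hf) (snorm_star_mul hnu).
Qed.

(** M bounds the norm of a in the universal C*-completion of D.  The f need not
    be unital, so corners are included. *)
Definition hom_bound D (a : D) (M : R) := forall E (nu : E -> R) (f : D -> E),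
  cstar_seminorm nu -> star_hom f -> nu (f a) <= M.

Lemma hom_bound_ge0 D (a : D) M : hom_bound a M -> 0 <= M.
Proof.
move=> h; apply: (h D (fun=> 0) id _ (@star_hom_id _ D)).
by split=> *; rewrite ?mulr0 ?addr0 ?expr0n.
Qed.

Lemma hom_boundD D (a b : D) M K : hom_bound a M -> hom_bound b K -> hom_bound (a + b) (M + K).
Proof.
move=> ha hb E nu f hnu hf; rewrite (star_homD hf).
apply: le_trans (snormD hnu _ _) _.
exact: lerD (ha _ _ _ hnu hf) (hb _ _ _ hnu hf).
Qed.

Lemma hom_boundM D (a b : D) M K : hom_bound a M -> hom_bound b K -> hom_bound (a * b) (M * K).
Proof.
move=> ha hb E nu f hnu hf; rewrite (star_homM hf).
apply: le_trans (snormM hnu _ _) _; by apply: ler_pM (ha _ _ _ hnu hf) (hb _ _ _ hnu hf); exact: snorm_ge0.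
Qed.

Lemma hom_bound_sum D I (r : seq I) (P : pred I) (F : I -> D) (M : I -> R) :
  (forall i, P i -> hom_bound (F i) (M i)) ->
  hom_bound (\sum_(i <- r | P i) F i) (\sum_(i <- r | P i) M i).
Proof.
move=> h; elim/big_ind2: _ => [E nu f hnu hf|a M' b K ha hb|i Pi].
- by rewrite (star_hom0 hf) (snorm0 hnu).
- exact: hom_boundD.
- exact: h.
Qed.

Lemma hom_bound_star_mul D (a : D) M : 0 <= M ->
  hom_bound (star a * a) (M ^+ 2) -> hom_bound a M.
Proof.
move=> M0 h E nu f hnu hf; have := h E nu f hnu hf.
by rewrite (star_homM hf) (star_homS hf) (snorm_star_mul hnu) ler_pXn2r ?nnegrE ?(snorm_ge0 hnu).
Qed.

Lemma hom_bound_piso D (a : D) : is_projection (star a * a) -> hom_bound a 1.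
Proof.
move=> [ps pp] E nu f hnu hf; apply: (snorm_piso hnu).
by rewrite -(star_homS hf) -(star_homM hf); split; rewrite -?(star_homS hf) -?(star_homM hf) ?ps ?pp.
Qed.

Lemma hom_bound_map D E (h : D -> E) a M : star_hom h -> hom_bound a M -> hom_bound (h a) M.
Proof. by move=> hh ha F nu f hnu hf; apply: (ha F nu (f \o h) hnu); exact: star_hom_comp hh hf. Qed.

Lemma hom_bound_cfun (f : cfun R) M : (forall z, cmod (ceval z f) <= M) -> hom_bound f M.
Proof. by move=> fM E nu pi hnu hpi; exact: (star_hom_contractive hnu hpi). Qed.

Lemma scale_deltaE D m n (a : D) i j p q :
  (a *: (delta_mx i j : 'M[D]_(m, n))) p q = a *+ ((p == i) && (q == j)).
Proof. by rewrite !mxE mulr_natr. Qed.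

Lemma scale_deltaM D m n p (a b : D) i j k :
  (a *: (delta_mx i j : 'M[D]_(m, n))) *m (b *: (delta_mx j k : 'M[D]_(n, p))) =
  (a * b) *: delta_mx i k.
Proof.
apply/matrixP => u v; rewrite mxE (bigD1 j)//= big1 ?addr0.
  rewrite !scale_deltaE eqxx andbT /=.
  by case: (u == i); case: (v == k); rewrite ?mulr1n ?mulr0n ?mulr0 ?mul0r.
by move=> x xj; rewrite !scale_deltaE (negPf xj) andbF mulr0n mul0r.
Qed.

Lemma scale_delta_star D n (a : D) (i j : 'I_n) :
  star (a *: (delta_mx i j : 'M[D]_n)) = star a *: delta_mx j i.
Proof.
apply/matrixP => u v; rewrite mx_starE !scale_deltaE andbC.
by case: andb; rewrite ?mulr1n ?mulr0n ?star0.
Qed.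

Lemma star_hom_corner D n (j : 'I_n) :
  star_hom (fun a : D => a *: (delta_mx j j : 'M[D]_n)).
Proof.
split=> [|a b|a]; [split=> [a b|c a]| |].
- by rewrite scalerDl.
- by apply/matrixP => u v; rewrite mx_scalME !scale_deltaE mulrnAr.
- by symmetry; exact: scale_deltaM.
- by rewrite scale_delta_star.
Qed.

Lemma matrix_sum_scale_delta D m n (X : 'M[D]_(m, n)) :
  X = \sum_i \sum_j X i j *: delta_mx i j.
Proof. exact: matrix_sum_delta. Qed.

(** The entries are seen through the corner embeddings: X = c_ij E_ij has
    X^* X = c_ij^* c_ij E_jj. *)
Lemma hom_bound_matrix D n (c : 'M[D]_n) (M : 'I_n -> 'I_n -> R) :
  (forall i j, 0 <= M i j) ->
  (forall i j, hom_bound (star (c i j) * c i j) (M i j ^+ 2)) ->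
  hom_bound c (\sum_i \sum_j M i j).
Proof.
move=> M0 cM; rewrite {1}[c]matrix_sum_scale_delta.
apply: hom_bound_sum => i _; apply: hom_bound_sum => j _.
apply: hom_bound_star_mul => //; rewrite scale_delta_star.
have -> : (star (c i j) *: delta_mx j i) * (c i j *: delta_mx i j) =
  (star (c i j) * c i j) *: delta_mx j j :> 'M[D]_n by exact: scale_deltaM.
exact: (hom_bound_map (star_hom_corner D j) (cM i j)).
Qed.

Lemma hom_bound_cfun_mx n (c : 'M[cfun R]_n) (M : 'I_n -> 'I_n -> R) :
  (forall i j z, cmod (ceval z (c i j)) <= M i j) ->
  hom_bound c (\sum_i \sum_j M i j).
Proof.
move=> cM; have M0 i j : 0 <= M i j by apply: le_trans (cM i j 1%g); exact: cmod_ge0.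
apply: hom_bound_matrix => // i j; apply: hom_bound_cfun => z.
rewrite cevalM ceval_star cmodM cmod_conj expr2.
by apply: ler_pM; rewrite ?cmod_ge0.
Qed.

Section AlgR.
Variable N : nat.
Hypothesis N_gt0 : (0 < N)%N.

(** R is generated by xi (C(S^1)) and the unitary u. *)
Lemma algR_decomposition (F : algR R N) :
  F = \sum_y xi N (iota_R F (Ordinal N_gt0) y) * algR_shift R N y.
Proof.
rewrite xi_iota_shift; have -> : algR_shift R N (Ordinal N_gt0) = 1; last by rewrite mul1r.
by apply: val_inj; apply/matrixP => i j; rewrite !mxE eq_sym.
Qed.

Lemma hom_bound_algR (F : algR R N) : exists M, hom_bound F M.
Proof.
have /choice[M HM] y : exists M, hom_bound (iota_R F (Ordinal N_gt0) y) M.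
  have [M _ HM] := cfun_bounded (iota_R F (Ordinal N_gt0) y); exists M.
  exact: hom_bound_cfun.
exists (\sum_y M y * 1); rewrite {1}[F]algR_decomposition; apply: hom_bound_sum => y _.
apply: hom_boundM; first exact: hom_bound_map (@star_hom_xi R N) (HM y).
by apply: hom_bound_piso; rewrite star_shift_shift; split; rewrite ?star1 ?mulr1.
Qed.

Lemma star_hom_inr m0 m1 : star_hom (fun X : 'M[cfun R]_m1 => (0, X) : stage R N m0 m1).
Proof.
split=> [|X Y|X]; [split=> [X Y|c X]| |]; congr (_, _); rewrite ?addr0 ?mulr0//.
by rewrite /= star0.
Qed.

Lemma hom_bound_stage m0 m1 (a : stage R N m0 m1) : exists M, hom_bound a M.
Proof.
have bmx D n (c : 'M[D]_n) : (forall F : D, exists M, hom_bound F M) -> exists M, hom_bound c M.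
  move=> DB.
  have /choice[M HM] (ij : 'I_n * 'I_n) :
      exists M, hom_bound (star (c ij.1 ij.2) * c ij.1 ij.2) M.
    exact: DB.
  exists (\sum_i \sum_j Num.sqrt (M (i, j))); apply: hom_bound_matrix => [i j|i j].
    exact: sqrtr_ge0.
  by have h := HM (i, j); rewrite sqr_sqrtr//; exact: hom_bound_ge0 h.
have [M0 h0] := bmx _ _ a.1 hom_bound_algR.
have [M1 h1] : exists M, hom_bound a.2 M.
  apply: bmx => f; have [M _ HM] := cfun_bounded f; exists M; exact: hom_bound_cfun.
have hl : star_hom (fun X : 'M[algR R N]_m0 => (X, 0) : stage R N m0 m1).
  split=> [|X Y|X]; [split=> [X Y|c X]| |]; congr (_, _); rewrite ?addr0 ?mulr0//.
  by rewrite /= star0.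
exists (M0 + M1); have -> : a = (a.1, 0) + (0, a.2).
  by case: a {h0 h1} => x y; congr (_, _); rewrite /= ?addr0 ?add0r.
by apply: hom_boundD; [exact: hom_bound_map hl h0|exact: hom_bound_map (star_hom_inr _ _) h1].
Qed.

End AlgR.

(** The power trick turns the crude bound by the entries into the bound by the
    operator norm, uniformly over the circle. *)
Lemma hom_bound_opnorm n (c : 'M[cfun R]_n) (M : R) : 0 <= M ->
  (forall z, opnorm (eval_mx z c) <= M) -> hom_bound c M.
Proof.
move=> M0 cM E nu f hnu hf.
have c2M k z : opnorm (eval_mx z ((star c * c) ^+ (2 ^ k))) <= (M ^+ 2) ^+ (2 ^ k).
  elim: (2 ^ k)%N => [|m IH].
    rewrite expr0; have h := eval_mx_seminorm n z; have := snorm1 h.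
    by rewrite expr0.
  rewrite (exprS (star c * c)) (exprS (M ^+ 2)) eval_mxM; apply: le_trans (opnormM _ _) _.
  apply: (ler_pM (opnorm_ge0 _) (opnorm_ge0 _) _ IH).
  by rewrite eval_mxM eval_mx_star opnorm_star ler_pXn2r ?nnegrE ?opnorm_ge0.
have key : nu (f (star c * c)) <= M ^+ 2.
  apply: (@power_trick R _ _ ((n * n)%:R)) => [||k]; [exact: snorm_ge0|exact: sqr_ge0|].
  rewrite -(snormX2 hnu); last by rewrite -(star_homS hf) starM starK.
  have k0 : (0 < 2 ^ k)%N by rewrite expn_gt0.
  rewrite -(prednK k0) -(star_homX hf) (prednK k0).
  have := @hom_bound_cfun_mx n ((star c * c) ^+ (2 ^ k)) (fun _ _ => (M ^+ 2) ^+ (2 ^ k)).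
  move=> /(_ _ E nu f hnu hf); rewrite !sumr_const !card_ord -mulrnA mulr_natl; apply.
  move=> i j z; apply: le_trans (c2M k z); rewrite -(eval_mxE z).
  exact: opnorm_entry.
move: key; rewrite (star_homM hf) (star_homS hf) (snorm_star_mul hnu).
by rewrite ler_pXn2r ?nnegrE ?(snorm_ge0 hnu).
Qed.

End UniversalBounds.

(** * Comparison in C*-algebras *)

Section CstarLemmas.
Variables (R : realType) (A : cstarType R).
Let hn := cnorm_seminorm A.
Implicit Types a b p q r s v w x y : A.

Lemma cnormX_le a n : cnorm (a ^+ n.+1) <= cnorm a ^+ n.+1.
Proof.
elim: n => [|n IH]; first by rewrite !expr1.
rewrite exprS [in leRHS]exprS; apply: le_trans (snormM hn _ _) _.
by rewrite ler_wpM2l ?(snorm_ge0 hn).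
Qed.

(** b is the orthogonal sum of p b and (1 - p) b, and s compresses p b
    to (1 - p) b.  This gives |b| <= 2 |p b|, also for the powers of b, and the
    factor is removed by power_trick. *)
Lemma cnorm_corner_sa p s b : is_projection p -> star s * s = 1 - p -> p * s = s ->
  p * b = b * p -> s * b = b * s -> star b = b -> cnorm b <= cnorm (p * b).
Proof.
move=> [ps pp] ss psE pb sb bs.
have s1 : cnorm s <= 1.
  apply: (snorm_piso hn); rewrite ss; split; first by rewrite starB star1 ps.
  by rewrite mulrBr mulr1 mulrBl mul1r pp subrr subr0.
apply: (@power_trick R _ _ 2) => [||k]; try exact: snorm_ge0 hn _.
rewrite -(snormX2 hn)//; have k0 : (0 < 2 ^ k)%N by rewrite expn_gt0.
rewrite -(prednK k0); set m := (2 ^ k).-1.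
have pbX : p * b ^+ m.+1 = (p * b) ^+ m.+1.
  have pX j : p ^+ j.+1 = p by elim: j => // j IH; rewrite exprS IH pp.
  by rewrite exprMn_comm// pX.
have sbX : s * b ^+ m.+1 = b ^+ m.+1 * s := commrX _ sb.
have pbC : b ^+ m.+1 * p = p * b ^+ m.+1 := esym (commrX _ pb).
have -> : b ^+ m.+1 = p * b ^+ m.+1 + star s * (p * b ^+ m.+1) * s.
  have -> : star s * (p * b ^+ m.+1) * s = (1 - p) * b ^+ m.+1.
    by rewrite -pbC -!mulrA psE -sbX mulrA ss.
  by rewrite -mulrDl addrC subrK mul1r.
have le1 : cnorm (star s * (p * b ^+ m.+1) * s) <= cnorm (p * b ^+ m.+1).
  apply: le_trans (snormM hn _ _) _; apply: (@le_trans _ _ (cnorm (star s * (p * b ^+ m.+1)))).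
    by rewrite ler_piMr ?(snorm_ge0 hn).
  apply: le_trans (snormM hn _ _) _; rewrite (snorm_star hn).
  by rewrite ler_piMl ?(snorm_ge0 hn).
apply: le_trans (snormD hn _ _) _.
have le2 : cnorm (p * b ^+ m.+1) <= cnorm (p * b) ^+ m.+1 by rewrite pbX cnormX_le.
by lra.
Qed.

Lemma cnorm_corner p s a : is_projection p -> star s * s = 1 - p -> p * s = s ->
  p * a = a * p -> p * star a = star a * p -> s * a = a * s -> s * star a = star a * s ->
  cnorm a <= cnorm (p * a).
Proof.
move=> hp ss psE pa pa' sa sa'; case: (hp) => ps pp.
rewrite -(@ler_pXn2r _ 2) ?nnegrE ?(snorm_ge0 hn)// -!(snorm_star_mul hn).
have -> : star (p * a) * (p * a) = p * (star a * a).
  by rewrite starM ps -mulrA (mulrA p) pp (mulrA (star a)) -pa' mulrA.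
apply: (cnorm_corner_sa hp ss psE).
- by rewrite mulrA pa' -mulrA pa mulrA.
- by rewrite mulrA sa' -mulrA sa mulrA.
- by rewrite starM starK.
Qed.

(** w is the first order approximation of (q - r)^(-1/2). *)
Lemma cuntz_step q r : q * q = q -> q * r = r -> r * q = r -> star q = q -> star r = r ->
  let w := q + scal (2^-1)%:C * r in
  star w = w /\ cnorm (q - w * (q - r) * w) <= 3 / 4 * cnorm r ^+ 2 + 1 / 4 * cnorm r ^+ 3.
Proof.
move=> qq qr rq qs rs w; set h := scal (2^-1)%:C in w *.
have hC a : a * h = h * a by rewrite /h scalC.
have hr2 : h * r + h * r = r := half_add r.
have hs : star h = h by rewrite /h star_scal_real.
have ws : star w = w by rewrite /w starD starM qs rs hs hC.
split=> //.
have E1 : w * (q - r) = q - h * r - h * (r * r).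
  rewrite /w mulrDl !mulrBr qq qr -!mulrA rq -{1}hr2 opprD !addrA.
  by rewrite subrK.
have E2 : q - w * (q - r) * w = h * (r * r) + h * (h * (r * r)) + h * (h * (r * (r * r))).
  rewrite E1 /w mulrDr.
  have -> : (q - h * r - h * (r * r)) * q = q - h * r - h * (r * r).
    by rewrite !mulrBl qq -!mulrA !rq.
  have -> : (q - h * r - h * (r * r)) * (h * r) =
      h * r - h * (h * (r * r)) - h * (h * (r * (r * r))).
    rewrite !mulrBl; congr (_ - _ - _).
    - by rewrite mulrA hC -mulrA qr.
    - by rewrite -!mulrA [r * (h * r)]mulrA hC -mulrA.
    - by rewrite -!mulrA [r * (h * r)]mulrA hC -mulrA [r * (h * _)]mulrA hC -mulrA.
  set X := h * r; set Y := h * (r * r); set Z := h * Y; set W := h * (h * _).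
  have -> : q - X - Y + (X - Z - W) = q - (Y + Z + W).
    by rewrite !opprD !addrA [q - X - Y]addrAC subrK.
  by rewrite opprB addrC subrK.
rewrite E2; set n := cnorm r; have n0 : 0 <= n := snorm_ge0 hn r.
have nh a : cnorm (h * a) = cnorm a / 2 := snorm_half hn a.
have n2 : cnorm (r * r) <= n ^+ 2 by rewrite expr2 (snormM hn).
have n3 : cnorm (r * (r * r)) <= n ^+ 3.
  by rewrite exprS; apply: le_trans (snormM hn _ _) _; rewrite ler_wpM2l.
apply: le_trans (snormD hn _ _) _; apply: le_trans (lerD (snormD hn _ _) (lexx _)) _.
by rewrite !nh; lra.
Qed.

Variable B : set A.
Hypothesis hB : star_subalgebra B.

Lemma subalgebraD a b : B a -> B b -> B (a + b).
Proof.
have [_ BB _ Bc _] := hB; move=> Ba Bb; rewrite -[b]opprK; apply: (BB _ _ Ba).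
by rewrite -sub0r; apply: (BB _ _ _ Bb); rewrite -(scal0 A); exact: Bc.
Qed.

(** v x v^* is made closer and closer to q by Newton's iteration for the inverse
    square root: with y = v x v^*, replacing v by w v for w = q + (q - y) / 2
    squares the distance from y to q. *)
Lemma cuntz_le_of_close q x v : B q -> is_projection q -> B v -> B x -> star x = x ->
  cnorm (v * x * star v - q) < 1 -> cuntz_le B q x.
Proof.
move=> Bq [qs qq] Bv Bx xs vx; have [B1 BB BM Bc Bs] := hB.
pose r v := q - v * x * star v.
have step v1 t : B v1 -> q * v1 = v1 -> cnorm (r v1) <= t -> t <= 1 ->
    exists v2, [/\ B v2, q * v2 = v2 & cnorm (r v2) <= t ^+ 2].
  move=> Bv1 qv1 rt t1; set r1 := r v1 in rt.
  have v1q : star v1 * q = star v1 by rewrite -{2}qv1 starM qs.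
  have qr1 : q * r1 = r1 by rewrite /r1 /r mulrBr qq !mulrA qv1.
  have r1q : r1 * q = r1 by rewrite /r1 /r mulrBl qq -!mulrA v1q.
  have r1s : star r1 = r1 by rewrite /r1 /r starB qs !starM starK xs mulrA.
  have [ws wE] := cuntz_step qq qr1 r1q qs r1s.
  set w := q + scal (2^-1)%:C * r1 in ws wE.
  have Br1 : B r1 by apply: (BB _ _ Bq); apply: (BM _ _ (BM _ _ Bv1 Bx)); exact: Bs.
  exists (w * v1); split.
  - by apply: (BM _ _ _ Bv1); apply: (subalgebraD Bq); apply: (BM _ _ _ Br1); exact: Bc.
  - by rewrite mulrA /w mulrDr qq mulrA -scalC -mulrA qr1.
  - have -> : r (w * v1) = q - w * (q - r1) * w.
      by rewrite /r1 /r starM ws subKr !mulrA.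
    apply: le_trans wE _; set n := cnorm r1 in rt *; have n0 : 0 <= n := snorm_ge0 hn r1.
    have n2 : n ^+ 2 <= t ^+ 2 by rewrite ler_pXn2r ?nnegrE ?(le_trans n0).
    have n3 : n ^+ 3 <= n ^+ 2.
      by rewrite exprS ler_piMl ?sqr_ge0// (le_trans rt).
    by lra.
pose t := cnorm (v * x * star v - q); have t0 : 0 <= t := snorm_ge0 hn _.
have q1 : cnorm q <= 1 by exact: snorm_proj hn _ (conj qs qq).
have /choice[vs vsP] : forall k, exists v1,
    [/\ B v1, q * v1 = v1 & cnorm (r v1) <= t ^+ k.+1].
  elim=> [|k [v1 [Bv1 qv1 rv1]]].
    exists (q * v); split; [exact: BM|by rewrite mulrA qq|].
    have -> : r (q * v) = q * (q - v * x * star v) * q.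
      by rewrite /r starM qs mulrBr mulrBl !qq !mulrA.
    rewrite expr1; apply: le_trans (snormM hn _ _) _; apply: le_trans (ler_piMr _ q1) _.
      exact: snorm_ge0 hn _.
    apply: le_trans (snormM hn _ _) _; rewrite (snorm_dist hn).
    by rewrite ler_piMl// snorm_ge0.
  have tk1 : t ^+ k.+1 <= 1 by rewrite exprn_ile1// ltW.
  have [v2 [Bv2 qv2 rv2]] := step v1 _ Bv1 qv1 rv1 tk1.
  exists v2; split => //; apply: le_trans rv2 _.
  rewrite -exprM mulnC mul2n -addnn addSn addnS !exprS ler_wpM2l// ler_wpM2l//.
  by rewrite -[leRHS]mulr1 exprD ler_wpM2l ?exprn_ge0// exprn_ile1// ltW.
exists vs; first by move=> n; have [] := vsP n.
apply/cvgr0Pnorm_lt => e e0.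
have /cvgr0Pnorm_lt/(_ e e0)[n0 _ Hn0] : (t ^+ n @[n --> \oo]) --> (0 : R).
  by apply: cvg_expr; rewrite ger0_norm.
exists n0 => // n nn /=; have [_ _ h] := vsP n; rewrite ger0_norm ?(snorm_ge0 hn)//.
rewrite (snorm_dist hn); apply: le_lt_trans h _; have := Hn0 n nn; rewrite /=.
rewrite ger0_norm ?exprn_ge0//; apply: le_lt_trans.
by rewrite exprS ler_piMl ?exprn_ge0// ltW.
Qed.

Lemma cuntz_le_conj P q x w : B w -> w * q * star w = P -> cuntz_le B q x -> cuntz_le B P x.
Proof.
have [_ _ BM _ _] := hB; move=> Bw <- [v Bv vx]; exists (fun n => w * v n).
  by move=> n; exact: BM.
apply/cvgr0Pnorm_lt => e e0.
have K0 : 0 < cnorm w ^+ 2 + 1 by have := sqr_ge0 (cnorm w); lra.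
have /cvgr0Pnorm_lt/(_ _ (divr_gt0 e0 K0))[n0 _ H] := vx.
exists n0 => // n /H /=; rewrite !ger0_norm ?(snorm_ge0 hn)// ltr_pdivlMr//.
set y := v n * x * star (v n) - q => yK.
have -> : w * v n * x * star (w * v n) - w * q * star w = w * y * star w.
  by rewrite /y mulrBr mulrBl starM !mulrA.
apply: le_lt_trans (snormM hn _ _) _; rewrite (snorm_star hn).
have := snormM hn w y; have := snorm_ge0 hn w; have := snorm_ge0 hn y.
set a := cnorm y in yK *; set b := cnorm w in yK *; set c := cnorm (w * y) => a0 b0 cab.
have h1 : c * b <= b * a * b by rewrite ler_wpM2r.
have h2 : b * a * b = a * b ^+ 2 by ring.
by apply: le_lt_trans h1 _; move: yK; rewrite h2 mulrDr mulr1; lra.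
Qed.

Lemma cuntz_le_const P x w : B w -> w * x * star w = P -> cuntz_le B P x.
Proof.
move=> Bw <-; exists (fun=> w) => //; rewrite subrr (snorm0 hn).
exact: cvg_cst.
Qed.

End CstarLemmas.

Lemma star_subalgebra_setT (R : realType) (A : cstarType R) : star_subalgebra [set: A].
Proof. by []. Qed.

Lemma fixed_subalgebra (R : realType) (A : cstarType R) (alpha : circle R -> A -> A) :
  (forall z, star_hom (alpha z)) -> (forall z, alpha z 1 = 1) -> star_subalgebra (fixed alpha).
Proof.
move=> h h1; split=> [z|a b fa fb z|a b fa fb z|c z|a fa z].
- exact: h1.
- by rewrite (star_homB (h z)) fa fb.
- by rewrite (star_homM (h z)) fa fb.
- by rewrite -[scal c]mulr1 (star_homZ (h z)) h1.
- by rewrite (star_homS (h z)) fa.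
Qed.

(** * *-homomorphisms of C*-algebras are contractive *)

Section AutomaticContractivity.
Variables (R : realType) (A B : cstarType R).
Let hn := cnorm_seminorm A.
Let hB := cnorm_seminorm B.

Let half : A := scal (2^-1)%:C.

Let half_star : star half = half. Proof. exact: star_scal_real. Qed.
Let halfC a : half * a = a * half. Proof. by rewrite /half scalC. Qed.
Let half_norm a : cnorm (half * a) = cnorm a / 2 := snorm_half hn a.
Let half2 a : half * a + half * a = a := half_add a.

Lemma cnorm_eq0_small (a : A) : (forall e : R, 0 < e -> cnorm a <= e) -> a = 0.
Proof.
move=> h; apply: cnorm_eq0; apply/le_anti; rewrite (snorm_ge0 hn) andbT.
by apply/ler_addgt0Pr => e e0; rewrite add0r h.
Qed.

(** The iteration z := (h^2 + z^2) / 2 converges to 1 - sqrt (1 - h^2), which is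
    the fixed point.  All iterates are polynomials in h^2, and rho < 1 bounds
    both the iterates and the ratio of successive differences. *)
Lemma sqrt_one_sub_sqr (h : A) : star h = h -> cnorm h < 1 ->
  exists y, [/\ star y = y, y * h = h * y & y * y = 1 - h * h].
Proof.
move=> hs h1; have [b bE] : exists b, b = h * h by exists (h * h).
pose beta := cnorm h ^+ 2; pose rho := (1 + beta) / 2.
have h0 := snorm_ge0 hn h.
have beta0 : 0 <= beta by rewrite sqr_ge0.
have beta1 : beta < 1 by rewrite /beta exprn_ilt1.
have nb : cnorm b = beta by rewrite bE -{1}hs (snorm_star_mul hn).
have rho0 : 0 < rho by rewrite /rho; lra.
have rho1 : rho < 1 by rewrite /rho; lra.
have rhoE : (beta + rho ^+ 2) / 2 <= rho.
  rewrite -subr_ge0; have -> : rho - (beta + rho ^+ 2) / 2 = (1 - beta) * (3 + beta) / 8.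
    by rewrite /rho; field.
  by rewrite !mulr_ge0 ?invr_ge0//; lra.
pose z := fix z n : A := if n is n'.+1 then half * (b + z n' * z n') else 0.
have z0 : z 0%N = 0 by [].
have zS n : z n.+1 = half * (b + z n * z n) by [].
clearbody z.
have bs : star b = b by rewrite bE starM hs.
have bh : b * h = h * b by rewrite bE mulrA.
have zs n : star (z n) = z n.
  elim: n => [|n IH]; first by rewrite z0 star0.
  by rewrite zS starM half_star -halfC starD bs starM IH.
have zh n : z n * h = h * z n.
  elim: n => [|n IH]; first by rewrite z0 mul0r mulr0.
  rewrite zS -mulrA [RHS]mulrA -(halfC h) -mulrA; congr (_ * _).
  by rewrite mulrDl mulrDr bh -mulrA IH mulrA IH mulrA.
have zz m n : z m * z n = z n * z m.
  have zb k : z k * b = b * z k by rewrite bE mulrA zh -mulrA zh mulrA.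
  elim: m n => [|m IH] n; first by rewrite z0 mul0r mulr0.
  rewrite zS -mulrA [RHS]mulrA -(halfC (z n)) -mulrA; congr (_ * _).
  by rewrite mulrDl mulrDr zb -mulrA IH mulrA IH mulrA.
have zn n : cnorm (z n) <= rho.
  elim: n => [|n IH]; first by rewrite z0 (snorm0 hn) ltW.
  rewrite zS half_norm; apply: le_trans rhoE; rewrite ler_pM2r ?invr_gt0//.
  apply: le_trans (snormD hn _ _) _; rewrite nb lerD2l; apply: le_trans (snormM hn _ _) _.
  by rewrite expr2; apply: ler_pM => //; exact: snorm_ge0 hn _.
have dz n : cnorm (z n.+1 - z n) <= rho ^+ n.
  elim: n => [|n IH].
    rewrite expr0 zS z0 subr0 mulr0 addr0 half_norm nb; lra.
  have -> : z n.+2 - z n.+1 = half * ((z n.+1 - z n) * (z n.+1 + z n)).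
    rewrite (zS n.+1) {3}(zS n) -mulrBr; congr (_ * _).
    rewrite opprD addrACA subrr add0r mulrDr !mulrBl (zz n n.+1).
    by rewrite addrA subrK.
  rewrite half_norm exprS; apply: (@le_trans _ _ (rho ^+ n * (2 * rho) / 2)); last first.
    by rewrite [leLHS](_ : _ = rho * rho ^+ n)//; field.
  rewrite ler_pM2r ?invr_gt0//; apply: le_trans (snormM hn _ _) _.
  apply: ler_pM => //; try exact: snorm_ge0 hn _.
  by apply: le_trans (snormD hn _ _) _; have := zn n; have := zn n.+1; lra.
have cz m n : (n <= m)%N -> cnorm (z m - z n) <= rho ^+ n / (1 - rho).
  move=> nm; suff : cnorm (z m - z n) <= (rho ^+ n - rho ^+ m) / (1 - rho).
    move=> /le_trans; apply; rewrite ler_pM2r ?invr_gt0 ?subr_gt0// gerBl exprn_ge0//.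
    exact: ltW.
  rewrite -(subnK nm); elim: (m - n)%N => [|k IH]; first by rewrite !subrr (snorm0 hn) mul0r.
  rewrite addSn; apply: le_trans (snorm_tri hn (z (k + n)%N) _ _) _.
  apply: le_trans (lerD (dz _) IH) _; rewrite exprS ler_pdivlMr ?subr_gt0//.
  by rewrite mulrDl divfK ?subr_eq0 ?gt_eqF//; rewrite [leLHS](_ : _ = rho ^+ n - rho * rho ^+ (k + n))//; ring.
have small (e : R) : 0 < e -> exists n0, forall n, (n0 <= n)%N -> rho ^+ n / (1 - rho) < e.
  move=> e0; have e1 : 0 < e * (1 - rho) by rewrite mulr_gt0// subr_gt0.
  have /cvgr0Pnorm_lt/(_ _ e1)[n0 _ Hn] : (rho ^+ n @[n --> \oo]) --> (0 : R).
    by apply: cvg_expr; rewrite gtr0_norm.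
  exists n0 => n /Hn /=; rewrite ger0_norm ?exprn_ge0 ?ltW//.
  by rewrite ltr_pdivrMr ?subr_gt0.
have [|l lE] := cnorm_complete z.
  move=> e /small[n0 H]; exists n0 => m n m0 n0n.
  have [mn|mn] := leqP n m; first by apply: le_lt_trans (cz _ _ mn) (H _ _).
  by rewrite (snorm_dist hn); apply: le_lt_trans (cz _ _ (ltnW mn)) (H _ _).
have near_l (e : R) : 0 < e -> exists n, cnorm (z n - l) <= e /\ cnorm (z n.+1 - l) <= e.
  move=> e0; have /cvgr0Pnorm_lt/(_ _ e0)[n _ Hn] := lE.
  exists n; have := Hn n (leqnn n); have := Hn n.+1 (leqnSn n).
  by rewrite /= !ger0_norm ?(snorm_ge0 hn)// => /ltW ? /ltW.
have ls : star l = l.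
  apply/eqP; rewrite -subr_eq0; apply/eqP/cnorm_eq0_small => e e0.
  have e2 : 0 < e / 2 by lra.
  have [n [zl _]] := near_l _ e2.
  have sE : cnorm (star l - z n) = cnorm (z n - l).
    by rewrite -{1}(zs n) -starB (snorm_star hn) (snorm_dist hn).
  by have := snorm_tri hn (z n) (star l) l; lra.
have lh : l * h = h * l.
  apply/eqP; rewrite -subr_eq0; apply/eqP/cnorm_eq0_small => e e0.
  have e2 : 0 < e / 2 by lra.
  have [n [zl _]] := near_l _ e2.
  have -> : l * h - h * l = h * (z n - l) - (z n - l) * h.
    by rewrite mulrBr mulrBl zh opprB [RHS]addrC addrA subrK.
  apply: le_trans (snormB hn _ _) _.
  have := snormM hn h (z n - l); have := snormM hn (z n - l) h.
  by have := snorm_ge0 hn (z n - l); nra.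
have lE2 : l = half * (b + l * l).
  apply/eqP; rewrite -subr_eq0; apply/eqP/cnorm_eq0_small => e e0.
  pose K := cnorm l + 2; have K0 : 0 < K by have := snorm_ge0 hn l; rewrite /K; lra.
  have [n [zl zl']] := near_l _ (divr_gt0 e0 K0).
  have -> : l - half * (b + l * l) = (l - z n.+1) + half * (z n * (z n - l) + (z n - l) * l).
    rewrite zS -[_ - _ + _]addrA; congr (_ + _).
    rewrite -!mulrN -mulrDr; congr (_ * _).
    rewrite mulrBr mulrBl [X in _ = _ + X]addrA subrK addrA [- (b + z n * z n)]opprD subrK.
    by rewrite -opprD.
  apply: le_trans (snormD hn _ _) _; rewrite half_norm (snorm_dist hn).
  have h2 : cnorm (z n * (z n - l) + (z n - l) * l) <= e / K * (1 + cnorm l).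
    have -> : e / K * (1 + cnorm l) = e / K + e / K * cnorm l by ring.
    apply: le_trans (snormD hn _ _) _; apply: lerD.
      apply: le_trans (snormM hn _ _) _; rewrite -[leRHS]mul1r.
      by apply: ler_pM => //; rewrite ?(snorm_ge0 hn)// (le_trans (zn n))// ltW.
    by apply: le_trans (snormM hn _ _) _; rewrite ler_wpM2r ?(snorm_ge0 hn).
  have h3 : e = e / K * (cnorm l + 2) by rewrite divfK// gt_eqF.
  have : 0 <= e / K * cnorm l by rewrite mulr_ge0 ?(snorm_ge0 hn)// ltW// divr_gt0.
  have := divr_gt0 e0 K0.
  have h4 : e / K * (1 + cnorm l) = e / K + e / K * cnorm l by ring.
  have h5 : e / K * (cnorm l + 2) = 2 * (e / K) + e / K * cnorm l by ring.
  move: h2 h3; rewrite h4 h5 => h2 h3; lra.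
exists (1 - l); split.
- by rewrite starB star1 ls.
- by rewrite mulrBl mulrBr mul1r mulr1 lh.
- have ll : l + l = b + l * l by rewrite {1 2}lE2 half2.
  have bl : b = l + l - l * l by rewrite ll addrK.
  rewrite mulrBr mulr1 mulrBl mul1r -bE bl !opprB opprD -!addrA; congr (1 + _).
  by rewrite addrCA.
Qed.

(** A self-adjoint h with |h| < 1 is the real part of the unitary h + i y, with y
    as in sqrt_one_sub_sqr. *)
Lemma star_hom_cnorm_le (psi : A -> B) a : star_hom psi -> cnorm (psi a) <= cnorm a.
Proof.
move=> hpsi; wlog as_ : a / star a = a.
  move=> H; rewrite -(@ler_pXn2r _ 2) ?nnegrE ?(snorm_ge0 hn) ?(snorm_ge0 hB)//.
  rewrite -(snorm_star_mul hn) -(snorm_star_mul hB) -(star_homS hpsi) -(star_homM hpsi).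
  by apply: H; rewrite starM starK.
have unit_case h : star h = h -> cnorm h < 1 -> cnorm (psi h) <= 1.
  move=> hs h1; have [y [ys yh yy]] := sqrt_one_sub_sqr hs h1.
  exact: (hom_cos_le1 hB hpsi hs ys yh yy).
apply/ler_addgt0Pr => e e0; have K0 : 0 < cnorm a + e by have := snorm_ge0 hn a; lra.
have := unit_case (scal ((cnorm a + e)^-1)%:C * a).
rewrite starM star_scal_real as_ -scalC => /(_ erefl).
rewrite (star_homZ hpsi) (snormZ hn) (snormZ hB) cmodR gtr0_norm ?invr_gt0// ![_^-1 * _]mulrC.
by rewrite ltr_pdivrMr// mul1r ler_pdivrMr// mul1r; apply; rewrite ltrDl.
Qed.

End AutomaticContractivity.

(** * Separability of the functions on the circle *)

Section CountableDense.
Variable R : realType.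
Implicit Types f g : cfun R.

Definition ratc (q : rat * rat) : R[i] := ratr q.1 +i* ratr q.2.

Lemma ratc_dense (c : R[i]) e : 0 < e -> exists q, cmod (c - ratc q) <= e.
Proof.
move=> e0; case: c => a b.
have near (x : R) : exists q, `|x - ratr q| <= e / 2.
  have [|q] := @rat_in_itvoo R (x - e / 2) (x + e / 2); first by lra.
  by rewrite in_itv /= => /andP[h1 h2]; exists q; rewrite ler_norml; apply/andP; split; lra.
have [p pa] := near a; have [q qb] := near b; exists (p, q).
by apply: le_trans (cmod_le_abs (a - ratr p) (b - ratr q)) _; lra.
Qed.

(** For c = ((r, k), q), the functions within (r+1)^-1 of the value q_j on the
    j-th of k+1 equal arcs. *)
Definition near_step (c : nat * nat * seq (rat * rat)) : set (cfun R) :=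
  [set f | forall (j : 'I_c.1.2.+1) (t : R), 0 <= t < 1 / c.1.2.+1%:R ->
    cmod (ceval (omega R c.1.2.+1 ^+ j * cis t)%g f - ratc (nth (0, 0) c.2 j)) <= c.1.1.+1%:R^-1].

Lemma near_step_ex f r : exists c, c.1.1 = r /\ near_step c f.
Proof.
have e0 : 0 < r.+1%:R^-1 / 2 :> R by rewrite divr_gt0.
have [d d0 Hd] := cfun_uniform_cis f e0.
pose k := Num.bound (1 / d).
have kd : 1 / k.+1%:R < d.
  have := archi_boundP (ltW (divr_gt0 (@ltr01 R) d0)); rewrite -/k => h.
  rewrite ltr_pdivrMr// mulrC -ltr_pdivrMr//; apply: lt_trans h _.
  by rewrite ltr_nat.
have /choice[q Hq] (j : 'I_k.+1) : exists q, cmod (ceval (omega R k.+1 ^+ j)%g f - ratc q) <= r.+1%:R^-1 / 2.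
  exact: ratc_dense.
exists (r, k, [seq q j | j : 'I_k.+1]); split=> // j t /= /andP[t0 tk].
rewrite (nth_map ord0) ?size_enum_ord// nth_ord_enum.
rewrite [X in _ <= X]splitr.
rewrite -[X in cmod X](subrKA (ceval (omega R k.+1 ^+ j)%g f)).
apply: le_trans (cmodD _ _) _; apply: lerD (Hq j).
rewrite circleMC; apply/ltW/Hd; rewrite ger0_norm//; exact: lt_trans tk kd.
Qed.

Lemma near_step_dist c f g z : near_step c f -> near_step c g ->
  cmod (ceval z f - ceval z g) <= 2 * c.1.1.+1%:R^-1.
Proof.
move=> fc gc; have [j [t [tk ->]]] := circle_near_root z (ltn0Sn c.1.2).
have := fc j t tk; have := gc j t tk; set q := ratc _ => h1 h2.
rewrite -(subrKA q); apply: le_trans (cmodD _ _) _.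
rewrite -(cmodN (q - _)) opprB mulr_natl mulr2n; exact: lerD.
Qed.

(** One function for each code with a nonempty set; by near_step_dist it stands
    for the whole set, so no rational functions have to be constructed. *)
Definition dense_cfun c : cfun R := xget 0 (near_step c).

Lemma dense_cfunP f e : 0 < e -> exists c, forall z, cmod (ceval z f - ceval z (dense_cfun c)) <= e.
Proof.
move=> e0; pose r := Num.bound (2 / e).
have re : 2 * r.+1%:R^-1 <= e.
  have := archi_boundP (ltW (divr_gt0 (@ltr0Sn R 1) e0)); rewrite -/r => h.
  rewrite ler_pdivrMr// mulrC -ler_pdivrMr//; apply/ltW; apply: lt_trans h _.
  by rewrite ltr_nat.
have [c [cr fc]] := near_step_ex f r; exists c => z; apply: le_trans re; rewrite -cr.
apply: near_step_dist => //; exact: (xgetPex 0 (ex_intro _ f fc)).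
Qed.

End CountableDense.

(** * Columns of functions on the circle *)

Section Columns.
Variable R : realType.
Implicit Types D : starAlgType R.

Definition col_at D r (i0 : 'I_r) (f : 'I_r -> D) : 'M[D]_r :=
  \matrix_(i, j) (f i *+ (j == i0)).

Lemma mul_col_at D r (i0 : 'I_r) (f : 'I_r -> D) (X : 'M[D]_r) :
  X * col_at i0 f = col_at i0 (fun i => \sum_j X i j * f j).
Proof.
apply/matrixP => i j; rewrite !mxE -sumrMnl; apply: eq_bigr => k _.
by rewrite mxE mulrnAr.
Qed.

Lemma star_col_at_mul D r (i0 : 'I_r) (f h : 'I_r -> D) :
  star (col_at i0 f) * col_at i0 h = (\sum_i star (f i) * h i) *: delta_mx i0 i0.
Proof.
apply/matrixP => i j; rewrite mxE scale_deltaE.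
under eq_bigr do rewrite !mxE.
have [_|ii] := eqVneq i i0; last by rewrite big1// => k _; rewrite mulr0n star0 mul0r.
by rewrite -sumrMnl; apply: eq_bigr => k _; rewrite mulr1n mulrnAr.
Qed.

Lemma continuous_sum (T : topologicalType) I (s : seq I) (F : I -> T -> R) :
  (forall i, continuous (F i)) -> continuous (fun z => \sum_(i <- s) F i z).
Proof.
move=> cF; elim: s => [|i s IH].
  rewrite (_ : (fun z => _) = cst 0); first by move=> z; exact: cvg_cst.
  by apply/funext => z; rewrite big_nil.
rewrite (_ : (fun z => _) = (fun z => F i z + \sum_(i <- s) F i z)); last first.
  by apply/funext => z; rewrite big_cons.
by move=> z; apply: (@cvgD R R^o _ (nbhs z)); [exact: cF|exact: IH].
Qed.

Lemma continuous_mul (T : topologicalType) (f g : T -> R) :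
  continuous f -> continuous g -> continuous (fun z => f z * g z).
Proof. by move=> cf cg z; apply: (@cvgM R _ (nbhs z)); [exact: cf|exact: cg]. Qed.

(** The squares of the weights are (G_t - tau)^+ / sum_s (G_s - tau)^+ G_s.  They
    vanish unless G_t > tau, so their sum is at most 1/tau. *)
Lemma exists_weights (T : finType) (G : T -> cfun R) (tau : R) : 0 < tau ->
  (forall t z, ceval z (G t) = (cmod (ceval z (G t)))%:C) ->
  (forall z, exists t, tau < cmod (ceval z (G t))) ->
  exists w : T -> cfun R, \sum_t star (w t) * (G t * w t) = 1 /\
    forall z, cmod (ceval z (\sum_t star (w t) * w t)) <= tau^-1.
Proof.
move=> tau0 Greal Gcover.
pose a t z := cmod (ceval z (G t)).
have ca t : continuous (a t) by exact: continuous_cmod_cfun.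
pose k t z := a t z - tau + `|a t z - tau|.
have cat t : continuous (fun z => a t z - tau).
  by move=> z; apply: (@cvgB R R^o _ (nbhs z)); [exact: ca|exact: cvg_cst].
have ck t : continuous (k t).
  move=> z; apply: (@cvgD R R^o _ (nbhs z)); first exact: cat.
  by apply: (@cvg_norm R R^o _ (nbhs z)); exact: cat.
have k0 t z : 0 <= k t z by rewrite /k; have := ler_norm (- (a t z - tau)); rewrite normrN; lra.
have ka t z : tau * k t z <= k t z * a t z.
  rewrite mulrC /k; have [h|h] := leP 0 (a t z - tau).
    by rewrite ger0_norm// ler_wpM2l//; lra.
  by rewrite ltr0_norm// subrr !mul0r.
pose S z := \sum_t k t z * a t z.
have cS : continuous S by apply: continuous_sum => t; exact: continuous_mul.
have S0 z : 0 < S z.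
  have [t tz] := Gcover z; rewrite /S (bigD1 t)//=.
  apply: ltr_pwDl; last by apply: sumr_ge0 => s _; rewrite mulr_ge0// cmod_ge0.
  have az : tau < a t z by exact: tz.
  by rewrite mulr_gt0 /k ?ger0_norm; lra.
have cSV : continuous (fun z => (S z)^-1).
  by move=> z; apply: (@cvgV R _ (nbhs z)); [rewrite gt_eqF|exact: cS].
have cw t : continuous (fun z => Num.sqrt (k t z * (S z)^-1)).
  by apply: sqrt_cont; exact: continuous_mul.
exists (fun t => rcfun (cw t)).
have ww t z : Num.conj (ceval z (rcfun (cw t))) = ceval z (rcfun (cw t)).
  by rewrite ceval_rcfun; exact: conjc_real.
have w2 t z : Num.sqrt (k t z * (S z)^-1) ^+ 2 = k t z / S z.
  by rewrite sqr_sqrtr// mulr_ge0// invr_ge0 ltW.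
split.
  apply: cfunP => z; rewrite rmorph_sum /=.
  transitivity ((\sum_t k t z * a t z / S z)%:C).
    rewrite rmorph_sum; apply: eq_bigr => t _.
    rewrite !cevalM ceval_star ww Greal ceval_rcfun -!rmorphM; congr (_ %:C).
    by rewrite /= -/(a t z) mulrCA -expr2 w2 mulrCA mulrA.
  by rewrite -mulr_suml mulfV ?gt_eqF ?S0// ceval1.
move=> z; rewrite rmorph_sum /=.
have -> : \sum_t ceval z (star (rcfun (cw t)) * rcfun (cw t)) = ((\sum_t k t z) / S z)%:C.
  rewrite mulr_suml rmorph_sum; apply: eq_bigr => t _.
  by rewrite cevalM ceval_star ww ceval_rcfun -rmorphM -expr2 w2.
have K0 : 0 <= \sum_t k t z by apply: sumr_ge0 => t _.
rewrite cmodR ger0_norm; last by rewrite divr_ge0// ltW.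
rewrite ler_pdivrMr// ler_pdivlMl// mulr_sumr.
by apply: ler_sum => t _.
Qed.

(** sum_t w t *+ (a == sigma t) is the a-th entry of the column with the entries
    w t in the rows sigma t. *)
Lemma sum_supported D r (T : finType) (sigma : T -> 'I_r) (w : T -> D) (h : 'I_r -> D) :
  \sum_a star (\sum_t w t *+ (a == sigma t)) * h a = \sum_t star (w t) * h (sigma t).
Proof.
under eq_bigr => a _ do rewrite star_sum mulr_suml.
rewrite exchange_big /=; apply: eq_bigr => t _.
rewrite (bigD1 (sigma t))//= eqxx mulr1n big1 ?addr0// => a ta.
by rewrite (negPf ta) mulr0n star0 mul0r.
Qed.

Lemma sum_supported_self D r (T : finType) (sigma : T -> 'I_r) (w : T -> D) :
  injective sigma ->
  \sum_a star (\sum_t w t *+ (a == sigma t)) * (\sum_t w t *+ (a == sigma t)) =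
  \sum_t star (w t) * w t.
Proof.
move=> sI; rewrite sum_supported; apply: eq_bigr => t _; congr (_ * _).
rewrite (bigD1 t)//= eqxx mulr1n big1 ?addr0// => s st.
by rewrite (inj_eq sI) eq_sym (negPf st) mulr0n.
Qed.

Lemma sum_supported_diag D r (T : finType) (sigma : T -> 'I_r) (w G : T -> D) (X : 'M[D]_r) :
  (forall s t, X (sigma s) (sigma t) = G s *+ (s == t)) ->
  \sum_a star (\sum_t w t *+ (a == sigma t)) *
     (\sum_b X a b * (\sum_t w t *+ (b == sigma t))) =
  \sum_t star (w t) * (G t * w t).
Proof.
move=> XG; rewrite sum_supported; apply: eq_bigr => t _; congr (_ * _).
under eq_bigr => b _ do rewrite mulr_sumr.
rewrite exchange_big /= (bigD1 t)//= [X in _ + X]big1 ?addr0; last first.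
  move=> s st; rewrite (bigD1 (sigma s))//= eqxx mulr1n XG eq_sym (negPf st) mulr0n mul0r.
  by rewrite add0r big1// => b /negPf ->; rewrite mulr0n mulr0.
rewrite (bigD1 (sigma t))//= eqxx mulr1n XG eqxx mulr1n big1 ?addr0//.
by move=> b /negPf ->; rewrite mulr0n mulr0.
Qed.

End Columns.

(** * The inductive system *)

Section System.
Variables (R : realType) (N : nat) (theta : R) (r0 r1 : nat).
Variables (l : 'I_2 -> 'I_2 -> nat -> nat).
Variables (A : cstarType R) (mu : forall n, sysA R N r0 r1 l n -> A).
Variable alpha : circle R -> A -> A.
Hypotheses (N_ge2 : (2 <= N)%N) (r1_gt0 : (0 < r1)%N).
Hypothesis l_gt0 : forall j k n, (0 < l j k n)%N.
Hypothesis lim : is_direct_limit (@sys_map R N theta r0 r1 l) mu.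
Hypothesis act : is_action alpha.
Hypothesis equivariant : forall n z a, alpha z (mu (n := n) a) = mu (sys_action z a).
Hypothesis l_le : forall n,
  [/\ (l 0%R 0%R n <= l 1%R 0%R n)%N, (l 0%R 0%R n <= l 0%R 1%R n)%N,
      (l 0%R 1%R n <= l 1%R 1%R n)%N & (l 1%R 0%R n <= l 1%R 1%R n)%N].

Local Notation Sys n := (sysA R N r0 r1 l n).
Local Notation rk0 n := (ranks N r0 r1 l n).1.
Local Notation rk1 n := (ranks N r0 r1 l n).2.
Let hn := cnorm_seminorm A.

Lemma sys_N_gt0 : (0 < N)%N. Proof. exact: ltnW. Qed.
Local Notation N_gt0 := sys_N_gt0.

Lemma sys_mapE n (a : Sys n) : sys_map theta a =
  step_map theta (l 0%R 0%R n) (l 0%R 1%R n) (l 1%R 0%R n) (l 1%R 1%R n) a.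
Proof. by []. Qed.

Lemma star_hom_sys_map n : star_hom (@sys_map R N theta r0 r1 l n).
Proof. exact: star_hom_step_map. Qed.

Lemma sys_map1 n : sys_map theta (1 : Sys n) = 1.
Proof. exact: step_map1. Qed.

Lemma rk1_gt0 n : (0 < rk1 n)%N.
Proof.
case: n => [//|n] /=; elim: n => [|n IH] /=;
  by rewrite addn_gt0 !muln_gt0 ?N_gt0 ?l_gt0 ?r1_gt0 ?IH ?orbT.
Qed.

Lemma rk1_double n : (2 * rk1 n <= rk1 n.+1)%N.
Proof.
rewrite /=; apply: leq_trans (leq_addl _ _); rewrite -mulnA leq_mul2l /=.
by rewrite mulnCA leq_pmulr// muln_gt0 N_gt0 l_gt0.
Qed.

Lemma rk1_large n : (n < rk1 n)%N.
Proof.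
elim: n => [|n IH]; first exact: rk1_gt0.
apply: leq_trans (rk1_double n); rewrite mul2n -addnn.
by apply: leq_trans (leq_add IH (rk1_gt0 n)); rewrite addn1.
Qed.

Lemma star_hom_mu n : star_hom (@mu n). Proof. exact: (limit_star_hom lim). Qed.

Lemma mu_sys_map n (a : Sys n) : mu (sys_map theta a) = mu a.
Proof. exact: (limit_compat lim). Qed.

Lemma mu1 n : mu (1 : Sys n) = 1.
Proof. exact: (limit1 lim sys_map1). Qed.

Lemma mu_dense a (e : R) : 0 < e ->
  exists n0, forall n, (n0 <= n)%N -> exists x : Sys n, cnorm (a - mu x) < e.
Proof. exact: (limit_dense lim sys_map1). Qed.

(** The evaluations at 1 of the C(S^1)-components give compatible bounded
    representations by larger and larger matrices. *)
Lemma limit_one_neq0 : (1 : A) <> 0.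
Proof.
pose X := @SnormFamily R (fun n => Sys n)
  (fun n => (fun c => opnorm (eval_mx 1%g c)) \o (fun a : Sys n => a.2))
  (fun n => cstar_seminorm_comp (star_hom_snd _ _) (eval_mx_seminorm (rk1 n) 1%g)).
pose nu n : sf_alg X n -> sf_alg X n.+1 := @sys_map R N theta r0 r1 l n.
have hnu n : star_hom (@nu n) by exact: star_hom_sys_map.
have bounded k y : coherent nu k y -> exists M, ev_bounded y M.
  move=> cy; have [M HM] := hom_bound_stage N_gt0 (y k : Sys k).
  exists M, k => n kn.
  have [f hf fy] : exists2 f : sf_alg X k -> sf_alg X n, star_hom f & f (y k) = y n.
    rewrite -(subnK kn); elim: (n - k)%N => [|j [f hf fy]].
      by exists id => //; exact: star_hom_id.
    exists (@nu (j + k)%N \o f); first exact: star_hom_comp hf (hnu _).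
    rewrite /comp fy; symmetry; exact: (cy _ (leq_addl _ _)).
  by rewrite -fy; exact: (HM _ _ f (@sf_seminorm _ X n) hf).
apply: (limit_nontrivial lim sys_map1 (star_hom_to_limsup hnu bounded)).
  by move=> n a; exact: (to_limsup_compat bounded).
rewrite (to_limsup1 (nu := nu) sys_map1 bounded).
apply: (@cls_one_neq0 _ X 1 ltr01) => n /=.
rewrite [eval_mx _ _](_ : _ = 1%:M); first exact: opnorm1 (rk1_gt0 n).
by apply/matrixP => i j; rewrite !mxE rmorph_nat.
Qed.

Lemma action_star_hom z : star_hom (alpha z). Proof. by case: act. Qed.

Lemma action1 z : alpha z 1 = 1.
Proof.
rewrite -(mu1 0) equivariant; congr mu; congr (_, _); apply/matrixP => i j.
  by rewrite !mxE (gamma_scal_nat N z).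
by rewrite !mxE translate_nat.
Qed.

Lemma fixed_star_subalgebra : star_subalgebra (fixed alpha).
Proof. exact: (fixed_subalgebra action_star_hom action1). Qed.

Definition sys_fixed n (a : Sys n) := forall z, sys_action z a = a.

Lemma mu_fixed n (a : Sys n) : sys_fixed a -> fixed alpha (mu a).
Proof. by move=> fa z; rewrite equivariant fa. Qed.

(** The unit p_n of the C(S^1)-component. *)
Definition proj n : A := mu ((0, 1) : Sys n).

Lemma mu_pair0 n (c : 'M[cfun R]_(rk1 n)) (a : Sys n) :
  mu a * mu ((0, c) : Sys n) = mu ((0, a.2 * c) : Sys n).
Proof. by rewrite -(star_homM (star_hom_mu n)); congr mu; congr (_, _); rewrite /= mulr0. Qed.

Lemma mu_pair0r n (c : 'M[cfun R]_(rk1 n)) (a : Sys n) :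
  mu ((0, c) : Sys n) * mu a = mu ((0, c * a.2) : Sys n).
Proof. by rewrite -(star_homM (star_hom_mu n)); congr mu; congr (_, _); rewrite /= mul0r. Qed.

Lemma proj_mul n (a : Sys n) : proj n * mu a = mu ((0, a.2) : Sys n).
Proof. by rewrite /proj mu_pair0r mul1r. Qed.

Lemma mul_proj n (a : Sys n) : mu a * proj n = mu ((0, a.2) : Sys n).
Proof. by rewrite /proj mu_pair0 mulr1. Qed.

Lemma projC n (a : Sys n) : proj n * mu a = mu a * proj n.
Proof. by rewrite proj_mul mul_proj. Qed.

Lemma is_projection_proj n : is_projection (proj n).
Proof.
split; last by rewrite /proj mu_pair0 mulr1.
rewrite /proj -(star_homS (star_hom_mu n)); congr mu; congr (_, _); rewrite /=.
  by rewrite star0.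
by rewrite star1.
Qed.

Lemma proj_fixed n : fixed alpha (proj n).
Proof.
apply: mu_fixed => z; congr (_, _); apply/matrixP => i j; rewrite !mxE.
  exact: star_hom0 (star_hom_gamma N z).
by rewrite translate_nat.
Qed.

Lemma one_sub_proj n : 1 - proj n = mu ((1, 0) : Sys n).
Proof.
rewrite -(mu1 n) /proj -(star_homB (star_hom_mu n)); congr mu; congr (_, _); rewrite /=.
  by rewrite subr0.
by rewrite subrr.
Qed.

Lemma projC_sys n (a : Sys n) : proj n.+1 * mu a = mu a * proj n.+1.
Proof. by rewrite -(mu_sys_map a) projC. Qed.

(** The first step provides the inclusion sub_mx needed as the isometry J of
    transfer_isometry in the second step; hence s lives in A_{n+2}, exchanges
    parts of the image of A_{n+1}, and commutes with the image of A_n. *)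
Lemma sys_swap n : exists s : A, [/\ fixed alpha s, star s * s = 1 - proj n.+1,
  proj n.+1 * s = s & forall a : Sys n, s * mu a = mu a * s].
Proof.
have [h1 _ h3 _] := l_le n; have [_ h2 _ h4] := l_le n.+1.
pose J := sub_mx R N_gt0 (rk0 n) (rk1 n) h1 h3.
have JJ : adj J *m J = 1%:M by exact: adj_sub_mx.
have Jfix z : map_mx (translate z) J = J.
  by rewrite /J (map_inj_mx _ (star_hom_translate z))// translate1.
have [s [sfix ss ps sa]] := @transfer_isometry R N theta N_gt0 (rk0 n.+1) (rk1 n.+1)
  _ _ _ _ h2 h4 J JJ Jfix.
exists (mu (s : Sys n.+2)); split.
- exact: mu_fixed.
- rewrite one_sub_proj -(mu_sys_map ((1, 0) : Sys n.+1)) sys_mapE -ss.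
  by rewrite (star_homM (star_hom_mu n.+2)) (star_homS (star_hom_mu n.+2)).
- by rewrite /proj -(mu_sys_map ((0, 1) : Sys n.+1)) sys_mapE -(star_homM (star_hom_mu n.+2)) ps.
- move=> a; rewrite -(mu_sys_map a) -(mu_sys_map (sys_map theta a)).
  rewrite -!(star_homM (star_hom_mu n.+2)); congr mu.
  have := sa (sys_map theta a).1 (sys_map theta a).2 (sub_mx_intertwine theta N_gt0 h1 h3 a).
  rewrite -surjective_pairing => E; symmetry; exact: E.
Qed.

(** s compresses the C(S^1)-component of mu a to its R-component. *)
Lemma cnorm_sys n (a : Sys n) :
  cnorm (mu a) <= cnorm (mu ((0, (sys_map theta a).2) : Sys n.+1)).
Proof.
have [s [_ ss ps sC]] := sys_swap n.
rewrite -proj_mul mu_sys_map.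
apply: (cnorm_corner (is_projection_proj n.+1) ss ps) => //.
- exact: projC_sys.
- by rewrite -(star_homS (star_hom_mu n)) projC_sys.
- by rewrite -(star_homS (star_hom_mu n)) sC.
Qed.

(** ** Comparison by ranks *)

Definition unit_at n (i : 'I_(rk1 n)) : A := mu ((0, delta_mx i i) : Sys n).

Hypothesis r01 : (r0 <= r1)%N.
Hypothesis lim0 : ((l 0 1 n)%:R / (l 0 0 n)%:R : R) @[n --> \oo] --> +oo.
Hypothesis lim1 : ((l 1 1 n)%:R / (l 1 0 n)%:R : R) @[n --> \oo] --> +oo.

Lemma rk0_le_rk1 n : (rk0 n <= rk1 n)%N.
Proof.
elim: n => [//|n IH] /=; have [h1 h2 h3 h4] := l_le n; apply: leq_add.
  apply: (@leq_trans (rk0 n * l 1%R 0%R n)); first by rewrite leq_mul2l h1 orbT.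
  by rewrite leq_pmulr// N_gt0.
apply: (@leq_trans (rk1 n * l 1%R 1%R n)); first by rewrite leq_mul2l h3 orbT.
by rewrite leq_pmull// muln_gt0 N_gt0.
Qed.

(** The ranks of the image of a rank one projection satisfy the recursion of
    the sizes, so they stay within a constant factor of the sizes. *)
Lemma unit_at_rank m (i : 'I_(rk1 m)) : exists C, forall n, (m < n)%N ->
  exists (X : Sys n) (k0 k1 : nat), [/\ mu X = unit_at i, diag_rank X.1 k0,
    diag_rank X.2 k1, (rk0 n <= C * k0)%N & (rk1 n <= C * k1)%N].
Proof.
have [C CE] : exists C, C = (rk0 m.+1 + rk1 m.+1)%N by eexists.
exists C => n mn; rewrite -(subnK mn).
elim: (n - m.+1)%N => [|j [X [k0 [k1 [XE X0 X1 h0 h1]]]]].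
  exists (sys_map theta ((0, delta_mx i i) : Sys m)), (0 * l 0%R 0%R m + 1 * l 0%R 1%R m)%N,
    (0 * l 1%R 0%R m * N + 2 * N * (1 * l 1%R 1%R m))%N.
  have [h1 h2] := @diag_rank_step_map R N theta (rk0 m) (rk1 m) (l 0%R 0%R m) (l 0%R 1%R m)
    (l 1%R 0%R m) (l 1%R 1%R m) (0, delta_mx i i) 0 1 (@diag_rank0 _ _ _) (diag_rank_delta _ _).
  split.
  - exact: mu_sys_map.
  - exact: h1.
  - exact: h2.
  - rewrite CE add0n mul0n mul1n add0n; apply: leq_trans (leq_addr (rk1 m.+1) _) _.
    by rewrite leq_pmulr.
  - rewrite CE add0n mul0n mul1n add0n; apply: leq_trans (leq_addl (rk0 m.+1) _) _.
    by rewrite leq_pmulr// !muln_gt0 N_gt0 l_gt0.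
have [d1 d2] := @diag_rank_step_map R N theta _ _ (l 0%R 0%R (j + m.+1)) (l 0%R 1%R (j + m.+1))
    (l 1%R 0%R (j + m.+1)) (l 1%R 1%R (j + m.+1)) X k0 k1 X0 X1.
exists (sys_map theta X); do 2 eexists; split; [|exact: d1|exact: d2| |].
- by rewrite -XE; exact: mu_sys_map.
- rewrite addSn /= mulnDr !mulnA; apply: leq_add; rewrite leq_mul2r; apply/orP; right.
    exact: h0.
  exact: h1.
- rewrite addSn [leqLHS]/= mulnDr; apply: leq_add.
    by rewrite !mulnA !leq_mul2r h0 !orbT.
  rewrite [leqRHS]mulnCA leq_mul2l; apply/orP; right.
  by rewrite mulnA leq_mul2r h1 orbT.
Qed.

Lemma ratio_large (f g : nat -> nat) C : (forall n, (0 < g n)%N) ->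
  (((f n)%:R / (g n)%:R : R) @[n --> \oo] --> +oo) ->
  exists n0, forall n, (n0 <= n)%N -> (C * g n <= f n)%N.
Proof.
move=> g0 /cvgryPge/(_ C%:R)[n0 _ H]; exists n0 => n /H /=.
by rewrite ler_pdivlMr ?ltr0n// -natrM ler_nat.
Qed.

(** The image of unit_at i has at least the rank of 1 - p_n in both components
    of A_{n+1}, as soon as the quotients of multiplicities exceed C. *)
Lemma one_sub_proj_compare m (i : 'I_(rk1 m)) : exists n0, forall n, (n0 <= n)%N ->
  exists2 w, fixed alpha w & w * unit_at i * star w = 1 - proj n.
Proof.
have [C HC] := unit_at_rank i.
have [n0 H0] := ratio_large C (fun n => l_gt0 _ _ n) lim0.
have [n1 H1] := ratio_large C (fun n => l_gt0 _ _ n) lim1.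
exists (maxn m.+1 (maxn n0 n1)) => n; rewrite !geq_max => /andP[mn /andP[n0n n1n]].
have [X [k0 [k1 [XE X0 X1 h0 h1]]]] := HC n mn.
have [d1 d2] := @diag_rank_step_map R N theta _ _ (l 0%R 0%R n) (l 0%R 1%R n)
    (l 1%R 0%R n) (l 1%R 1%R n) X k0 k1 X0 X1.
have rC : (rk0 n <= C * k1)%N := leq_trans (rk0_le_rk1 n) h1.
have [||w wfix wE] := @step_map_compress R N theta (rk0 n) (rk1 n) (l 0%R 0%R n) (l 0%R 1%R n)
    (l 1%R 0%R n) (l 1%R 1%R n) (sys_map theta X).
- apply: diag_rankS d1; apply: leq_trans (leq_addl _ _).
  apply: (@leq_trans (C * k1 * l 0%R 0%R n)); first by rewrite leq_mul2r rC orbT.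
  by rewrite -[leqLHS]mulnA [leqLHS]mulnCA leq_mul2l H0 ?orbT.
- apply: diag_rankS d2; apply: leq_trans (leq_addl _ _).
  apply: (@leq_trans (C * k1 * l 1%R 0%R n * N)); first by rewrite !leq_mul2r rC !orbT.
  rewrite [leqRHS]mulnAC leq_mul2r; apply/orP; right.
  apply: (@leq_trans (k1 * l 1%R 1%R n)); last by rewrite leq_pmull.
  by rewrite -[leqLHS]mulnA [leqLHS]mulnCA leq_mul2l H1 ?orbT.
exists (mu (w : Sys n.+1)); first exact: mu_fixed.
rewrite -XE -(mu_sys_map X) -(star_homS (star_hom_mu n.+1)) -!(star_homM (star_hom_mu n.+1)).
by rewrite one_sub_proj -(mu_sys_map ((1, 0) : Sys n)); congr mu.
Qed.

(** ** Compressions to rank one *)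

Hypothesis irr : irrational theta.

Definition mu_c n (c : 'M[cfun R]_(rk1 n)) : A := mu ((0, c) : Sys n).

Lemma star_hom_mu_c n : star_hom (@mu_c n).
Proof. exact: (star_hom_comp (@star_hom_inr R N _ (rk1 n)) (star_hom_mu n)). Qed.

Lemma cnorm_mu_c n (c : 'M[cfun R]_(rk1 n)) M : hom_bound c M -> cnorm (mu_c c) <= M.
Proof. by move=> /(_ A _ _ hn (star_hom_mu_c n)). Qed.

Lemma cnorm_mu_c_delta n (i : 'I_(rk1 n)) f M : (forall z, cmod (ceval z f) <= M) ->
  cnorm (mu_c (f *: delta_mx i i)) <= M.
Proof.
move=> fM; apply: cnorm_mu_c; apply: (hom_bound_map (star_hom_corner _ i)).
exact: hom_bound_cfun.
Qed.

Lemma proj_mu_c n (c : 'M[cfun R]_(rk1 n)) : proj n * mu_c c = mu_c c.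
Proof. by rewrite /mu_c proj_mul. Qed.

Lemma cnorm_star_mul_sub (e f : A) :
  cnorm (star e * e - star f * f) <= cnorm (e - f) * (cnorm e + cnorm f).
Proof.
have -> : star e * e - star f * f = star (e - f) * e + star f * (e - f).
  by rewrite starB mulrBl mulrBr addrA subrK.
apply: le_trans (snormD hn _ _) _; rewrite [leRHS]mulrDr; apply: lerD.
  by rewrite -(snorm_star hn (e - f)) (snormM hn).
by rewrite mulrC -(snorm_star hn f) (snormM hn).
Qed.

Lemma cnorm_conj_le (v y : A) : cnorm (star v * y * v) <= cnorm v ^+ 2 * cnorm y.
Proof.
apply: le_trans (snormM hn _ _) _; rewrite expr2 mulrAC.
rewrite ler_wpM2r ?(snorm_ge0 hn)//; apply: le_trans (snormM hn _ _) _.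
by rewrite (snorm_star hn).
Qed.

(** Otherwise all operator norms of the c(z) were at most M, which would bound
    the image of c by M. *)
Lemma almost_norming_vector n (c : 'M[cfun R]_(rk1 n)) M : 0 <= M -> M < cnorm (mu_c c) ->
  exists z0 (eta : 'cV[R[i]]_(rk1 n)), vnorm eta = 1 /\ M < vnorm (eval_mx z0 c *m eta).
Proof.
move=> M0 Mc; apply: contrapT => H.
have : forall z, opnorm (eval_mx z c) <= M.
  move=> z; apply: opnorm_le => // v; rewrite leNgt; apply/negP => vM.
  have v0 : 0 < vnorm v.
    rewrite lt_neqAle vnorm_ge0 andbT eq_sym; apply/eqP => v0; move: vM.
    by have := opnormP (eval_mx z c) v; rewrite v0 !mulr0 => h1 h2; lra.
  apply: H; exists z, ((vnorm v)^-1%:C *: v); rewrite -scalemxAr !vnormZ cmodR.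
  rewrite gtr0_norm ?invr_gt0// mulVf ?gt_eqF//; split=> //.
  by rewrite mulrC ltr_pdivlMr.
move=> /(hom_bound_opnorm M0)/cnorm_mu_c; by rewrite leNgt Mc.
Qed.

Definition vec_col n (i0 : 'I_(rk1 n)) (eta : 'cV[R[i]]_(rk1 n)) : 'M[cfun R]_(rk1 n) :=
  col_at i0 (fun i => scal (eta i 0)).

(** |c eta|^2 as a function on the circle. *)
Definition vec_sqr n (c : 'M[cfun R]_(rk1 n)) (eta : 'cV[R[i]]_(rk1 n)) : cfun R :=
  \sum_i star (\sum_j c i j * scal (eta j 0)) * (\sum_j c i j * scal (eta j 0)).

Lemma ceval_vec_sqr n (c : 'M[cfun R]_(rk1 n)) eta z :
  ceval z (vec_sqr c eta) = (vnorm (eval_mx z c *m eta) ^+ 2)%:C.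
Proof.
rewrite vnorm_sqr rmorph_sum /= /vec_sqr rmorph_sum /=; apply: eq_bigr => i _.
rewrite cevalM ceval_star conj_mul; congr ((cmod _ ^+ 2)%:C).
rewrite rmorph_sum mxE; apply: eq_bigr => j _ /=.
by rewrite cevalM ceval_scal eval_mxE.
Qed.

Lemma vec_col_compress n i0 (c : 'M[cfun R]_(rk1 n)) eta :
  star (mu_c (vec_col i0 eta)) * (star (mu_c c) * mu_c c) * mu_c (vec_col i0 eta) =
  mu_c (vec_sqr c eta *: delta_mx i0 i0).
Proof.
rewrite -mulrA -[star (mu_c c) * _ * _]mulrA mulrA -starM.
rewrite -!(star_homM (star_hom_mu_c n)) -(star_homS (star_hom_mu_c n)) -(star_homM (star_hom_mu_c n)).
by rewrite mul_col_at star_col_at_mul.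
Qed.

Lemma cnorm_vec_col n i0 (eta : 'cV[R[i]]_(rk1 n)) : vnorm eta = 1 ->
  cnorm (mu_c (vec_col i0 eta)) <= 1.
Proof.
move=> eta1; rewrite -(@ler_pXn2r _ 2) ?nnegrE ?(snorm_ge0 hn)// expr1n -(snorm_star_mul hn).
rewrite -(star_homS (star_hom_mu_c n)) -(star_homM (star_hom_mu_c n)) star_col_at_mul.
apply: cnorm_mu_c_delta => z; rewrite rmorph_sum /=.
under eq_bigr do rewrite cevalM ceval_star ceval_scal conj_mul.
by rewrite -rmorph_sum -vnorm_sqr eta1 cmodR expr1n normr1.
Qed.

(** The compression of c^* c by the constant column eta is the function
    |c eta|^2, and e^* e is close to c^* c. *)
Lemma near_vector n i0 (c : 'M[cfun R]_(rk1 n)) (e : A) : cnorm e <= 1 ->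
  cnorm (e - mu_c c) <= 2 / 100 -> 95 / 100 < cnorm (mu_c c) ->
  exists z0 eta, [/\ vnorm eta = 1, 90 / 100 < cmod (ceval z0 (vec_sqr c eta)) &
    cnorm (star (mu_c (vec_col i0 eta)) * (star e * e) * mu_c (vec_col i0 eta) -
           mu_c (vec_sqr c eta *: delta_mx i0 i0)) <= 5 / 100].
Proof.
move=> e1 ec c95; have M0 : 0 <= 95 / 100 :> R by lra.
have [z0 [eta [eta1 h]]] := almost_norming_vector M0 c95.
exists z0, eta; split=> //.
  rewrite ceval_vec_sqr cmodR ger0_norm ?sqr_ge0//.
  apply: (@lt_trans _ _ ((95 / 100) ^+ 2)); first by rewrite expr2; lra.
  by rewrite ltr_pXn2r ?nnegrE ?vnorm_ge0//; lra.
rewrite -vec_col_compress -mulrBl -mulrBr; apply: le_trans (cnorm_conj_le _ _) _.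
have v1 := cnorm_vec_col i0 eta1; set v := cnorm _ in v1 *.
have v0 : 0 <= v by exact: snorm_ge0 hn _.
have := cnorm_star_mul_sub e (mu_c c); set y := cnorm (star e * e - _).
have y0 : 0 <= y by exact: snorm_ge0 hn _.
have c1 : cnorm (mu_c c) <= 102 / 100.
  by have := snorm_tri hn e (mu_c c) 0; rewrite !subr0 (snorm_dist hn); lra.
have d0 := snorm_ge0 hn (e - mu_c c).
have : cnorm (e - mu_c c) * (cnorm e + cnorm (mu_c c)) <= 2 / 100 * (202 / 100).
  by apply: ler_pM => //; [rewrite addr_ge0 ?(snorm_ge0 hn)|lra].
have : v ^+ 2 * y <= y by rewrite ler_piMl// exprn_ile1.
by lra.
Qed.


(** The positions of the angles 0 and theta among the 2N angles. *)
Lemma ang_lt (b : bool) : ((if b then N else 0) < 2 * N)%N.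
Proof. by case: b; rewrite ?muln_gt0 ?N_gt0// mul2n -addnn -[X in (X < _)%N]addn0 ltn_add2l N_gt0. Qed.

Lemma cis_ang (b : bool) : cis (rotation_angle theta (Ordinal (ang_lt b))) =
  if b then cis theta else 1%g.
Proof.
rewrite /rotation_angle; case: b => /=; last by rewrite N_gt0 mul0r cis0.
by rewrite ltnn subnn mul0r addr0.
Qed.

(** Each step produces, from every diagonal entry, a copy of it and a copy
    rotated by theta; after k steps all rotations by j theta with j <= k are
    present. *)
Lemma rotated_summands n (i0 : 'I_(rk1 n)) (g : cfun R) k :
  exists (X : Sys (k + n)) (T : finType) (sigma : T -> 'I_(rk1 (k + n))) (G : T -> cfun R),
  [/\ mu X = mu_c (g *: delta_mx i0 i0), injective sigma,
      forall s t, X.2 (sigma s) (sigma t) = G s *+ (s == t),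
      forall t, exists w, G t = translate w g &
      forall j, (j <= k)%N -> exists t, G t = translate (cis (j%:R * theta)) g].
Proof.
elim: k => [|k [X [T [sigma [G [XE sI XG Gw Gj]]]]]].
  exists (0, g *: delta_mx i0 i0), unit, (fun=> i0), (fun=> g); split.
  - by [].
  - by move=> [] [].
  - by move=> [] []; rewrite scale_deltaE !eqxx.
  - by move=> _; exists 1%g; rewrite translate_id.
  - by move=> j; rewrite leqn0 => /eqP ->; exists tt; rewrite mul0r cis0 translate_id.
pose c0 := Ordinal (l_gt0 1%R 1%R (k + n)).
exists (sys_map theta X), (bool * T)%type,
  (fun u => rshift _ (mxtens_index (Ordinal (ang_lt u.1), mxtens_index (sigma u.2, c0)))),
  (fun u => translate (if u.1 then cis theta else 1%g) (G u.2)).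
split.
- by rewrite -XE; exact: mu_sys_map.
- move=> [b s] [b' t] /rshift_inj/mxtens_index_inj[/(congr1 val)/= bb].
  move=> /mxtens_index_inj[/sI -> _]; congr (_, _).
  by move: bb N_gt0; case: b; case: b' => //; lia.
- move=> [b s] [b' t] /=.
  rewrite block_mxEdr block_diagE amplifyE eqxx mulr1n XG cis_ang.
  have -> : (Ordinal (ang_lt b) == Ordinal (ang_lt b')) = (b == b').
    rewrite -val_eqE /=; move: N_gt0.
    by case: b; case: b' => //= N0; rewrite ?eqxx// ?[(0 == _)%N]eq_sym gtn_eqF.
  by rewrite (star_homMn (star_hom_translate _)) -mulrnA mulnb xpair_eqE [in RHS]andbC.
- by move=> [b t] /=; have [w ->] := Gw t; eexists; rewrite -translateM.
- move=> j; rewrite leq_eqVlt => /predU1P[->|]; last first.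
    rewrite ltnS => /Gj[t tE]; exists (false, t) => /=; by rewrite translate_id.
  have [t tE] := Gj k (leqnn k); exists (true, t) => /=.
  by rewrite tE -translateM -cisD -nat1r mulrDl mul1r.
Qed.

Lemma vec_sqr_real n (c : 'M[cfun R]_(rk1 n)) eta z :
  ceval z (vec_sqr c eta) = (cmod (ceval z (vec_sqr c eta)))%:C.
Proof. by rewrite ceval_vec_sqr cmodR ger0_norm// sqr_ge0. Qed.

Lemma unit_atE n (i : 'I_(rk1 n)) : unit_at i = mu_c (1 *: delta_mx i i).
Proof. by rewrite /unit_at /mu_c scale1r. Qed.

Lemma mu_c_close n (c d : 'M[cfun R]_(rk1 n)) e :
  (forall i j z, cmod (ceval z (c i j) - ceval z (d i j)) <= e / (rk1 n * rk1 n)%:R) ->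
  cnorm (mu_c c - mu_c d) <= e.
Proof.
move=> cd; have rp : 0 < (rk1 n * rk1 n)%:R :> R by rewrite ltr0n muln_gt0 rk1_gt0.
rewrite -(star_homB (star_hom_mu_c n)).
apply: le_trans (cnorm_mu_c (@hom_bound_cfun_mx _ _ _ (fun _ _ => e / (rk1 n * rk1 n)%:R) _)) _.
  by move=> i j z; rewrite !mxE; exact: cd.
by rewrite !sumr_const !card_ord -mulrnA -[X in X <= _]mulr_natr divfK ?gt_eqF.
Qed.

Lemma compress_mul_proj n (c : 'M[cfun R]_(rk1 n)) (d : A) :
  star (mu_c c) * (star d * d) * mu_c c =
  star (mu_c c) * (star (d * proj n) * (d * proj n)) * mu_c c.
Proof.
have E x : star (mu_c c) * (star x * x) * mu_c c = star (x * mu_c c) * (x * mu_c c).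
  by rewrite starM !mulrA.
by rewrite !E -[d * proj n * _]mulrA proj_mu_c.
Qed.

Lemma cnorm_mul_proj_le n a : cnorm (a * proj n) <= cnorm a.
Proof.
apply: le_trans (snormM hn _ _) _; rewrite ler_piMr ?(snorm_ge0 hn)//.
exact: snorm_proj hn _ (is_projection_proj n).
Qed.

Lemma cnorm_dist_ge (a b : A) : cnorm a - cnorm (a - b) <= cnorm b.
Proof. by have := snormD hn (a - b) b; rewrite subrK; lra. Qed.

(** By density and cnorm_sys.  The numerical errors below only have to add up to
    less than 1 in the end. *)
Lemma approx_in_component d : cnorm d = 1 -> exists n (c : 'M[cfun R]_(rk1 n.+1)),
  cnorm (d * proj n.+1 - mu_c c) <= 1 / 100 /\ 99 / 100 <= cnorm (mu_c c).
Proof.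
move=> d1; have e0 : 0 < 1 / 100 :> R by lra.
have [n0 /(_ n0 (leqnn n0))[a da]] := mu_dense d e0.
exists n0, (sys_map theta a).2; split.
  have -> : mu_c (sys_map theta a).2 = mu a * proj n0.+1 by rewrite -(mu_sys_map a) mul_proj.
  by rewrite -mulrBl; apply: le_trans (cnorm_mul_proj_le _ _) (ltW da).
apply: le_trans (cnorm_sys a); have := cnorm_dist_ge d (mu a); rewrite d1; lra.
Qed.

(** A constant column compresses d^* d to a function which is large at a point
    (near_vector); its rotations by multiples of theta, which appear after some
    steps on the diagonal, are large everywhere together (orbit_cover), so they
    are compressed to 1 by exists_weights. *)
Lemma compress_to_unit d : cnorm d = 1 -> exists m (i : 'I_(rk1 m.+1)) v,
  cnorm (v * (star d * d) * star v - unit_at i) < 1.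
Proof.
move=> d1; have [n' [c [dc c99]]] := approx_in_component d1.
set n := n'.+1 in c dc c99; have i0 := Ordinal (rk1_gt0 n).
have e1 : cnorm (d * proj n) <= 1 by rewrite -d1 cnorm_mul_proj_le.
have [||z0 [eta [eta1 gz0 gV]]] := near_vector i0 e1 (c := c); [lra|lra|].
set V := mu_c (vec_col i0 eta) in gV; set g := vec_sqr c eta in gz0 gV.
(* V compresses d^* d to g in the corner i0, up to 5/100. *)
have [k kcover] : exists k, forall z, exists2 j : nat, (j <= k)%N &
    90 / 100 < complex.Re (ceval z (translate (cis (j%:R * theta)) g)).
  by apply: orbit_cover irr _; exists z0; rewrite vec_sqr_real.
have [X [T [sigma [G [XE sI XG Gw Gj]]]]] := rotated_summands i0 g k.
have Greal t z : ceval z (G t) = (cmod (ceval z (G t)))%:C.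
  by have [w ->] := Gw t; rewrite ceval_translate; exact: vec_sqr_real.
have tau0 : 0 < 90 / 100 :> R by lra.
have Gcover z : exists t, 90 / 100 < cmod (ceval z (G t)).
  have [j /Gj[t tE] jz] := kcover z; exists t.
  have E : complex.Re (ceval z (G t)) = cmod (ceval z (G t)) by rewrite {1}Greal.
  by rewrite -E tE.
have [w [wG ww]] := exists_weights tau0 Greal Gcover.
have i1 := Ordinal (rk1_gt0 (k + n)).
(* U compresses the image of g exactly to 1, and |U|^2 <= 100/90. *)
set u := fun a : 'I_(rk1 (k + n)) => \sum_t w t *+ (a == sigma t).
pose U := mu_c (col_at i1 u).
have UU : cnorm U ^+ 2 <= (90 / 100)^-1.
  rewrite -(snorm_star_mul hn) /U -(star_homS (star_hom_mu_c _)) -(star_homM (star_hom_mu_c _)).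
  rewrite star_col_at_mul sum_supported_self//; exact: cnorm_mu_c_delta.
have UXU : star U * mu_c (g *: delta_mx i0 i0) * U = unit_at i1.
  rewrite -XE -mulrA /U [mu X * _]mu_pair0 -(star_homS (star_hom_mu_c _)).
  rewrite -[mu (0, _)]/(mu_c _) -(star_homM (star_hom_mu_c _)) mul_col_at star_col_at_mul.
  by rewrite (sum_supported_diag _ XG) wG unit_atE.
have kn : (k + n)%N = (k + n').+1 by rewrite /n addnS.
suff : exists v, cnorm (v * (star d * d) * star v - unit_at i1) < 1.
  by move: i1 {u U UU UXU}; rewrite kn => i1 [v vP]; exists (k + n')%N, i1, v.
exists (star (V * U)).
have -> : star (V * U) * (star d * d) * star (star (V * U)) =
    star U * (star V * (star (d * proj n) * (d * proj n)) * V) * U.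
  by rewrite -compress_mul_proj starK starM !mulrA.
rewrite -UXU -mulrBl -mulrBr; apply: le_lt_trans (cnorm_conj_le _ _) _.
apply: (@le_lt_trans _ _ ((90 / 100)^-1 * (5 / 100))); last by lra.
by apply: ler_pM => //; rewrite ?sqr_ge0 ?(snorm_ge0 hn).
Qed.

Lemma mu_c_const_fixed n (c : 'M[R[i]]_(rk1 n)) : fixed alpha (mu_c (map_mx (fun x => scal x) c)).
Proof.
apply: mu_fixed => z; congr (_, _); apply/matrixP => i j; rewrite !mxE.
  exact: star_hom0 (star_hom_gamma N z).
by apply: cfunP.
Qed.

Lemma alpha_mu_c n (c : 'M[cfun R]_(rk1 n)) z :
  alpha z (mu_c c) = mu_c (map_mx (translate z) c).
Proof.
rewrite /mu_c equivariant; congr mu; congr (_, _); apply/matrixP => i j; rewrite !mxE.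
exact: star_hom0 (star_hom_gamma N z).
Qed.

Lemma mu_c_avg n (c : 'M[cfun R]_(rk1 n)) k : mu_c (map_mx (circle_avg k) c) =
  scal (k%:R^-1)%:C * \sum_(j < k) alpha (omega R k ^+ j)%g (mu_c c).
Proof.
under eq_bigr do rewrite alpha_mu_c.
rewrite -(star_hom_sum (star_hom_mu_c n)) -(star_homZ (star_hom_mu_c n)); congr mu_c.
apply/matrixP => i j; rewrite mx_scalME !mxE summxE; congr (_ * _).
by apply: eq_bigr => m _; rewrite mxE.
Qed.

Lemma cnorm_avg_le k (a b : A) (e : R) : (0 < k)%N -> fixed alpha a -> cnorm (a - b) <= e ->
  cnorm (a - scal (k%:R^-1)%:C * \sum_(j < k) alpha (omega R k ^+ j)%g b) <= e.
Proof.
move=> k0 fa ab; have kp : 0 < k%:R :> R by rewrite ltr0n.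
have {1}-> : a = scal (k%:R^-1)%:C * \sum_(j < k) alpha (omega R k ^+ j)%g a.
  under eq_bigr do rewrite fa.
  rewrite sumr_const card_ord -[X in _ = _ * X]mulr_natl -(scal_nat A k) mulrA -scalM.
  by rewrite -(rmorph_nat (real_complex R) k) -rmorphM mulVf ?gt_eqF// scal1 mul1r.
rewrite -mulrBr -sumrB (snormZ hn) cmodR gtr0_norm ?invr_gt0// ler_pdivrMl//.
apply: le_trans (snorm_sum hn _ _ _) _.
have -> : k%:R * e = \sum_(j < k) e by rewrite sumr_const card_ord mulr_natl.
apply: ler_sum => j _; rewrite -(star_homB (action_star_hom _)).
exact: le_trans (star_hom_cnorm_le _ (action_star_hom _)) ab.
Qed.

(** The approximant of the fixed element d p_n is averaged over roots of unity,
    which makes its entries almost constant, and then replaced by the matrix c2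
    of constants.  The function |c2 eta|^2 is a constant t > 0, so that a scalar
    normalises it and no rotations are needed. *)
Lemma fixed_compress_to_unit d : cnorm d = 1 -> fixed alpha d ->
  exists m (i : 'I_(rk1 m)) v, fixed alpha v /\
  cnorm (v * (star d * d) * star v - unit_at i) < 1.
Proof.
move=> d1 fd; have [n' [c [dc c99]]] := approx_in_component d1.
set n := n'.+1 in c dc c99.
have i0 := Ordinal (rk1_gt0 n).
have e1 : cnorm (d * proj n) <= 1 by rewrite -d1 cnorm_mul_proj_le.
have fe : fixed alpha (d * proj n).
  by have [_ _ BM _ _] := fixed_star_subalgebra; apply: BM => //; exact: proj_fixed.
have rp : 0 < (rk1 n * rk1 n)%:R :> R by rewrite ltr0n muln_gt0 rk1_gt0.
have eps0 : 0 < 1 / 100 / (rk1 n * rk1 n)%:R :> R by rewrite !divr_gt0.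
have /choice[K HK] (ij : 'I_(rk1 n) * 'I_(rk1 n)) : exists K, forall k, (K <= k)%N -> (0 < k)%N ->
    forall z, cmod (ceval z (circle_avg k (c ij.1 ij.2)) -
      ceval 1%g (circle_avg k (c ij.1 ij.2))) <= 1 / 100 / (rk1 n * rk1 n)%:R.
  exact: circle_avg_const.
(* One k for all entries. *)
pose k := (\sum_ij K ij).+1.
have Kk ij : (K ij <= k)%N by rewrite /k (bigD1 ij)//= leqW// leq_addr.
pose c0 := map_mx (fun f => ceval 1%g (circle_avg k f)) c.
pose c2 : 'M[cfun R]_(rk1 n) := map_mx (fun x => scal x) c0.
have avg_c2 : cnorm (mu_c (map_mx (circle_avg k) c) - mu_c c2) <= 1 / 100.
  by apply: mu_c_close => i j z; rewrite !mxE; exact: (HK (i, j) k (Kk _) (ltn0Sn _) z).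
have d_avg := cnorm_avg_le (ltn0Sn _ : (0 < k)%N) fe dc.
rewrite -mu_c_avg in d_avg.
have ec : cnorm (d * proj n - mu_c c2) <= 2 / 100.
  by have := snorm_tri hn (mu_c (map_mx (circle_avg k) c)) (d * proj n) (mu_c c2); lra.
have c295 : 95 / 100 < cnorm (mu_c c2).
  have := cnorm_dist_ge (mu_c c) (mu_c c2).
  by have := snorm_tri hn (d * proj n) (mu_c c) (mu_c c2); rewrite (snorm_dist hn (mu_c c) (d * _)); lra.
have [z0 [eta [eta1 gz0 gV]]] := near_vector i0 e1 ec c295.
set V := mu_c (vec_col i0 eta) in gV; set g := vec_sqr c2 eta in gz0 gV.
set t := cmod _ in gz0.
have gE : g = scal t%:C.
  apply: cfunP => z; rewrite ceval_scal /t -vec_sqr_real !ceval_vec_sqr.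
  by congr ((vnorm (_ *m _) ^+ 2)%:C); apply/matrixP => i j; rewrite !eval_mxE !mxE.
have t0 : 0 < t by lra.
pose s := Num.sqrt t^-1; have ss : s * s = t^-1 by rewrite -expr2 sqr_sqrtr// invr_ge0 ltW.
have Vfix : fixed alpha V.
  rewrite /V (_ : vec_col i0 eta = map_mx (fun x => scal x) (\matrix_(i, j) (eta i 0 *+ (j == i0)))).
    exact: mu_c_const_fixed.
  apply/matrixP => i j; rewrite !mxE; case: eqP => _; rewrite ?mulr1n// !mulr0n.
  by rewrite scal0.
have [_ _ BM Bc Bs] := fixed_star_subalgebra.
exists n, i0, (scal s%:C * star V); split.
  by apply: (BM _ _ (Bc _)); exact: Bs.
have -> : scal s%:C * star V * (star d * d) * star (scal s%:C * star V) =
    scal (t^-1)%:C * (star V * (star (d * proj n) * (d * proj n)) * V).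
  rewrite -compress_mul_proj starM starK star_scal_real -ss rmorphM scalM -!mulrA.
  by congr (_ * _); rewrite [RHS]scalC !mulrA.
have -> : unit_at i0 = scal (t^-1)%:C * mu_c (g *: delta_mx i0 i0).
  rewrite -(star_homZ (star_hom_mu_c n)) unit_atE; congr mu_c; apply/matrixP => i j.
  rewrite mx_scalME !scale_deltaE gE mulrnAr -scalM -rmorphM (mulVf (lt0r_neq0 t0)).
  by rewrite (_ : scal _ = 1)//; exact: scal1.
rewrite -mulrBr (snormZ hn) cmodR gtr0_norm ?invr_gt0// mulrC ltr_pdivrMr// mul1r.
by apply: le_lt_trans gV _; lra.
Qed.

(** * The Rokhlin data *)

Lemma finite_eventually (T : eqType) (F : set T) (P : T -> nat -> Prop) : finite_set F ->
  (forall a, F a -> exists n0, forall n, (n0 <= n)%N -> P a n) ->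
  exists n0, forall n, (n0 <= n)%N -> forall a, F a -> P a n.
Proof.
move=> /finite_seqP[s ->]; elim: s => [|b s IH] H; first by exists 0%N => n _ a.
have [|n0 H0] := IH; first by move=> a /= sa; apply: H => /=; rewrite inE sa orbT.
have [|n1 H1] := H b; first by rewrite /= inE eqxx.
exists (maxn n0 n1) => n; rewrite geq_max => /andP[h0 h1] a /=; rewrite inE.
by move=> /predU1P[->|sa]; [exact: H1|exact: H0].
Qed.

Lemma is_projection_unit_at n (i : 'I_(rk1 n)) : is_projection (unit_at i).
Proof.
have h := star_hom_comp (star_hom_corner (cfun R) i) (star_hom_mu_c n).
have E : unit_at i = (@mu_c n \o (fun f : cfun R => f *: delta_mx i i)) 1 by rewrite unit_atE.
by rewrite E; split; [rewrite -(star_homS h) star1|rewrite -(star_homM h) mulr1].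
Qed.

Lemma unit_at_fixed n (i : 'I_(rk1 n)) : fixed alpha (unit_at i).
Proof.
rewrite (_ : unit_at i = mu_c (map_mx (fun x => scal x) (delta_mx i i))).
  exact: mu_c_const_fixed.
congr mu; congr (_, _); apply/matrixP => a b; rewrite !mxE.
by case: (_ && _); rewrite ?scal1 ?scal0.
Qed.

(** 1 - p_n is below the minimal diagonal projection, which is below x. *)
Lemma one_sub_proj_le B (x : A) m (i : 'I_(rk1 m)) v : star_subalgebra B ->
  fixed alpha `<=` B -> B v -> B x -> star x = x ->
  cnorm (v * x * star v - unit_at i) < 1 ->
  exists n0, forall n, (n0 <= n)%N -> cuntz_le B (1 - proj n) x.
Proof.
move=> hB fB Bv Bx xs vx; have [n0 H] := one_sub_proj_compare i.
exists n0 => n /H[w fw wE]; apply: (cuntz_le_conj hB (fB _ fw) wE).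
apply: (cuntz_le_of_close hB _ (is_projection_unit_at i) Bv Bx xs vx).
by apply: fB; exact: unit_at_fixed.
Qed.

Lemma star_mul_self (d : A) : star (star d * d) = star d * d.
Proof. by rewrite starM starK. Qed.

Lemma one_sub_proj_le_positive (x : A) : positive x -> cnorm x = 1 ->
  exists n0, forall n, (n0 <= n)%N -> cuntz_le setT (1 - proj n) x.
Proof.
move=> [d _ ->]; rewrite cnorm_star => d2.
have d1 : cnorm d = 1.
  by apply/eqP; rewrite -(@eqrXn2 _ 2%N) // ?(snorm_ge0 hn)// expr1n d2.
have [m [i [v vx]]] := compress_to_unit d1.
exact: (one_sub_proj_le (star_subalgebra_setT A) _ _ _ (star_mul_self d) vx).
Qed.

Lemma normalise (d : A) : d <> 0 -> cnorm (scal ((cnorm d)^-1)%:C * d) = 1.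
Proof.
move=> d0; have dp : cnorm d != 0 by apply/eqP => /cnorm_eq0.
by rewrite cnormZ -/(cmod _) cmodR ger0_norm ?invr_ge0 ?(snorm_ge0 hn)// mulVf.
Qed.

Lemma one_sub_proj_le_fixed (y : A) : positive_in (fixed alpha) y -> y <> 0 ->
  exists n0, forall n, (n0 <= n)%N -> cuntz_le (fixed alpha) (1 - proj n) y.
Proof.
move=> [d fd ->] dd0; have d0 : d <> 0 by move=> d0; apply: dd0; rewrite d0 mulr0.
have [_ _ BM Bc Bs] := fixed_star_subalgebra.
set t := ((cnorm d)^-1)%:C; pose d' := scal t * d.
have fd' : fixed alpha d' by apply: BM => //; exact: Bc.
have [m [i [v [fv vx]]]] := fixed_compress_to_unit (normalise d0) fd'.
apply: (one_sub_proj_le fixed_star_subalgebra (@subset_refl _ _) (v := v * scal t) (i := i)).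
- by apply: BM => //; exact: Bc.
- by apply: BM => //; exact: Bs.
- exact: star_mul_self.
- rewrite (_ : v * scal t * _ * _ = v * (star d' * d') * star v)//.
  have st : star (scal t : A) = scal t by rewrite star_scal_real.
  have -> : star d' * d' = scal t * (star d * d) * scal t.
    by rewrite /d' starM st [scal t * d]scalC -scalC !mulrA.
  by rewrite [star (v * _)]starM st !mulrA.
Qed.

(** For x = d^* d one has |p x p| = |d p|^2, and cnorm_sys gives |a p| >= |a| for
    the elements a of the system. *)
Lemma corner_norm_large (x : A) e : positive x -> cnorm x = 1 -> 0 < e ->
  exists n0, forall n, (n0 <= n)%N -> 1 - e < cnorm (proj n.+1 * x * proj n.+1).
Proof.
move=> [d _ ->]; rewrite cnorm_star => d2 e0.
have d1 : cnorm d = 1.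
  by apply/eqP; rewrite -(@eqrXn2 _ 2%N) // ?(snorm_ge0 hn)// expr1n d2.
pose c := Num.min (e / 8) (1 / 4).
have c0 : 0 < c by rewrite /c lt_min; apply/andP; split; lra.
have ce : c <= e / 8 by rewrite /c ge_min lexx.
have c4 : c <= 1 / 4 by rewrite /c ge_min lexx orbT.
have [n0 H] := mu_dense d c0; exists n0 => n /H[a da].
have -> : proj n.+1 * (star d * d) * proj n.+1 = star (d * proj n.+1) * (d * proj n.+1).
  by have [ps _] := is_projection_proj n.+1; rewrite starM ps !mulrA.
rewrite cnorm_star.
have h1 := cnorm_sys a; rewrite -mul_proj mu_sys_map in h1.
have h2 := cnorm_dist_ge d (mu a); rewrite d1 in h2.
have h3 := cnorm_dist_ge (mu a * proj n.+1) (d * proj n.+1).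
rewrite -mulrBl in h3; have h4 := cnorm_mul_proj_le n.+1 (mu a - d).
rewrite (snorm_dist hn (mu a) d) in h4.
have h5 : 1 - 2 * c <= cnorm (d * proj n.+1) by lra.
apply: (@lt_le_trans _ _ ((1 - 2 * c) ^+ 2)).
  by rewrite expr2; have := sqr_ge0 c; rewrite expr2; lra.
by rewrite ler_pXn2r ?nnegrE ?(snorm_ge0 hn)//; lra.
Qed.

(** The map phi of the theorem: scalar matrices commute with the
    C(S^1)-component, as it is a matrix algebra over a commutative algebra. *)
Definition rokhlin n (f : cfun R) : A := mu_c (f%:M : 'M[cfun R]_(rk1 n)).

Lemma cfun_mulC (f g : cfun R) : f * g = g * f.
Proof. by apply: cfunP => z; rewrite !cevalM mulrC. Qed.

Lemma star_hom_rokhlin n : star_hom (rokhlin n).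
Proof. exact: (star_hom_comp (star_hom_scalar_mx _ _) (star_hom_mu_c n)). Qed.

Lemma rokhlin1 n : rokhlin n 1 = proj n. Proof. by []. Qed.

Lemma rokhlin_contractive n : contractive (rokhlin n).
Proof.
move=> f; apply: (star_hom_contractive hn (star_hom_rokhlin n)) => z.
exact: cfun_norm_ge.
Qed.

Lemma rokhlin_corner n f : corner (proj n) (rokhlin n f).
Proof. by exists (rokhlin n f) => //; rewrite -rokhlin1 -!(star_homM (star_hom_rokhlin n)) mulr1 mul1r. Qed.

Lemma rokhlin_ucp n : ucp (proj n) (rokhlin n).
Proof.
have h := star_hom_rokhlin n; split.
- by case: h.
- exact: rokhlin1.
- exact: rokhlin_corner.
- move=> k X [Y _ ->]; have hM := star_hom_map_mx k h.
  exists (map_mx (rokhlin n) Y); last by rewrite (star_homM hM) (star_homS hM).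
  by move=> i j; rewrite mxE; exact: rokhlin_corner.
Qed.

Lemma rokhlin_equivariant n f z : rokhlin n (translate z f) = alpha z (rokhlin n f).
Proof.
rewrite /rokhlin alpha_mu_c; congr mu_c; apply/matrixP => i j.
by rewrite !mxE (star_homMn (star_hom_translate z)).
Qed.

Lemma rokhlin_central n f (a : Sys n) : rokhlin n f * mu a = mu a * rokhlin n f.
Proof.
rewrite /rokhlin /mu_c mu_pair0 mu_pair0r; congr mu; congr (_, _).
rewrite -diag_const_mx; apply/matrixP => i j.
by rewrite -mulmxE mul_diag_mx mul_mx_diag !mxE cfun_mulC.
Qed.

Lemma rokhlin_almost_central (f : cfun R) (a : A) e : 0 < e ->
  exists n0, forall n, (n0 <= n)%N -> cnorm (rokhlin n f * a - a * rokhlin n f) < e.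
Proof.
move=> e0; have [M M0 fM] := cfun_bounded f.
have K0 : 0 < 2 * (M + 1) by lra.
have [n0 H] := mu_dense a (divr_gt0 e0 K0); exists n0 => n /H[b ab].
have rM : cnorm (rokhlin n f) <= M := star_hom_contractive hn (star_hom_rokhlin n) fM.
have -> : rokhlin n f * a - a * rokhlin n f =
    rokhlin n f * (a - mu b) - (a - mu b) * rokhlin n f.
  by rewrite mulrBr mulrBl rokhlin_central opprB addrA subrK.
apply: le_lt_trans (snormB hn _ _) _.
apply: (@le_lt_trans _ _ (2 * (M + 1) * cnorm (a - mu b))); last by rewrite mulrC -ltr_pdivlMr.
have d0 := snorm_ge0 hn (a - mu b).
have h1 := snormM hn (rokhlin n f) (a - mu b); have h2 := snormM hn (a - mu b) (rokhlin n f).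
have := ler_wpM2r d0 rM; have := ler_wpM2l d0 rM; lra.
Qed.

Lemma rokhlin_conditions (F : set A) (S : set (cfun R)) e :
  finite_set F -> finite_set S -> 0 < e ->
  exists n0, forall n, (n0 <= n)%N -> approx_central_mult alpha F S e (rokhlin n).
Proof.
move=> fF fS e0.
have [n0 H] : exists n0, forall n, (n0 <= n)%N -> forall f, S f ->
    forall a, F a -> cnorm (rokhlin n f * a - a * rokhlin n f) < e.
  apply: finite_eventually => // f _; apply: finite_eventually => // a _.
  exact: rokhlin_almost_central.
exists n0 => n n0n; split=> [f g _ _|f a Sf Fa|f _].
- by rewrite (star_homM (star_hom_rokhlin n)) subrr (snorm0 hn).
- exact: H.
- apply: (@le_lt_trans _ _ 0%E); last by rewrite lte_fin.
  apply: ub_ereal_sup => _ [z _ <-].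
  by rewrite rokhlin_equivariant subrr (snorm0 hn).
Qed.

Definition swap n : A := projT1 (cid (sys_swap n)).

Lemma swapP n : [/\ fixed alpha (swap n), star (swap n) * swap n = 1 - proj n.+1,
  proj n.+1 * swap n = swap n & forall a : Sys n, swap n * mu a = mu a * swap n].
Proof. exact: projT2 (cid (sys_swap n)). Qed.

Lemma is_projection_one_sub (p : A) : is_projection p -> is_projection (1 - p).
Proof.
by move=> [ps pp]; split; rewrite ?starB ?star1 ?ps// mulrBl mul1r mulrBr mulr1 pp subrr subr0.
Qed.

Lemma swap_partial_isometry n : partial_isometry (swap n).
Proof.
rewrite /partial_isometry; have [_ -> _ _] := swapP n.
exact: is_projection_one_sub (is_projection_proj _).
Qed.

(** s p = 0, so s s^* is a projection below p. *)
Lemma swap_below n : positive (proj n.+1 - swap n * star (swap n)).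
Proof.
have [_ ss ps _] := swapP n; have [Ps Pp] := is_projection_proj n.+1.
set s := swap n in ss ps *; set p := proj n.+1 in ss ps Ps Pp *.
have sp : star s * p = star s by rewrite -Ps -starM ps.
have sp0 : s * p = 0.
  apply: cnorm_eq0; apply/eqP; rewrite -sqrf_eq0 -cnorm_star starM Ps.
  by rewrite -mulrA [star s * _]mulrA ss mulrBl mul1r Pp subrr mulr0 (snorm0 hn).
have sss : s * star s * s = s by rewrite -mulrA ss mulrBr mulr1 sp0 subr0.
exists (p - s * star s) => //.
by rewrite starB Ps starM starK mulrBl !mulrBr Pp -!mulrA sp !mulrA ps sss subrr subr0.
Qed.

Lemma cnorm_swap n : cnorm (swap n) <= 1.
Proof. exact: snorm_piso hn _ (swap_partial_isometry n). Qed.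

Lemma swap_almost_central (a : A) e : 0 < e ->
  exists n0, forall n, (n0 <= n)%N -> cnorm (swap n * a - a * swap n) < e.
Proof.
move=> e0; have e2 : 0 < e / 2 by lra.
have [n0 H] := mu_dense a e2; exists n0 => n /H[b ab]; have [_ _ _ sC] := swapP n.
have -> : swap n * a - a * swap n = swap n * (a - mu b) - (a - mu b) * swap n.
  by rewrite mulrBr mulrBl sC opprB addrA subrK.
have s1 := cnorm_swap n; have d0 := snorm_ge0 hn (a - mu b).
have := snormB hn (swap n * (a - mu b)) ((a - mu b) * swap n).
have := snormM hn (swap n) (a - mu b); have := snormM hn (a - mu b) (swap n).
have := ler_wpM2r d0 s1; have := ler_wpM2l d0 s1; lra.
Qed.

Lemma one_sub_proj_le_proj n : cuntz_le (fixed alpha) (1 - proj n.+1) (proj n.+1).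
Proof.
have [sf ss ps _] := swapP n; have [_ _ _ _ Bs] := fixed_star_subalgebra.
by apply: (cuntz_le_const _ (w := star (swap n))); [exact: Bs|rewrite starK -mulrA ps].
Qed.

Lemma Rokhlin_data (F F0 : set A) (S : set (cfun R)) (e : R) (x y : A) :
  finite_set F -> finite_set F0 -> finite_set S -> 0 < e -> positive x -> cnorm x = 1 ->
  positive_in (fixed alpha) y -> y <> 0 ->
  exists (p : A) (phi : cfun R -> A) (s : A),
    [/\ is_projection p, fixed alpha p, ucp p phi /\ contractive phi,
        partial_isometry s /\ fixed alpha s &
        trpc_conditions alpha F S e x y p phi /\ mtrp_conditions alpha F F0 S e x p s phi].
Proof.
move=> fF fF0 fS e0 x0 x1 y0 yn0.
have [n1 H1] := rokhlin_conditions fF fS e0.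
have [n2 H2] := one_sub_proj_le_positive x0 x1.
have [n3 H3] := one_sub_proj_le_fixed y0 yn0.
have [n4 H4] := corner_norm_large x0 x1 e0.
have [n5 H5] : exists n0, forall n, (n0 <= n)%N -> forall a, F0 a ->
    cnorm (swap n * a - a * swap n) < e.
  by apply: finite_eventually => // a _; exact: swap_almost_central.
pose n := (n1 + n2 + n3 + n4 + n5)%N.
exists (proj n.+1), (rokhlin n.+1), (swap n).
have [sf ss _ _] := swapP n.
have C1 : approx_central_mult alpha F S e (rokhlin n.+1) by apply: H1; rewrite /n; lia.
have C2 : cuntz_le setT (1 - proj n.+1) x by apply: H2; rewrite /n; lia.
have C4 : 1 - e < cnorm (proj n.+1 * x * proj n.+1) by apply: H4; rewrite /n; lia.
split.
- exact: is_projection_proj.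
- exact: proj_fixed.
- by split; [exact: rokhlin_ucp|exact: rokhlin_contractive].
- by split; [exact: swap_partial_isometry|].
- split; split=> //.
  + by apply: H3; rewrite /n; lia.
  + exact: one_sub_proj_le_proj.
  + by split; [|exact: swap_below].
  + by apply: H5; rewrite /n; lia.
Qed.

(** * Simplicity, infinite dimension, separability *)

Lemma rk1_mx_units n : proj n = \sum_(j < rk1 n) unit_at j.
Proof.
rewrite /proj -[mu (0, 1)]/(mu_c 1) -(star_hom_sum (star_hom_mu_c n)); congr mu_c.
apply/matrixP => i j; rewrite summxE (bigD1 i)//= !mxE eqxx big1 ?addr0.
  by rewrite eq_sym.
by move=> k ki; rewrite mxE eq_sym (negPf ki).
Qed.

Lemma unit_at_move n (i j : 'I_(rk1 n)) :
  mu_c (delta_mx j i) * unit_at i * mu_c (delta_mx i j) = unit_at j.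
Proof.
by rewrite unit_atE scale1r -!(star_homM (star_hom_mu_c n)) -!mulmxE !mul_delta_mx unit_atE scale1r.
Qed.

(** A nonzero ideal contains a minimal diagonal projection, by compress_to_unit
    and closedness, hence some p_{m+1}, hence also 1 - p_{m+1} by swap. *)
Lemma simple : simple_algebra A.
Proof.
split; first exact: limit_one_neq0.
move=> I [I0 ID IM Icl]; have [|] := pselect (exists2 a, I a & a <> 0); last first.
  move=> h; left; apply/seteqP; split=> [a Ia|_ -> //].
  by apply: contrapT => a0; apply: h; exists a.
move=> [a Ia a0]; right; apply/seteqP; split=> // b _.
set d := scal ((cnorm a)^-1)%:C * a.
have Idd : I (star d * d) by apply: (proj2 (IM _ _ _)); apply: (proj2 (IM _ _ _)).
have [m [i [v vd]]] := compress_to_unit (normalise a0).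
have [u _ ud] : cuntz_le setT (unit_at i) (star d * d).
  exact: (cuntz_le_of_close (star_subalgebra_setT A) _ (is_projection_unit_at i) _ _
    (star_mul_self d) vd).
have Ii : I (unit_at i).
  by apply: Icl ud => n; apply: (proj1 (IM _ _ _)); apply: (proj2 (IM _ _ _)).
have Ip : I (proj m.+1).
  rewrite rk1_mx_units; apply: big_ind => // j _; rewrite -(unit_at_move i).
  by apply: (proj1 (IM _ _ _)); apply: (proj2 (IM _ _ _)).
have [_ ss ps _] := swapP m.
have I1 : I 1.
  rewrite -[1](subrK (proj m.+1)); apply: ID => //; rewrite -ss -ps.
  by apply: (proj2 (IM _ _ _)); apply: (proj1 (IM _ _ _)).
by rewrite -[b]mulr1; apply: (proj2 (IM _ _ _)).
Qed.

Lemma proj_neq0 n : proj n.+1 <> 0.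
Proof.
move=> p0; apply: limit_one_neq0; have [_ ss ps _] := swapP n.
by rewrite -[1](subrK (proj n.+1)) -ss -ps p0 mul0r mulr0 addr0.
Qed.

Lemma unit_at_neq0 n (i : 'I_(rk1 n.+1)) : unit_at i <> 0.
Proof.
move=> i0; apply: (@proj_neq0 n); rewrite rk1_mx_units big1// => j _.
by rewrite -(unit_at_move i) i0 mulr0 mul0r.
Qed.

Lemma unit_at_mul n (i j : 'I_(rk1 n)) : unit_at i * unit_at j = unit_at i *+ (i == j).
Proof.
rewrite !unit_atE !scale1r -(star_homM (star_hom_mu_c n)) -(star_homMn (star_hom_mu_c n)).
by rewrite -mulmxE mul_delta_mx_cond; case: eqP => [->|].

Qed.

(** The minimal diagonal projections of A_{n+1} are more than n orthogonal
    nonzero elements. *)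
Lemma infinite_dim : infinite_dimensional A.
Proof.
move=> [n [b Hb]].
have rn : (n < rk1 n.+1)%N := ltn_trans (ltnSn n) (rk1_large n.+1).
pose f (j : 'I_n.+1) := unit_at (widen_ord rn j).
have /choice[C HC] j : exists c : 'I_n -> R[i], f j = \sum_(i < n) scal (c i) * b i by exact: Hb.
pose M : 'M[R[i]]_(n.+1, n) := \matrix_(j, i) C j i.
have : kermx M != 0.
  by rewrite kermx_eq0 /row_free neq_ltn ltnS rank_leq_col.
move=> /rowV0Pn[w /sub_kermxP wM w0].
have wf : \sum_j scal (w 0 j) * f j = 0.
  under eq_bigr => j _ do rewrite HC mulr_sumr.
  rewrite exchange_big big1 //= => i _.
  under eq_bigr => j _ do rewrite mulrA -scalM.
  rewrite -mulr_suml -(big_morph _ (@scalD R A) (scal0 A)).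
  have -> : \sum_j w 0 j * C j i = (w *m M) 0 i.
    by rewrite mxE; apply: eq_bigr => j _; rewrite mxE.
  by rewrite wM mxE scal0 mul0r.
case/negP: w0; apply/eqP/rowP => k; rewrite mxE; apply: contrapT => wk.
apply: (@unit_at_neq0 n (widen_ord rn k)).
have : (\sum_j scal (w 0 j) * f j) * f k = 0 by rewrite wf mul0r.
rewrite mulr_suml (bigD1 k)//= big1 ?addr0.
  rewrite -mulrA unit_at_mul eqxx mulr1n => /(congr1 (fun a => scal (w 0 k)^-1 * a)).
  by rewrite mulr0 mulrA -scalM mulVf ?scal1 ?mul1r//; apply/eqP.
move=> j jk; rewrite -mulrA unit_at_mul (_ : (_ == _) = false) ?mulr0n ?mulr0//.
by apply/negbTE; apply: contra jk => /eqP/(congr1 val)/= h; apply/eqP/val_inj.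
Qed.

(** 1 - p_{n+1} = s^* s, so the R-component of mu a is recovered from the
    C(S^1)-component by swap; therefore only matrices of functions have to be
    approximated for the separability of A. *)
Lemma mu_swap n (a : Sys n) : let c := mu_c (sys_map theta a).2 in
  mu a = c + star (swap n) * c * swap n.
Proof.
have [_ ss ps sC] := swapP n; rewrite /=.
have -> : mu_c (sys_map theta a).2 = proj n.+1 * mu a by rewrite -(mu_sys_map a) proj_mul.
by rewrite !mulrA -[_ * mu a * _]mulrA -sC mulrA -[star _ * _ * _]mulrA ps ss -mulrDl addrC subrK mul1r.
Qed.

Lemma separable : separable_algebra A.
Proof.
pose C := (nat * nat * seq (rat * rat))%type.
pose X (t : {n : nat & 'M[C]_(rk1 n.+1)}) : A :=
  let c := mu_c (map_mx (@dense_cfun R) (tagged t)) in c + star (swap (tag t)) * c * swap (tag t).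
exists (range X) => [|a e e0].
  exact: card_le_trans (card_image_le _ _) (countableP _).
have e3 : 0 < e / 3 by lra.
have [n /(_ n (leqnn n))[a' aa']] := mu_dense a e3.
set c := (sys_map theta a').2.
have rp : 0 < (rk1 n.+1 * rk1 n.+1)%:R :> R by rewrite ltr0n muln_gt0 rk1_gt0.
have /choice[M HM] (ij : 'I_(rk1 n.+1) * 'I_(rk1 n.+1)) : exists t : C, forall z,
    cmod (ceval z (c ij.1 ij.2) - ceval z (dense_cfun R t)) <= e / 3 / (rk1 n.+1 * rk1 n.+1)%:R.
  by apply: dense_cfunP; rewrite divr_gt0.
pose T : 'M[C]_(rk1 n.+1) := \matrix_(i, j) M (i, j).
pose t : {n : nat & 'M[C]_(rk1 n.+1)} := existT _ n T.
exists (X t); first by exists t.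
have cT : cnorm (mu_c c - mu_c (map_mx (@dense_cfun R) T)) <= e / 3.
  apply: mu_c_close => i j z; rewrite [map_mx _ _ i j](_ : _ = dense_cfun R (M (i, j))).
    exact: (HM (i, j) z).
  by rewrite !mxE.
apply: le_lt_trans (snorm_tri hn (mu a') _ _) _.
rewrite [in Y in _ + Y]mu_swap /X /= -/c; set d := mu_c (map_mx _ T) in cT *.
rewrite opprD addrACA -mulrBl -mulrBr.
have := snormD hn (mu_c c - d) (star (swap n) * (mu_c c - d) * swap n).
have := cnorm_conj_le (swap n) (mu_c c - d).
have : cnorm (swap n) ^+ 2 * cnorm (mu_c c - d) <= cnorm (mu_c c - d).
  by rewrite ler_piMl ?(snorm_ge0 hn)// exprn_ile1 ?(snorm_ge0 hn)// cnorm_swap.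
move: aa' cT; lra.
Qed.

Lemma admissible : admissible_algebra A.
Proof. by split; [exact: infinite_dim|exact: simple|exact: separable]. Qed.
End System.

Theorem proposition5p28 (R : realType) (N : nat) (theta : R) (r0 r1 : nat)
    (l : 'I_2 -> 'I_2 -> nat -> nat)
    (A : cstarType R) (mu : forall n, sysA R N r0 r1 l n -> A)
    (alpha : circle R -> A -> A) :
  (2 <= N)%N -> irrational theta -> (0 < r0)%N -> (0 < r1)%N ->
  (forall j k n, (0 < l j k n)%N) ->
  is_direct_limit (@sys_map R N theta r0 r1 l) mu ->
  is_action alpha ->
  (forall n z a, alpha z (mu n a) = mu n (sys_action z a)) ->
  (r0 <= r1)%N ->
  (forall n, [/\ (l 0%R 0%R n <= l 1%R 0%R n)%N, (l 0%R 0%R n <= l 0%R 1%R n)%N,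
                 (l 0%R 1%R n <= l 1%R 1%R n)%N & (l 1%R 0%R n <= l 1%R 1%R n)%N]) ->
  ((l 0 1 n)%:R / (l 0 0 n)%:R : R) @[n --> \oo] --> +oo ->
  ((l 1 1 n)%:R / (l 1 0 n)%:R : R) @[n --> \oo] --> +oo ->
  [/\ tracial_Rokhlin_with_comparison alpha,
      modified_tracial_Rokhlin alpha &
      forall (F F0 : set A) (S : set (cfun R)) (e : R) (x y : A),
        finite_set F -> finite_set F0 -> F0 `<=` fixed alpha ->
        finite_set S -> 0 < e -> positive x -> cnorm x = 1 ->
        positive_in (fixed alpha) y -> y <> 0 ->
        exists (p : A) (phi : cfun R -> A) (s : A),
          [/\ is_projection p, fixed alpha p,
              ucp p phi /\ contractive phi,
              partial_isometry s /\ fixed alpha s &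
              trpc_conditions alpha F S e x y p phi /\
              mtrp_conditions alpha F F0 S e x p s phi]].
Proof.
move=> N2 irr _ r1_gt0 l_gt0 lim act equiv r01 l_le lim0 lim1.
have adm : admissible_algebra A := admissible N2 r1_gt0 l_gt0 lim equiv l_le r01 irr.
have data := Rokhlin_data N2 r1_gt0 l_gt0 lim act equiv l_le r01 lim0 lim1 irr.
split.
- split=> // F S e x y fF fS e0 x0 x1 y0 yn0.
  have [p [phi [s [pp pf [u _] _ [c _]]]]] := data _ _ _ _ _ _ fF (finite_set0 A) fS e0 x0 x1 y0 yn0.
  by exists p, phi.
- split=> // F1 F2 S e x fF1 fF2 _ fS e0 x0 x1.
  have one_pos : positive_in (fixed alpha) 1.
    exists 1; last by rewrite star1 mulr1.
    by have [] := fixed_star_subalgebra lim act equiv.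
  have [_ [one_neq0 _] _] := adm.
  have [p [phi [s [pp pf [u cc] [sp sf] [_ c]]]]] :=
    data _ _ _ _ _ _ fF1 fF2 fS e0 x0 x1 one_pos one_neq0.
  by exists p, s, phi.
- by move=> F F0 S e x y fF fF0 _; exact: data.
Qed.
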